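(* Let $(M,\Gamma)$ be a Hopf--von Neumann algebra such that $M$ is subhomogeneous. Then $\mathcal{WAP}(M_\ast)$ is a $C^\ast$-subalgebra of $M$.
   Context: A Hopf--von Neumann algebra is a pair $(M,\Gamma)$ where $M$ is a von Neumann algebra and $\Gamma : M \to M \bar{\otimes} M$ is a faithful, normal, unital $^\ast$-homomorphism with $(\Gamma \otimes \mathrm{id}) \circ \Gamma = (\mathrm{id} \otimes \Gamma) \circ \Gamma$. The predual $M_\ast$ is a (completely contractive) Banach algebra under $\langle f \ast g, x \rangle := \langle f \otimes g, \Gamma x\rangle$ ($f,g \in M_\ast$, $x \in M$), and $(M_\ast)^\ast = M$. A von Neumann algebra is subhomogeneous if it has the form $M_{n_1}(A_1) \oplus \cdots \oplus M_{n_k}(A_k)$ with $n_1,\ldots,n_k \in \mathbb{N}$ and abelian von Neumann algebras $A_1,\ldots,A_k$. For a Banach algebra $A$, $A^\ast$ is a Banach $A$-bimodule via $\langle a\cdot\phi, b\rangle = \langle \phi, ba\rangle$ and $\langle \phi\cdot a, b\rangle = \langle \phi, ab\rangle$. A functional $\phi \in A^\ast$ is weakly almost periodic if $A \to A^\ast$, $a \mapsto a \cdot \phi$, is weakly compact (equivalently, $a \mapsto \phi\cdot a$ is weakly compact); $\mathcal{WAP}(A)$ is the set of all such $\phi$. *)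

(* Defs.v *)
From HB Require Import structures.
From mathcomp Require Import all_boot all_order all_algebra.
From mathcomp Require Import complex ring lra.
From mathcomp Require Import boolp classical_sets functions reals topology.
From mathcomp Require Import normedtype sequences.
Set Implicit Arguments.
Unset Strict Implicit.
Unset Printing Implicit Defensive.
Import Order.TTheory GRing.Theory Num.Theory.
Import numFieldNormedType.Exports.
Local Open Scope classical_set_scope.
Local Open Scope ring_scope.

Section BoundedOperators.
Variables (R : realType) (V W : normedModType R[i]).

Definition bounded_linear (f : V -> W) : Prop := linear f /\ continuous f.

Definition bop_pred : {pred V -> W} := fun f => `[< bounded_linear f >].

Record bop := Bop { bop_fun :> V -> W; _ : bop_fun \in bop_pred }.

HB.instance Definition _ := [isSub for bop_fun].
HB.instance Definition _ := [Choice of bop by <:].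

Lemma bop_submod : GRing.subsemimod_closed bop_pred.
Proof.
split; [split |].
- apply/asboolP; split; last exact: cst_continuous.
  by move=> a x y /=; rewrite scaler0 addr0.
- move=> f g /asboolP[lf cf] /asboolP[lg cg]; apply/asboolP; split.
    by move=> a x y; rewrite !fctE lf lg scalerDr addrACA.
  by move=> x; apply: cvgD; [exact: cf | exact: cg].
- move=> a f /asboolP[lf cf]; apply/asboolP; split.
    by move=> b x y; rewrite !fctE lf scalerDr !scalerA [a * b]mulrC.
  by move=> x; apply: cvgZl_tmp; exact: cf.
Qed.

HB.instance Definition _ := GRing.isSubmodClosed.Build R[i] (V -> W) bop_pred
  bop_submod.
HB.instance Definition _ := [SubChoice_isSubLmodule of bop by <:].

Lemma bopP (f : bop) : bounded_linear f.
Proof. by case: f => f /= /asboolP. Qed.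

Lemma bop_eqP (f g : bop) : (f : V -> W) =1 g -> f = g.
Proof. by move=> fg; apply/val_inj/funext. Qed.

HB.instance Definition _ (f : bop) :=
  GRing.isLinear.Build R[i] V W *:%R f (bopP f).1.

Lemma bopD (f g : bop) x : (f + g) x = f x + g x. Proof. by []. Qed.

Lemma bopZ a (f : bop) x : (a *: f) x = a *: f x. Proof. by []. Qed.

Lemma normRe (U : normedModType R[i]) (x : U) : `|x| = (complex.Re `|x|)%:C%C.
Proof. by rewrite RRe_real// normr_real. Qed.

Lemma bop_bounded (f : bop) : exists2 M : R, 0 <= M &
  forall x, complex.Re `|f x| <= M * complex.Re `|x|.
Proof.
have /linear_bounded_continuous/linear_boundedP := (bopP f).2.
move=> /pinfty_ex_gt0[M M0 fM]; exists (complex.Re M).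
  by move: M0; rewrite ltcE => /andP[_ /ltW].
move=> x; rewrite -lecR rmorphM/= -!normRe RRe_real ?fM//.
by rewrite realE ltW.
Qed.

(* The library's norms on a module over K take values in K, hence %:C. *)
Definition opnorm (f : bop) : R[i] :=
  (sup [set complex.Re `|f x| | x in [set x | `|x| <= 1]])%:C%C.

Lemma opnorm_has_sup (f : bop) :
  has_sup [set complex.Re `|f x| | x in [set x | `|x| <= 1]].
Proof.
split; first by exists (complex.Re `|f 0|), 0 => //=; rewrite normr0.
have [M M0 fM] := bop_bounded f; exists M => _ [x /= x1 <-].
apply: (le_trans (fM x)); rewrite -[leRHS]mulr1 ler_wpM2l//.
by move: x1; rewrite lecE => /andP[].
Qed.

Lemma opnorm_ge0 f : 0 <= opnorm f.
Proof.
rewrite ler0c; apply: (@le_trans _ _ (complex.Re `|f 0|)).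
  by rewrite linear0 normr0.
apply: ub_le_sup; first exact: (opnorm_has_sup f).2.
by exists 0 => //=; rewrite normr0.
Qed.

Lemma opnormP (f : bop) x : `|f x| <= opnorm f * `|x|.
Proof.
have [->|x0] := eqVneq x 0; first by rewrite linear0 !normr0 mulr0.
rewrite -ler_pdivrMr ?normr_gt0// mulrC -[`|x|^-1]ger0_norm ?invr_ge0//.
rewrite -normrZ -linearZ/= [leLHS]normRe lecR.
apply: ub_le_sup; first exact: (opnorm_has_sup f).2.
by exists (`|x|^-1 *: x) => //=; rewrite normrZ normfV normr_id mulVf ?normr_eq0.
Qed.

Lemma opnorm_le (f : bop) M :
  (forall x, `|f x| <= M * `|x|) -> 0 <= M -> opnorm f <= M.
Proof.
move=> fM M0; rewrite -[leRHS]RRe_real ?ger0_real// lecR.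
apply: ge_sup; first exact: (opnorm_has_sup f).1.
move=> _ [x /= x1 <-]; rewrite -lecR -normRe RRe_real ?ger0_real//.
by rewrite (le_trans (fM x))// -[leRHS]mulr1 ler_wpM2l.
Qed.

Lemma opnormD f g : opnorm (f + g) <= opnorm f + opnorm g.
Proof.
apply: opnorm_le => [x|]; last by rewrite addr_ge0 ?opnorm_ge0.
by rewrite (le_trans (ler_normD _ _))// mulrDl lerD ?opnormP.
Qed.

Lemma opnormZ a f : opnorm (a *: f) = `|a| * opnorm f.
Proof.
have le b g : opnorm (b *: g) <= `|b| * opnorm g.
  apply: opnorm_le => [x|]; last by rewrite mulr_ge0 ?opnorm_ge0.
  by rewrite bopZ normrZ -mulrA ler_wpM2l ?opnormP.
apply/le_anti; rewrite le /=; have [->|a0] := eqVneq a 0.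
  by rewrite normr0 mul0r opnorm_ge0.
have := le a^-1 (a *: f); rewrite scalerA mulVf// scale1r normfV.
by rewrite ler_pdivlMl ?normr_gt0.
Qed.

Lemma opnorm0_eq0 f : opnorm f = 0 -> f = 0.
Proof.
move=> f0; apply: bop_eqP => x; apply/eqP; rewrite -normr_le0.
by rewrite (le_trans (opnormP f x))// f0 mul0r.
Qed.

HB.instance Definition _ := Lmodule_isNormed.Build R[i] bop
  opnormD opnormZ opnorm0_eq0.

Lemma bop_predP (f : V -> W) (M : R[i]) :
  linear f -> 0 <= M -> (forall x, `|f x| <= M * `|x|) -> f \in bop_pred.
Proof.
move=> lf M0 fM; apply/asboolP; split => //.
pose F : {linear V -> W} := HB.pack f (GRing.isLinear.Build _ _ _ _ f lf).
apply: (@bounded_linear_continuous _ _ _ F); apply/linear_boundedP.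
near=> r => x; rewrite (le_trans (fM x))// ler_wpM2r//.
by near: r; apply: nbhs_pinfty_ge; rewrite ger0_real.
Unshelve. all: by end_near. Qed.

End BoundedOperators.

Section Endomorphisms.
Variables (R : realType) (V : normedModType R[i]).
Local Notation B := (bop V V).

Lemma bop_idP : (@id V) \in @bop_pred R V V.
Proof. by apply/asboolP; split => // x; exact: cvg_id. Qed.

Lemma bop_compP (f g : B) : f \o g \in @bop_pred R V V.
Proof.
apply/asboolP; split; first by move=> a x y; rewrite /= !linearP.
by move=> x; apply: continuous_comp; [apply: (bopP g).2 | apply: (bopP f).2].
Qed.

Definition bop1 : B := Bop bop_idP.
Definition bopM (f g : B) : B := Bop (bop_compP f g).

Lemma bopMA : associative bopM. Proof. by move=> f g h; exact: bop_eqP. Qed.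
Lemma bop1M : left_id bop1 bopM. Proof. by move=> f; exact: bop_eqP. Qed.
Lemma bopM1 : right_id bop1 bopM. Proof. by move=> f; exact: bop_eqP. Qed.
Lemma bopMDl : left_distributive bopM +%R.
Proof. by move=> f g h; exact: bop_eqP. Qed.
Lemma bopMDr : right_distributive bopM +%R.
Proof. by move=> f g h; apply: bop_eqP => x; exact: linearD. Qed.

HB.instance Definition _ := GRing.Zmodule_isPzRing.Build B
  bopMA bop1M bopM1 bopMDl bopMDr.

Lemma bopME (f g : B) x : (f * g) x = f (g x). Proof. by []. Qed.

Lemma bopMZl a (f g : B) : (a *: f) * g = a *: (f * g).
Proof. exact: bop_eqP. Qed.

Lemma bopMZr a (f g : B) : f * (a *: g) = a *: (f * g).
Proof. by apply: bop_eqP => x; exact: linearZ. Qed.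

End Endomorphisms.

(* The inner product is linear in its first argument. *)
HB.mixin Record isHilbert (R : realType) H of CompleteNormedModule R[i] H := {
  inner : H -> H -> R[i];
  innerPl : forall a x y z, inner (a *: x + y) z = a * inner x z + inner y z;
  innerC : forall x y, inner y x = (inner x y)^*;
  inner_norm : forall x, inner x x = `|x| ^+ 2
}.

#[short(type="hilbertType")]
HB.structure Definition Hilbert (R : realType) :=
  { H of CompleteNormedModule R[i] H & isHilbert R H }.

Notation dual V := (bop V (_[i]^o)).

Section HilbertSpaces.
Variables (R : realType) (H : hilbertType R).
Implicit Types (x y z : H).

Lemma innerDl x y z : inner (x + y) z = inner x z + inner y z.
Proof. by rewrite -{1}[x]scale1r innerPl mul1r. Qed.

Lemma inner0l z : inner 0 z = 0.
Proof. by apply: (@addrI _ (inner 0 z)); rewrite -innerDl !addr0. Qed.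

Lemma innerZl a x z : inner (a *: x) z = a * inner x z.
Proof. by rewrite -[a *: x]addr0 innerPl inner0l addr0. Qed.

Lemma innerNl x z : inner (- x) z = - inner x z.
Proof. by rewrite -scaleN1r innerZl mulN1r. Qed.

Lemma innerDr x y z : inner x (y + z) = inner x y + inner x z.
Proof. by rewrite innerC innerDl rmorphD/= -!innerC. Qed.

Lemma innerZr a x z : inner x (a *: z) = a^* * inner x z.
Proof. by rewrite innerC innerZl rmorphM/= -innerC. Qed.

Lemma innerNr x z : inner x (- z) = - inner x z.
Proof. by rewrite innerC innerNl rmorphN/= -innerC. Qed.

Lemma inner0r x : inner x 0 = 0. Proof. by rewrite innerC inner0l rmorph0. Qed.

Lemma inner_eq0 x : (forall y, inner y x = 0) -> x = 0.
Proof.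
move=> x0; apply/eqP; rewrite -normr_eq0 -sqrf_eq0 -inner_norm.
by apply/eqP; exact: x0.
Qed.

Lemma inner_eq x y : (forall z, inner z x = inner z y) -> x = y.
Proof.
move=> xy; apply/eqP; rewrite -subr_eq0; apply/eqP; apply: inner_eq0 => z.
by rewrite innerDr innerNr xy subrr.
Qed.

Lemma inner_proj x k : k != 0 ->
  `|x - (inner x k / `|k| ^+ 2) *: k| ^+ 2
    = `|x| ^+ 2 - `|inner x k| ^+ 2 / `|k| ^+ 2.
Proof.
move=> k0; have n0 : `|k| ^+ 2 != 0 by rewrite sqrf_eq0 normr_eq0.
rewrite -inner_norm !(innerDl, innerDr, innerNl, innerNr, innerZl, innerZr).
rewrite !inner_norm [inner k x]innerC rmorphM/= fmorphV/=.
rewrite (_ : (`|k| ^+ 2)^* = `|k| ^+ 2); last first.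
  by rewrite geC0_conj// exprn_ge0.
by rewrite normCK; field; rewrite -normr_eq0 normr_id normr_eq0.
Qed.

Lemma cauchy_schwarz x y : `|inner x y| <= `|x| * `|y|.
Proof.
have [->|y0] := eqVneq y 0; first by rewrite inner0r !normr0 mulr0.
have y2 : 0 < `|y| ^+ 2 by rewrite exprn_gt0// normr_gt0.
rewrite -(@ler_pXn2r _ 2)// ?nnegrE ?mulr_ge0// exprMn -ler_pdivrMr//.
by rewrite -subr_ge0 -inner_proj// exprn_ge0.
Qed.

Lemma parallelogram x y :
  `|x + y| ^+ 2 + `|x - y| ^+ 2 = 2 * `|x| ^+ 2 + 2 * `|y| ^+ 2.
Proof. by rewrite -!inner_norm !(innerDl, innerDr, innerNl, innerNr); ring. Qed.

Lemma riesz (f : dual H) : exists z, forall x, f x = inner x z.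
Proof.
have [f0|/existsNP[x0 fx0]] := pselect (forall x, f x = 0).
  by exists 0 => x; rewrite f0 inner0r.
pose S := [set x | f x = 1].
have [q qE] : {q : H -> R & forall x, `|x| ^+ 2 = (q x)%:C%C}.
  by exists (fun x => complex.Re `|x| ^+ 2) => x; rewrite rmorphXn/= -normRe.
have q0 x : 0 <= q x by rewrite -ler0c -qE exprn_ge0.
have Sn0 : (q @` S) !=set0.
  exists (q ((f x0)^-1 *: x0)), ((f x0)^-1 *: x0) => //.
  by rewrite /S/= linearZ/= /GRing.scale/= mulVf//; apply/eqP.
have Slb : has_lbound (q @` S) by exists 0 => _ [x _ <-].
pose d := inf (q @` S).
have dle x : S x -> d <= q x by move=> Sx; apply: ge_inf => //; exists x.
have d0 : 0 <= d by apply: lb_le_inf => // _ [x _ <-].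
have ker u k : S u -> f k = 0 -> forall s, S (u + s *: k).
  by move=> Su fk s; rewrite /S/= linearD linearZ/= fk scaler0 addr0.
have [u uS] : {u : nat -> H & forall n, S (u n) /\ q (u n) < d + n.+1%:R^-1}.
  apply: (@choice _ _ (fun n x => S x /\ q x < d + n.+1%:R^-1)) => n.
  have n0 : 0 < n.+1%:R^-1 :> R by rewrite invr_gt0.
  by have [_ [x Sx <-] qx] := inf_adherent n0 (conj Sn0 Slb); exists x.
have par x y : q (x + y) + q (x - y) = 2 * q x + 2 * q y.
    apply: complexI; rewrite !rmorphD/= !rmorphM/= !rmorph_nat -!qE.
    exact: parallelogram.
  have qhalf x : q (2^-1 *: x) = 4^-1 * q x.
    apply: complexI; rewrite -[LHS]qE normrZ exprMn qE rmorphM/= fmorphV.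
    by rewrite normfV normr_nat exprVn -natrX rmorph_nat.
  have dist n m : q (u n - u m) <= 2 * n.+1%:R^-1 + 2 * m.+1%:R^-1.
    have [[Sn qn] [Sm qm]] := (uS n, uS m).
    have Snm : S (2^-1 *: (u n + u m)).
      rewrite /S/= linearZ linearD/= Sn Sm; apply: mulVf.
      by rewrite pnatr_eq0.
    have := dle _ Snm; rewrite qhalf.
    move: (par (u n) (u m)) qn qm.
    move: (q (_ + _)) (q (_ - _)) (q (u n)) (q (u m)) (_^-1) (_^-1) => *; lra.
have qC e : 0 < e -> exists2 r : R, 0 < r & e = r%:C%C.
    move=> e0; exists (complex.Re e); first by move: e0; rewrite ltcE => /andP[].
    by rewrite RRe_real// gtr0_real.
  have near0 (r : R) : 0 < r -> exists N : nat,
      forall n, (N <= n)%N -> 4 * n.+1%:R^-1 < r.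
    move=> r0; exists (Num.truncn (4 / r)) => n Nn.
    rewrite ltr_pdivrMr// mulrC -ltr_pdivrMr// (lt_le_trans (truncnS_gt _))//.
    by rewrite ler_nat ltnS.
  have [p up] : exists p : H, u @ \oo --> p.
    apply/cvg_ex; apply: (@cauchy_cvg H); apply: cauchy_exP => e e0.
    have [r r0 ->] := qC _ e0; have [N rN] := near0 (r ^+ 2) (exprn_gt0 2 r0).
    exists (u N); exists N => // n /= Nn; rewrite -ball_normE/=.
    suff : q (u N - u n) < r ^+ 2.
      rewrite -ltcR -qE rmorphXn/= ltr_pXn2r//; first exact: normr_ge0.
      by rewrite nnegrE ler0c ltW.
    apply: (le_lt_trans (dist N n)).
    apply: le_lt_trans (rN N (leqnn N)).
    have : n.+1%:R^-1 <= N.+1%:R^-1 :> R.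
      by rewrite lef_pV2 ?posrE// ler_nat ltnS.
    by move: (_^-1) (_^-1) => *; lra.
  have Sp : S p.
    have fu : f \o u @ \oo --> f p.
      by apply: (cvg_comp _ _ up); exact: (bopP f).2.
    apply: (cvg_unique (@norm_hausdorff _ R[i]^o) fu).
    apply: cvg_near_cst; apply: nearW => n /=.
    by have [] := uS n.
  have qp : q p <= d.
    rewrite leNgt; apply/negP => dp.
    have r0 : 0 < (q p - d) / 2 by rewrite divr_gt0// subr_gt0.
    have nu : `|u n| ^+ 2 @[n --> \oo] --> (`|p| ^+ 2 : R[i]^o).
      by apply: cvgM; exact: cvg_norm.
    have rC : 0 < ((q p - d) / 2)%:C%C by rewrite ltcR.
    have unear := @cvgr_dist_lt _ R[i]^o _ _ _ _ _ nu _ rC.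
    have [N rN] := near0 _ r0.
    near \oo => n.
    have : `|(`|p| ^+ 2 - `|u n| ^+ 2 : R[i])| < ((q p - d) / 2)%:C%C.
      by near: n; exact: unear.
    rewrite !qE -rmorphB => /(le_lt_trans (real_ler_norm _)).
    rewrite ltcR complex_real eqxx => /(_ isT).
    have : 4 * n.+1%:R^-1 < (q p - d) / 2.
      by apply: rN; near: n; exact: nbhs_infty_ge.
    have : 0 < n.+1%:R^-1 :> R by rewrite invr_gt0.
    have [_] := uS n.
    by move: (q (u n)) (_^-1); clear Sp fx0 => *; lra.
  have pker k : f k = 0 -> inner k p = 0.
    move=> fk; have [->|k0] := eqVneq k 0; first by rewrite inner0l.
    have := dle _ (ker _ _ Sp fk (- (inner p k / `|k| ^+ 2))).
    move=> /(le_trans qp); rewrite scaleNr -lecR -!qE inner_proj//.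
    rewrite -subr_ge0 addrAC subrr sub0r oppr_ge0 => h.
    have : `|inner p k| ^+ 2 / `|k| ^+ 2 == 0.
      by apply/eqP/le_anti; rewrite h divr_ge0// exprn_ge0.
    rewrite mulf_eq0 invr_eq0 !sqrf_eq0 !normr_eq0 (negPf k0) orbF => /eqP pk.
    by rewrite innerC pk rmorph0.
  have p0 : p != 0.
    apply/eqP => p0; move: Sp; rewrite p0 /S/= linear0 => /eqP.
    by rewrite eq_sym oner_eq0.
  exists ((`|p| ^+ 2)^-1 *: p) => x.
  have : inner (x - f x *: p) p = 0.
    apply: pker; rewrite linearB linearZ/= Sp.
    by rewrite /GRing.scale/= mulr1 subrr.
  rewrite innerDl innerNl innerZl inner_norm => /eqP; rewrite subr_eq0 => /eqP h.
  rewrite innerZr h fmorphV/= geC0_conj ?exprn_ge0//.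
  by rewrite mulrC mulfK// sqrf_eq0 normr_eq0.
Unshelve. all: by end_near. Qed.

Lemma adjoint_ex (a : bop H H) :
  exists b : bop H H, forall x y, inner (a x) y = inner x (b y).
Proof.
have ex y : exists z, forall x, inner (a x) y = inner x z.
  have ly : linear (fun x => inner (a x) y : R[i]^o).
    by move=> c u v; rewrite linearP innerPl.
  have by_ : forall x, `|inner (a x) y : R[i]^o| <= opnorm a * `|y| * `|x|.
    move=> x; rewrite (le_trans (cauchy_schwarz _ _))// mulrAC.
    by rewrite ler_wpM2r// opnormP.
  have M0 : 0 <= opnorm a * `|y| by rewrite mulr_ge0// opnorm_ge0.
  have [z az] := riesz (Bop (bop_predP ly M0 by_)).
  by exists z.
have [b ab] := choice ex.
have lb : linear b.
  move=> c u v; apply: inner_eq => z.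
  by rewrite -ab !(innerDr, innerZr) !ab.
suff bb x : `|b x| <= opnorm a * `|x|.
  by exists (Bop (bop_predP lb (opnorm_ge0 a) bb)).
have [->|bx0] := eqVneq (b x) 0.
  by rewrite normr0 mulr_ge0// opnorm_ge0.
rewrite -(@ler_pM2l _ `|b x|) ?normr_gt0// -expr2 -inner_norm -ab.
have /ger0_norm <- : 0 <= inner (a (b x)) x by rewrite ab inner_norm exprn_ge0.
rewrite (le_trans (cauchy_schwarz _ _))// mulrA ler_wpM2r// mulrC.
exact: opnormP.
Qed.

Definition adj (a : bop H H) : bop H H := projT1 (cid (adjoint_ex a)).

Lemma adjE (a : bop H H) x y : inner (a x) y = inner x (adj a y).
Proof. by rewrite /adj; case: cid. Qed.

Lemma adjEr (a : bop H H) x y : inner x (a y) = inner (adj a x) y.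
Proof. by rewrite innerC adjE -innerC. Qed.

Lemma adjK : involutive adj.
Proof.
by move=> a; apply: bop_eqP => x; apply: inner_eq => z; rewrite -adjE -adjEr.
Qed.

Lemma adjM (a b : bop H H) : adj (a * b) = adj b * adj a.
Proof.
apply: bop_eqP => x; apply: inner_eq => z.
by rewrite -adjE !bopME adjE adjE.
Qed.

End HilbertSpaces.

Definition commutant (R : realType) (V : normedModType R[i])
    (X : set (bop V V)) : set (bop V V) :=
  [set a | forall x, X x -> a * x = x * a].

(* A von Neumann algebra on H: a selfadjoint set of bounded operators equal to
   its bicommutant. It is a unital *-subalgebra of B(H) (vn_submod, vn_mulr);
   its elements form the type vn below. *)
Record vnalg (R : realType) (H : hilbertType R) := VNAlg {
  vn_set : set (bop H H);
  vn_adj : forall a, vn_set a -> vn_set (adj a);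
  vn_bicommutant : commutant (commutant vn_set) = vn_set
}.

Section VonNeumannAlgebras.
Variables (R : realType) (H : hilbertType R) (M : vnalg H).

Definition vn_pred : {pred bop H H} := fun a => `[< vn_set M a >].

Record vn := Vn { vn_val :> bop H H; _ : vn_val \in vn_pred }.

HB.instance Definition _ := [isSub for vn_val].
HB.instance Definition _ := [Choice of vn by <:].

Lemma vnP (a : vn) : vn_set M a. Proof. by case: a => a /= /asboolP. Qed.

Lemma vn_submod : GRing.subsemimod_closed vn_pred.
Proof.
split; [split |].
- apply/asboolP; rewrite -vn_bicommutant => x _.
  by rewrite mul0r mulr0.
- move=> a b /asboolP Ma /asboolP Mb; apply/asboolP.
  move: Ma Mb; rewrite -vn_bicommutant => Ma Mb x Mx.
  by rewrite mulrDl mulrDr Ma ?Mb.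
- move=> c a /asboolP Ma; apply/asboolP.
  move: Ma; rewrite -vn_bicommutant => Ma x Mx.
  by rewrite bopMZl bopMZr Ma.
Qed.

Lemma vn_mulr : mulr_closed vn_pred.
Proof.
split.
- by apply/asboolP; rewrite -vn_bicommutant => x _; rewrite mul1r mulr1.
- move=> a b /asboolP Ma /asboolP Mb; apply/asboolP.
  move: Ma Mb; rewrite -vn_bicommutant => Ma Mb x Mx.
  by rewrite -mulrA Mb// mulrA Ma// mulrA.
Qed.

HB.instance Definition _ := GRing.isSubmodClosed.Build R[i] (bop H H) vn_pred
  vn_submod.
HB.instance Definition _ := [SubChoice_isSubLmodule of vn by <:].

Lemma vn_subring : subring_closed vn_pred.
Proof.
by split; [exact: vn_mulr.1 | exact: rpredB | exact: vn_mulr.2].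
Qed.

HB.instance Definition _ :=
  GRing.SubZmodule_isSubPzRing.Build (bop H H) vn_pred vn vn_subring.

Definition vn_norm (a : vn) : R[i] := (`|vn_val a|).

Lemma vn_normD a b : vn_norm (a + b) <= vn_norm a + vn_norm b.
Proof. exact: ler_normD. Qed.

Lemma vn_normZ c a : vn_norm (c *: a) = `|c| * vn_norm a.
Proof. exact: normrZ. Qed.

Lemma vn_norm0_eq0 a : vn_norm a = 0 -> a = 0.
Proof. by move=> /normr0_eq0 a0; exact: val_inj. Qed.

HB.instance Definition _ := Lmodule_isNormed.Build R[i] vn
  vn_normD vn_normZ vn_norm0_eq0.

Lemma star_subproof (a : vn) : adj a \in vn_pred.
Proof. by apply/asboolP/vn_adj/vnP. Qed.

Definition star (a : vn) : vn := Vn (star_subproof a).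

End VonNeumannAlgebras.

(* Square-summable sequences; a pair (xi, eta) of them gives the form
   a |-> \sum_n <a xi_n, eta_n>, and the ultraweak topology is the initial
   topology for these forms. *)
Record sqsum (R : realType) (H : hilbertType R) := SqSum {
  sqsum_fun :> nat -> H;
  _ : cvgn (series (fun n => `|sqsum_fun n| ^+ 2 : R[i]^o))
}.

Section Ultraweak.
Variables (R : realType) (H : hilbertType R) (M : vnalg H).

Definition uw_form (xi : sqsum H * sqsum H) (a : bop H H) : R[i]^o :=
  limn (series (fun n => inner (a (xi.1 n)) (xi.2 n) : R[i]^o)).

Definition uw_embed (a : vn M) : {ptws (sqsum H * sqsum H) -> R[i]^o} :=
  fun xi => uw_form xi a.

Definition ultraweak : Type := initial_topology uw_embed.
HB.instance Definition _ := Topological.on ultraweak.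

(* M_*: the ultraweakly continuous functionals, normed as a subspace of the
   dual of M. *)
Definition predual_pred : {pred dual (vn M)} :=
  fun f => `[< continuous (f : ultraweak -> R[i]^o) >].

Record predual :=
  Predual { predual_val :> dual (vn M); _ : predual_val \in predual_pred }.

HB.instance Definition _ := [isSub for predual_val].
HB.instance Definition _ := [Choice of predual by <:].

Lemma predual_submod : GRing.subsemimod_closed predual_pred.
Proof.
split; [split |].
- by apply/asboolP => x; exact: cst_continuous.
- move=> f g /asboolP cf /asboolP cg; apply/asboolP => x.
  exact: (@cvgD R[i] R[i]^o _ _ _ _ _ _ _ (cf x) (cg x)).
- move=> c f /asboolP cf; apply/asboolP => x.
  exact: (@cvgZl_tmp R[i] R[i]^o _ _ _ c _ _ (cf x)).
Qed.

HB.instance Definition _ := GRing.isSubmodClosed.Build R[i] (dual (vn M))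
  predual_pred predual_submod.
HB.instance Definition _ := [SubChoice_isSubLmodule of predual by <:].

Definition predual_norm (f : predual) : R[i] := (`|predual_val f|).

Lemma predual_normD f g :
  predual_norm (f + g) <= predual_norm f + predual_norm g.
Proof. exact: ler_normD. Qed.

Lemma predual_normZ c f : predual_norm (c *: f) = `|c| * predual_norm f.
Proof. exact: normrZ. Qed.

Lemma predual_norm0_eq0 f : predual_norm f = 0 -> f = 0.
Proof. by move=> /normr0_eq0 f0; exact: val_inj. Qed.

HB.instance Definition _ := Lmodule_isNormed.Build R[i] predual
  predual_normD predual_normZ predual_norm0_eq0.

Lemma predual_eval_subproof (a : vn M) :
  (fun f : predual => f a : R[i]^o) \in @bop_pred R predual R[i]^o.
Proof.
apply: (@bop_predP _ _ _ _ `|a|) => // f; rewrite mulrC; exact: opnormP.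
Qed.

(* The canonical identification of M with the dual of M_*. *)
Definition predual_eval (a : vn M) : dual predual :=
  Bop (predual_eval_subproof a).

End Ultraweak.

Section WeaklyAlmostPeriodic.
Variable R : realType.

Definition weak_embed (V : normedModType R[i]) (v : V) :
  {ptws (dual V) -> R[i]^o} := fun l => l v.

(* V with the topology sigma(V, dual V). *)
Definition weak (V : normedModType R[i]) : Type := initial_topology (@weak_embed V).
HB.instance Definition _ (V : normedModType R[i]) := Topological.on (weak V).

Definition weakly_compact (V W : normedModType R[i]) (T : bop V W) : Prop :=
  compact (closure ([set T v | v in [set v | `|v| <= 1]] : set (weak W))).

(* T is the map a |-> a . phi, where <a . phi, b> = <phi, b a>. In a Banach
   algebra this is always a bounded operator from A to its dual, so the only
   condition on phi is weak compactness. *)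
Definition WAP (A : normedModType R[i]) (mul : A -> A -> A) : set (dual A) :=
  [set phi | exists2 T : bop A (dual A),
     forall a b, T a b = phi (mul b a) & weakly_compact T].

End WeaklyAlmostPeriodic.

Section Commutants.
Variables (R : realType) (H : hilbertType R).
Implicit Types X Y : set (bop H H).

Lemma commutantS X Y : X `<=` Y -> commutant Y `<=` commutant X.
Proof. by move=> XY a Ya x /XY; exact: Ya. Qed.

Lemma sub_bicommutant X : X `<=` commutant (commutant X).
Proof. by move=> a Xa x /(_ a Xa). Qed.

Lemma commutant3 X : commutant (commutant (commutant X)) = commutant X.
Proof.
apply/seteqP; split; last exact: sub_bicommutant.
by apply: commutantS; exact: sub_bicommutant.
Qed.

Lemma commutant_adj X : (forall a, X a -> X (adj a)) ->
  forall a, commutant X a -> commutant X (adj a).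
Proof.
move=> XX a Xa x Xx; rewrite -[x in LHS]adjK -[x in RHS]adjK.
by rewrite -!adjM Xa//; exact: XX.
Qed.

End Commutants.

(* K is (a model of) the Hilbert space tensor product of H1 and H2. *)
Record hilbert_tensor (R : realType) (H1 H2 K : hilbertType R) :=
  HilbertTensor {
    tens :> H1 -> H2 -> K;
    tensPl : forall a x y z, tens (a *: x + y) z = a *: tens x z + tens y z;
    tensPr : forall a x y z, tens x (a *: y + z) = a *: tens x y + tens x z;
    inner_tens : forall x1 x2 y1 y2,
      inner (tens x1 y1) (tens x2 y2) = inner x1 x2 * inner y1 y2;
    tens_dense : closure [set z | exists n (x : 'I_n -> H1) (y : 'I_n -> H2),
      z = \sum_(i < n) tens (x i) (y i)] = setT
  }.

Section TensorProducts.
Variables (R : realType) (H1 H2 K : hilbertType R).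
Variable t : hilbert_tensor H1 H2 K.

Lemma tens_total w : (forall x y, inner (t x y) w = 0) -> w = 0.
Proof.
move=> tw; apply/eqP/negPn/negP => w0.
have : closure [set z | exists n (x : 'I_n -> H1) (y : 'I_n -> H2),
  z = \sum_(i < n) t (x i) (y i)] w by rewrite tens_dense.
have bw : nbhs w (ball w `|w|) by apply: nbhsx_ballx; rewrite normr_gt0.
move=> /(_ _ bw)[z [[n [x [y ->]]]]]; rewrite -ball_normE/=.
set z' := \sum_(i < n) _ => wz; have z'w : inner z' w = 0.
  by rewrite /z'; elim/big_ind : _ => //[|u v u0 v0]; rewrite ?inner0l// innerDl u0 v0 addr0.
have : `|w| ^+ 2 <= `|w - z'| * `|w|.
  rewrite -(@ger0_norm _ (`|w| ^+ 2)) ?exprn_ge0// -inner_norm.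
  by rewrite (le_trans _ (cauchy_schwarz _ _))// innerDl innerNl z'w subr0.
by rewrite expr2 ler_pM2r ?normr_gt0// => /le_lt_trans/(_ wz); rewrite ltxx.
Qed.

Definition is_otimes (a : bop H1 H1) (b : bop H2 H2) (c : bop K K) : Prop :=
  forall x y, c (t x y) = t (a x) (b y).

Lemma is_otimes_adj a b c :
  is_otimes a b c -> is_otimes (adj a) (adj b) (adj c).
Proof.
move=> abc x y; apply/eqP; rewrite -subr_eq0; apply/eqP/tens_total => u v.
by rewrite innerDr innerNr -adjE abc !inner_tens -!adjE subrr.
Qed.

Variables (M : vnalg H1) (N : vnalg H2).

Definition otimes_set : set (bop K K) :=
  [set c | exists (a : vn M) (b : vn N), is_otimes a b c].

Lemma otimes_set_adj c : otimes_set c -> otimes_set (adj c).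
Proof.
by move=> [a [b abc]]; exists (star a), (star b); exact: is_otimes_adj.
Qed.

(* The von Neumann algebra generated by the a (x) b. *)
Definition vn_tensor : vnalg K := VNAlg
  (commutant_adj (commutant_adj otimes_set_adj)) (commutant3 _).

(* f (x) g: the normal functional determined on elementary tensors, which span
   an ultraweakly dense subalgebra. It always exists, so the default 0 is never
   used; likewise for conv below. *)
Definition predual_tensor (f : predual M) (g : predual N) :
    predual vn_tensor :=
  xget 0 [set h : predual vn_tensor | forall (a : vn M) (b : vn N) (c : vn vn_tensor),
    is_otimes a b c -> h c = f a * g b].

End TensorProducts.

Section Homomorphisms.
Variables (R : realType) (H K : hilbertType R) (M : vnalg H) (N : vnalg K).
Variable phi : vn M -> vn N.

Definition star_hom : Prop :=
  [/\ linear phi, {morph phi : a b / a * b} & {morph phi : a / star a}].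

Definition normal_map : Prop := continuous (phi : ultraweak M -> ultraweak N).

End Homomorphisms.

(* Theta = phi (x) psi, the normal *-homomorphism determined on elementary
   tensors. *)
Definition tensor_hom (R : realType) (H1 H2 K H1' H2' K' : hilbertType R)
    (t : hilbert_tensor H1 H2 K) (t' : hilbert_tensor H1' H2' K')
    (M : vnalg H1) (N : vnalg H2) (M' : vnalg H1') (N' : vnalg H2')
    (phi : vn M -> vn M') (psi : vn N -> vn N')
    (Theta : vn (vn_tensor t M N) -> vn (vn_tensor t' M' N')) : Prop :=
  [/\ star_hom Theta, normal_map Theta &
      forall (a : vn M) (b : vn N) (c : vn (vn_tensor t M N)),
        is_otimes t a b c -> is_otimes t' (phi a) (psi b) (Theta c)].

Section HopfVonNeumann.
Variables (R : realType) (H K L : hilbertType R).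
Variables (t : hilbert_tensor H H K).
Variables (tl : hilbert_tensor K H L) (tr : hilbert_tensor H K L).

(* tl and tr present L as the same triple tensor product of H, so that the
   ranges of Gamma (x) id and id (x) Gamma can be compared inside B(L). *)
Definition tens_assoc : Prop :=
  forall x y z, tl (t x y) z = tr x (t y z).

Variables (M : vnalg H) (Gamma : vn M -> vn (vn_tensor t M M)).

Definition coassociative : Prop :=
  exists Gl : vn (vn_tensor t M M) -> vn (vn_tensor tl (vn_tensor t M M) M),
  exists Gr : vn (vn_tensor t M M) -> vn (vn_tensor tr M (vn_tensor t M M)),
  [/\ tensor_hom Gamma id Gl, tensor_hom id Gamma Gr &
      forall a, Gl (Gamma a) = Gr (Gamma a) :> bop L L].

Definition hopf_vn : Prop :=
  [/\ star_hom Gamma, Gamma 1 = 1, injective Gamma, normal_map Gamma &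
      coassociative].

(* <f * g, a> = <f (x) g, Gamma a> *)
Definition conv (f g : predual M) : predual M :=
  xget 0 [set k : predual M | forall a, k a = predual_tensor t f g (Gamma a)].

End HopfVonNeumann.

Section Subalgebras.
Variables (R : realType) (H : hilbertType R) (M : vnalg H).

(* M is *-isomorphic to the direct sum of the M_(n i)(A i). *)
Definition subhomogeneous : Prop :=
  exists k (n : 'I_k -> nat) (K : 'I_k -> hilbertType R)
    (A : forall i, vnalg (K i)) (phi : forall i, vn M -> 'M[vn (A i)]_(n i)),
  [/\ forall i, (0 < n i)%N,
      forall i (a b : vn (A i)), a * b = b * a,
      bijective (fun a i => phi i a) &
      forall i,
      [/\ {morph phi i : a b / a + b},
          forall c, {morph phi i : a / c *: a >-> map_mx ( *:%R c) a},
          {morph phi i : a b / a * b >-> a *m b} &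
          {morph phi i : a / star a >-> (map_mx (@star _ _ _) a)^T}]].

Definition cstar_subalgebra (S : set (vn M)) : Prop :=
  [/\ S 0, forall c a b, S a -> S b -> S (c *: a + b),
      forall a b, S a -> S b -> S (a * b),
      forall a, S a -> S (star a) & closed S].

End Subalgebras.

(* Main.v *)
Require Import Defs.
From HB Require Import structures.
From mathcomp Require Import all_boot all_order all_algebra.
From mathcomp Require Import complex ring lra.
From mathcomp Require Import boolp classical_sets functions reals topology.
From mathcomp Require Import normedtype sequences.
Set Implicit Arguments.
Unset Strict Implicit.
Unset Printing Implicit Defensive.
Import Order.TTheory GRing.Theory Num.Theory.
Import numFieldNormedType.Exports.
Local Open Scope classical_set_scope.
Local Open Scope ring_scope.

(* For X in M (x) M and bounded functionals phi, psi on M there are two iterated slices,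
   phi((psi (x) id)(X)) and psi((id (x) phi)(X)). They agree when phi and psi are normal, and by
   Goldstine's theorem they agree for all phi and psi (WC X) exactly when X induces a weakly
   compact operator from M_* to M; with X = Gamma a this says that a is weakly almost periodic.
   As Gamma is a contractive *-homomorphism, it remains to see that the X with WC X form a
   C*-algebra, and only products are not immediate.
   The matrix units of a subhomogeneous M write X as a finite sum of elementary tensors times
   central elements that again satisfy WC, which reduces products to X^* X with X central. For
   a state phi, the slices of X form a relatively weakly compact set of central elements. If
   central selfadjoint contractions h_i tend to 0 weakly and lie in a relatively weakly compact
   set, then phi(h_i^2) -> 0: otherwise a cluster point of the functionals
   phi(prod_k (1 + h_{n_k}) .), a Riesz product, would separate the h_{n_k} from 0. So the slices
   are relatively compact in L^2(phi), and X is close to a finite sum Z of elementary tensors in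
   the sense that (id (x) phi)(|X - Z|^2) is small. This bounds one iterated slice of X^* X by
   the other, and exchanging the two factors gives equality. *)

(** * Limits along ultrafilters *)

(** Closeness of Z to X in the sense above does not control the norm of D = X - Z, and only one of
    the two iterated slices of D^* D becomes small; the other is merely nonnegative. Squares
    tolerate this: X^* X - D^* D consists of terms containing Z, which satisfy [WC] anyway, so one
    inequality survives for positive functionals. Mixed products have no sign and follow by
    polarization. Centrality gives Riesz products their sign, as commuting positive operators have
    positive products. It also turns a bound on each single slice in L^2(phi) into a bound on (id
    (x) phi)(X^* X): for coefficients b_i this compares sum |b_i|^2 with the norms of linear
    combinations, which is false without commutativity. Points of the spectrum are replaced there by
    states under which finitely many central elements are definite. Since phi may fail to be normal,
    approximants of X cannot be inserted under phi directly. The estimate is proved for vector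
    states and, after exchange of the legs, yields approximants of X at a fixed first vector
    uniformly in the second, which every positive phi accepts. *)

Section ComplexOrder.
Variable R : realType.
Implicit Types (x y e : R[i]).

Lemma ge0_complexP x : 0 <= x -> exists2 r : R, 0 <= r & x = r%:C%C.
Proof.
move=> x0; exists (complex.Re x); last by rewrite RRe_real// ger0_real.
by move: x0; rewrite lecE => /andP[].
Qed.

Lemma gt0_complexP x : 0 < x -> exists2 r : R, 0 < r & x = r%:C%C.
Proof.
move=> x0; exists (complex.Re x); last by rewrite RRe_real// gtr0_real.
by move: x0; rewrite ltcE => /andP[].
Qed.

Lemma le_all_eps x y : 0 <= x -> 0 <= y ->
  (forall e, 0 < e -> x <= y + e) -> x <= y.
Proof.
move=> /ge0_complexP[r r0 ->] /ge0_complexP[s s0 ->] h.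
rewrite lecR; apply/ler_addgt0Pr => e e0.
by rewrite -lecR rmorphD; apply: h; rewrite ltcR.
Qed.

Lemma eq0_all_eps x : (forall e, 0 < e -> `|x| <= e) -> x = 0.
Proof.
move=> h; apply/eqP; rewrite -normr_le0; apply: le_all_eps => // e e0.
by rewrite add0r h.
Qed.

Lemma eq_all_eps x y : (forall e, 0 < e -> `|x - y| <= e) -> x = y.
Proof. by move=> h; apply/eqP; rewrite -subr_eq0; apply/eqP/eq0_all_eps. Qed.

End ComplexOrder.

Section UltraLimits.
Variables (R : realType) (T : Type) (F : set_system T).
Hypothesis FF : UltraFilter F.
Implicit Types (u v : T -> R[i]).

Let pF : ProperFilter F := ultra_proper.

Definition ubounded u := exists M : R[i], F [set i | `|u i| <= M].

(** The default 0 is reached only when no limit exists; a family that is bounded along [F] has one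
    ([ulim_ex]). *)
Definition ulim u : R[i] :=
  xget 0 [set z | forall e, 0 < e -> F [set i | `|u i - z| < e]].

Lemma real_ulim_ex (r : T -> R) (M : R) : F [set i | `|r i| <= M] ->
  exists l, forall e, 0 < e -> F [set i | `|r i - l| < e].
Proof.
move=> FM; have FMM : (r @ F) `[- M, M]%classic.
  apply: (@filterS _ F _ _ _ _ FM) => i /=; by rewrite in_itv/= -ler_norml.
have [l [_ cl]] := @segment_compact R _ _ (r @ F) _ FMM.
(* A cluster point of an ultrafilter is a limit: if the ball around [l] were not in [F], its
   complement would be, and could not meet the ball. *)
exists l => e e0; have [//|nF] := in_ultra_setVsetC [set i | `|r i - l| < e] FF.
have [] := cl [set s | ~ `|s - l| < e] (ball l e).
- exact: nF.
- exact: nbhsx_ballx.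
- by move=> y [/= + ]; rewrite /ball /= distrC => /[apply].
Qed.

Lemma ulim_ex u : ubounded u ->
  exists z, forall e, 0 < e -> F [set i | `|u i - z| < e].
Proof.
move=> [M uM].
have F0 (r : T -> R) : (forall i, (`|r i|)%:C%C <= `|u i|) -> 
    exists l : R, forall e, 0 < e -> F [set i | `|r i - l| < e].
  move=> ru; apply: (@real_ulim_ex _ (complex.Re M)).
  apply: filterS uM => i /= /(le_trans (ru i)).
  by rewrite lecE/= => /andP[].
have ni : `|'i%C| = 1 :> R[i].
  by rewrite normc_def/= expr0n/= expr1n add0r sqrtr1.
have nr (x : R) : `|x%:C%C| = `|x|%:C%C.
  by rewrite normc_def/= expr0n/= addr0 sqrtr_sqr.
have ImE z : complex.Im z = - complex.Re ('i%C * z).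
  by case: z => x y; rewrite /= mul0r mul1r sub0r opprK.
have [|l lP] := F0 (fun i => complex.Re (u i)).
  by move=> i; exact: normc_ge_Re.
have [|m mP] := F0 (fun i => complex.Im (u i)).
  move=> i; rewrite ImE normrN (le_trans (normc_ge_Re _))// normrM.
  by rewrite ni mul1r.
exists (l +i* m)%C => _ /gt0_complexP[e e0 ->].
have e2 : 0 < e / 2 by rewrite divr_gt0.
apply: filterS2 (lP _ e2) (mP _ e2) => i /= hl hm.
rewrite (_ : u i - _ = (complex.Re (u i) - l)%:C%C + 'i%C * (complex.Im (u i) - m)%:C%C); last first.
  by case: (u i) => x y; apply/eqP; rewrite eq_complex/=; apply/andP; split; apply/eqP; ring.
apply: (le_lt_trans (ler_normD _ _)); rewrite normrM ni mul1r !nr.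
by rewrite -rmorphD ltcR [ltRHS]splitr ltrD.
Qed.

Lemma ulimP u : ubounded u ->
  forall e, 0 < e -> F [set i | `|u i - ulim u| < e].
Proof. by move=> /ulim_ex[z zP]; rewrite /ulim; case: xgetP => //= /(_ z). Qed.

Lemma ultra_ex (A : set T) : F A -> exists i, A i.
Proof. exact: filter_ex. Qed.

Lemma ulim_uniq u z : (forall e, 0 < e -> F [set i | `|u i - z| < e]) ->
  ulim u = z.
Proof.
move=> uz; have bu : ubounded u.
  exists (`|z| + 1); apply: filterS (uz 1 ltr01) => i /= h.
  by rewrite -[u i](subrK z) addrC (le_trans (ler_normD _ _))// lerD2l ltW.
apply: eq_all_eps => e e0; have e2 : 0 < e / 2 by rewrite divr_gt0.
have [i [/= h1 h2]] := ultra_ex (filterI (ulimP bu e2) (uz _ e2)).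
rewrite -[_ - z](subrKA (u i)) [leRHS]splitr (le_trans (ler_normD _ _))// lerD//.
  by rewrite distrC ltW.
exact: ltW.
Qed.

Lemma eq_ulim u v : F [set i | u i = v i] -> ulim u = ulim v.
Proof.
move=> uv; rewrite /ulim; congr (xget _ _); apply/seteqP; split => z /= h e e0.
  by apply: filterS2 uv (h e e0) => i /= ->.
by apply: filterS2 uv (h e e0) => i /= <-.
Qed.

Lemma ulim_cst z : ulim (fun=> z) = z.
Proof.
by apply: ulim_uniq => e e0; apply: filterE => i /=; rewrite subrr normr0.
Qed.

Lemma uboundedW u (M : R[i]) : (forall i, `|u i| <= M) -> ubounded u.
Proof. by move=> uM; exists M; apply: filterE. Qed.

Lemma ubounded_cst z : ubounded (fun=> z).
Proof. exact: (@uboundedW _ `|z|). Qed.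

Lemma uboundedD u v : ubounded u -> ubounded v -> ubounded (fun i => u i + v i).
Proof.
move=> [M uM] [N vN]; exists (M + N); apply: filterS2 uM vN => i /= h1 h2.
by rewrite (le_trans (ler_normD _ _))// lerD.
Qed.

Lemma uboundedM u v : ubounded u -> ubounded v -> ubounded (fun i => u i * v i).
Proof.
move=> [M uM] [N vN]; exists (M * N); apply: filterS2 uM vN => i /= h1 h2.
by rewrite normrM ler_pM.
Qed.

Lemma uboundedZ c u : ubounded u -> ubounded (fun i => c * u i).
Proof. exact/uboundedM/ubounded_cst. Qed.

Lemma ulimD u v : ubounded u -> ubounded v ->
  ulim (fun i => u i + v i) = ulim u + ulim v.
Proof.
move=> bu bv; apply: ulim_uniq => e e0.
have e2 : 0 < e / 2 by rewrite divr_gt0.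
apply: filterS2 (ulimP bu e2) (ulimP bv e2) => i /= h1 h2.
by rewrite opprD addrACA [ltRHS]splitr (le_lt_trans (ler_normD _ _))// ltrD.
Qed.

Lemma ulimZ c u : ubounded u -> ulim (fun i => c * u i) = c * ulim u.
Proof.
move=> bu; apply: ulim_uniq => e e0.
have c0 : 0 < `|c| + 1 by rewrite ltr_wpDl.
apply: filterS (ulimP bu (divr_gt0 e0 c0)) => i /=.
rewrite ltr_pdivlMr// => h; rewrite -mulrBr normrM (le_lt_trans _ h)//.
by rewrite mulrC ler_wpM2l// lerDl.
Qed.

Lemma ulim_conj u : ubounded u -> ulim (fun i => (u i)^*) = (ulim u)^*.
Proof.
move=> bu; apply: ulim_uniq => e e0; apply: filterS (ulimP bu e0) => i /=.
by rewrite -rmorphB norm_conjC.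
Qed.

Lemma ulim_ge0 u : ubounded u -> F [set i | 0 <= u i] -> 0 <= ulim u.
Proof.
move=> bu u0; have E : ulim u = `|ulim u|; last by rewrite E.
apply: eq_all_eps => e e0; have e2 : 0 < e / 2 by rewrite divr_gt0.
have [i [/= h1 h2]] := ultra_ex (filterI (ulimP bu e2) u0).
rewrite -[_ - _](subrKA (u i)) [leRHS]splitr (le_trans (ler_normD _ _))// lerD//.
  by rewrite distrC ltW.
by rewrite -{1}(ger0_norm h2) (le_trans (ler_dist_dist _ _))// ltW.
Qed.

Lemma ulim_norm_le u M : 0 <= M -> F [set i | `|u i| <= M] -> `|ulim u| <= M.
Proof.
move=> M0 uM; apply: le_all_eps => // e e0; have bu : ubounded u by exists M.
have [i [/= h1 h2]] := ultra_ex (filterI (ulimP bu e0) uM).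
rewrite -[ulim u](subrK (u i)) addrC (le_trans (ler_normD _ _))// lerD//.
by rewrite distrC ltW.
Qed.

Lemma ulim_near u e : ubounded u -> 0 < e ->
  F [set i | `|u i - ulim u| <= e].
Proof. by move=> bu e0; apply: filterS (ulimP bu e0) => i /ltW. Qed.

End UltraLimits.

(** * Semi-inner products *)

Section SemiInnerProducts.
Variables (R : realType).

Definition sesqui (V W : lmodType R[i]) (s : V -> W -> R[i]) : Prop :=
  (forall a x y z, s (a *: x + y) z = a * s x z + s y z) /\
  (forall a x y z, s x (a *: y + z) = a^* * s x y + s x z).

Section Sesquilinear.
Variables (V W : lmodType R[i]) (s : V -> W -> R[i]).
Hypothesis ss : sesqui s.

Lemma sesquiDl x y z : s (x + y) z = s x z + s y z.
Proof. by rewrite -[x]scale1r ss.1 mul1r scale1r. Qed.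

Lemma sesquiDr x y z : s x (y + z) = s x y + s x z.
Proof. by rewrite -[y]scale1r ss.2 rmorph1 mul1r scale1r. Qed.

Lemma sesqui0l z : s 0 z = 0.
Proof. by apply: (@addrI _ (s 0 z)); rewrite -sesquiDl !addr0. Qed.

Lemma sesqui0r z : s z 0 = 0.
Proof. by apply: (@addrI _ (s z 0)); rewrite -sesquiDr !addr0. Qed.

Lemma sesquiZl a x z : s (a *: x) z = a * s x z.
Proof. by rewrite -[a *: x]addr0 ss.1 sesqui0l addr0. Qed.

Lemma sesquiZr a x z : s x (a *: z) = a^* * s x z.
Proof. by rewrite -[a *: z]addr0 ss.2 sesqui0r addr0. Qed.

Lemma sesquiNl x z : s (- x) z = - s x z.
Proof. by rewrite -scaleN1r sesquiZl mulN1r. Qed.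

Lemma sesquiNr x z : s x (- z) = - s x z.
Proof. by rewrite -scaleN1r sesquiZr rmorphN1 mulN1r. Qed.

Lemma sesqui_suml (I : Type) (r : seq I) (F : I -> V) z :
  s (\sum_(i <- r) F i) z = \sum_(i <- r) s (F i) z.
Proof. by elim/big_rec2: _ => [|i x y _ <-]; rewrite ?sesqui0l// sesquiDl. Qed.

Lemma sesqui_sumr (I : Type) (r : seq I) (F : I -> W) z :
  s z (\sum_(i <- r) F i) = \sum_(i <- r) s z (F i).
Proof. by elim/big_rec2: _ => [|i x y _ <-]; rewrite ?sesqui0r// sesquiDr. Qed.

Definition sesquiE := (sesquiDl, sesquiDr, sesquiNl, sesquiNr, sesquiZl, sesquiZr).

End Sesquilinear.

Lemma ler_nat_mul0 (x y : R[i]) : 0 <= x -> 0 <= y ->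
  (forall n : nat, n%:R * x <= y) -> x = 0.
Proof.
move=> /ge0_complexP[r r0 ->] /ge0_complexP[u u0 ->] h.
have {}h n : n%:R * r <= u by rewrite -lecR rmorphM/= rmorph_nat.
suff -> : r = 0 by [].
apply/le_anti; rewrite r0 andbT leNgt; apply/negP => r0'.
have := h (Num.truncn (u / r)).+1; rewrite -ler_pdivlMr//.
by rewrite leNgt truncnS_gt.
Qed.

Variables (V : lmodType R[i]) (s : V -> V -> R[i]).
Hypotheses (ss : sesqui s) (s_ge0 : forall x, 0 <= s x x).

(** Positivity alone forces hermitian symmetry: [s (c *: x + y) (c *: x + y)] is real, and c = 1 and
    c = i together determine [s y x]. *)
Lemma semi_innerC x y : s y x = (s x y)^*.
Proof.
have r z : (s z z)^* = s z z by rewrite geC0_conj.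
have h c : (c * s x y + c^* * s y x)^* = c * s x y + c^* * s y x.
  have := r (c *: x + y); rewrite !(sesquiE ss) !rmorphD/= !rmorphM/= !r conjCK.
  move: (s x x) (s y y) (s x y) (s y x) => p q u v E.
  move/eqP: E; rewrite -subr_eq0 => /eqP E.
  by apply/eqP; rewrite -subr_eq0; apply/eqP; rewrite -{}E; ring.
move: (h 1) (h 'i); rewrite !rmorphD/= !rmorphM/= !conjC1 !mul1r !conjCi.
move: (s x y) (s y x) => u v E1 E2.
have {}E2 : v^* - u^* = u - v.
  apply: (mulfI (neq0Ci _)); move: E2; rewrite rmorphN/= conjCi opprK => E2.
  by apply: etrans (etrans E2 _); ring.
apply: (@mulfI _ 2); first by rewrite pnatr_eq0.
have -> : 2 * u^* = (u^* + v^*) - (v^* - u^*) by ring.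
by rewrite E1 E2; ring.
Qed.

(** Since [s y y] may vanish, the usual coefficient c / b is replaced by c / (b + d), with d = e /
    (a + 1) so that a d is at most e. *)
Lemma semi_cs x y : `|s x y| ^+ 2 <= s x x * s y y.
Proof.
set a := s x x; set b := s y y; set c := s x y.
have a0 : 0 <= a by exact: s_ge0.
have b0 : 0 <= b by exact: s_ge0.
apply: le_all_eps => [||e e0]; rewrite ?exprn_ge0 ?mulr_ge0//.
pose d := e / (a + 1); have a1 : 0 < a + 1 by rewrite ltr_wpDl.
have d0 : 0 < d by rewrite divr_gt0.
suff : `|c| ^+ 2 <= a * (b + d).
  move=> /le_trans; apply; rewrite mulrDr lerD2l /d mulrA ler_pdivrMr//.
  by rewrite mulrC ler_wpM2l ?lerDl// ltW.
have bd0 : 0 < b + d by rewrite ltr_wpDl.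
have := s_ge0 (x - (c / (b + d)) *: y).
have -> : s (x - (c / (b + d)) *: y) (x - (c / (b + d)) *: y) =
    a - `|c| ^+ 2 / (b + d) - `|c| ^+ 2 * d / (b + d) ^+ 2.
  rewrite !(sesquiE ss) -/a -/b -/c [s y x]semi_innerC -/c.
  rewrite rmorphM/= fmorphV/= (@geC0_conj _ (b + d)) ?(ltW bd0)// normCK.
  by field; rewrite gt_eqF.
move=> h.
have : 0 <= a - `|c| ^+ 2 / (b + d).
  apply: le_trans h _; rewrite gerBl.
  by apply: divr_ge0; [apply: mulr_ge0; [exact: exprn_ge0 | exact: ltW] | apply/exprn_ge0/ltW].
by rewrite subr_ge0 ler_pdivrMr.
Qed.

Lemma semi_null x y : s x x = 0 -> s x y = 0.
Proof.
move=> x0; have := semi_cs x y; rewrite x0 mul0r => h.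
by apply/eqP; rewrite -normr_eq0 -sqrf_eq0; apply/eqP/le_anti; rewrite h exprn_ge0.
Qed.

Lemma semi_null_r x y : s y y = 0 -> s x y = 0.
Proof. by move=> /semi_null y0; rewrite semi_innerC y0 rmorph0. Qed.

Definition seminorm x : R[i] := sqrtC (s x x).

Lemma seminorm_ge0 x : 0 <= seminorm x.
Proof. by rewrite sqrtC_ge0. Qed.

Lemma seminorm_sqr x : seminorm x ^+ 2 = s x x.
Proof. exact: sqrtCK. Qed.

Lemma semi_csn x y : `|s x y| <= seminorm x * seminorm y.
Proof.
rewrite -(@ler_pXn2r _ 2)// ?nnegrE ?mulr_ge0 ?seminorm_ge0//.
by rewrite exprMn !seminorm_sqr semi_cs.
Qed.

Lemma seminormD x y : seminorm (x + y) <= seminorm x + seminorm y.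
Proof.
rewrite -(@ler_pXn2r _ 2)// ?nnegrE ?addr_ge0 ?seminorm_ge0//.
rewrite seminorm_sqr sqrrD !seminorm_sqr !(sesquiE ss) [s y x]semi_innerC.
rewrite addrA lerD2r -addrA lerD2l.
have : 0 <= s (x + y) (x + y) by [].
have -> : s x y + (s x y)^* = 2 * 'Re (s x y).
  by rewrite ReE mulrC divfK ?pnatr_eq0.
move=> _; rewrite -[leRHS]mulr_natl ler_wpM2l// (le_trans _ (semi_csn x y))//.
by rewrite leif_Re_Creal.
Qed.

Lemma seminormN x : seminorm (- x) = seminorm x.
Proof. by rewrite /seminorm !(sesquiE ss) opprK. Qed.

Lemma seminormZ a x : seminorm (a *: x) = `|a| * seminorm x.
Proof.
apply/eqP; rewrite -(@eqrXn2 _ 2)// ?mulr_ge0 ?seminorm_ge0//.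
by rewrite exprMn !seminorm_sqr !(sesquiE ss) mulrA -normCK.
Qed.

Definition orthon (m : nat) (e : nat -> V) : Prop :=
  forall i j, (i < m)%N -> (j < m)%N -> s (e i) (e j) = (i == j)%:R.

Definition oproj (m : nat) (e : nat -> V) x := \sum_(i < m) s x (e i) *: e i.

Lemma oproj_inner m e x j : orthon m e -> (j < m)%N ->
  s (oproj m e x) (e j) = s x (e j).
Proof.
move=> oe jm; rewrite (sesqui_suml ss) (bigD1 (Ordinal jm))//= big1 ?addr0.
  by rewrite (sesquiE ss) oe// eqxx mulr1.
move=> i /eqP ij; rewrite (sesquiE ss) oe//; case: eqP => [ij'|_].
  by case: ij; exact: val_inj.
by rewrite mulr0.
Qed.

Lemma oproj_orth m e x j : orthon m e -> (j < m)%N ->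
  s (x - oproj m e x) (e j) = 0.
Proof. by move=> oe jm; rewrite !(sesquiE ss) oproj_inner// subrr. Qed.

Lemma oproj_sqr m e x : orthon m e ->
  s (x - oproj m e x) (x - oproj m e x) = s x x - \sum_(i < m) `|s x (e i)| ^+ 2.
Proof.
move=> oe; rewrite [in LHS](sesquiDr ss) (sesquiNr ss).
have -> : s (x - oproj m e x) (oproj m e x) = 0.
  rewrite {2}/oproj (sesqui_sumr ss) big1// => i _.
  by rewrite (sesquiZr ss) oproj_orth// mulr0.
rewrite subr0 (sesquiDl ss) (sesquiNl ss); congr (_ - _).
rewrite /oproj (sesqui_suml ss); apply: eq_bigr => i _.
by rewrite (sesquiZl ss) [s (e i) x]semi_innerC normCK.
Qed.

Lemma oproj_linear m e a x y :
  oproj m e (a *: x + y) = a *: oproj m e x + oproj m e y.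
Proof.
rewrite /oproj scaler_sumr -big_split/=; apply: eq_bigr => i _.
by rewrite ss.1 scalerDl scalerA.
Qed.

Lemma seminorm_null x : s x x = 0 -> seminorm x = 0.
Proof. by move=> x0; rewrite /seminorm x0 sqrtC0. Qed.

(** Up to a null vector [y] lies in the span of the [e i], and the projection is the best
    approximation from that span. *)
Lemma oproj_best m e x y : orthon m e ->
  s (y - oproj m e y) (y - oproj m e y) = 0 ->
  seminorm (x - oproj m e x) <= seminorm (x - y).
Proof.
move=> oe /seminorm_null y0.
have -> : x - oproj m e x = (x - y - oproj m e (x - y)) + (y - oproj m e y).
  have -> : oproj m e (x - y) = oproj m e x - oproj m e y.
    by rewrite addrC -scaleN1r oproj_linear scaleN1r addrC.
  have E (a b c d : V) : a - b - (c - d) = a - c - (b - d).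
    by rewrite !opprD !opprK addrACA.
  by rewrite E subrK.
rewrite (le_trans (seminormD _ _))// y0 addr0.
rewrite -(@ler_pXn2r _ 2)// ?nnegrE ?seminorm_ge0// !seminorm_sqr oproj_sqr//.
by rewrite gerBl sumr_ge0// => i _; exact: exprn_ge0.
Qed.

(** As [s] may be degenerate, a vector with null residual contributes no new basis vector, and
    residuals are null rather than zero at the end. [P] carries a subspace, later the centre,
    through the construction. *)
Lemma gram_schmidt (P : V -> Prop) (xs : seq V) :
  P 0 -> (forall a x y, P x -> P y -> P (a *: x + y)) ->
  (forall x, List.In x xs -> P x) ->
  exists m (e : nat -> V), [/\ orthon m e, forall i, P (e i) &
    forall x, List.In x xs -> s (x - oproj m e x) (x - oproj m e x) = 0].
Proof.
move=> P0 PD; elim: xs => [|x xs IH] xsP; first by exists 0%N, (fun=> 0); split.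
have [|m [e [oe eP ex]]] := IH; first by move=> y ?; apply: xsP; right.
have Psum y k : P (oproj k e y).
  by rewrite /oproj; elim/big_ind: _ => // [u v Pu Pv|i _]; 
    [rewrite -[u]scale1r; exact: PD | rewrite -[_ *: _]addr0; exact: PD].
pose y := x - oproj m e x.
have Py : P y by rewrite /y addrC -scaleN1r; apply: PD => //; apply: xsP; left.
have [y0|/eqP y0] := pselect (s y y = 0).
  by exists m, e; split => // z [<-//|/ex].
(* The sequence is total, so the new vector is repeated from index [m] on; only the first [m.+1]
   entries count. *)
pose f i := if (i < m)%N then e i else (seminorm y)^-1 *: y.
have n0 : seminorm y != 0 by rewrite sqrtC_eq0.
have fe i : (i < m)%N -> f i = e i by rewrite /f => ->.
have fm : f m = (seminorm y)^-1 *: y by rewrite /f ltnn.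
have ye i : (i < m)%N -> s y (e i) = 0 by exact: oproj_orth.
have nr : (seminorm y)^* = seminorm y by rewrite geC0_conj// seminorm_ge0.
have of_ : orthon m.+1 f.
  move=> i j; rewrite !ltnS (leq_eqVlt i) (leq_eqVlt j) => /predU1P[->|im] /predU1P[->|jm].
  - rewrite fm (sesquiZl ss) (sesquiZr ss) eqxx fmorphV/= nr -seminorm_sqr. field.
    exact: n0.
  - by rewrite fm fe// (sesquiE ss) ye// mulr0 gtn_eqF.
  - by rewrite fm fe// (sesquiE ss) semi_innerC ye// conjC0 mulr0 ltn_eqF.
  - by rewrite !fe// oe.
have fproj z : oproj m.+1 f z = oproj m e z + s z (f m) *: f m.
  rewrite /oproj big_ord_recr/=; congr (_ + _).
  by apply: eq_bigr => i _; rewrite fe.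
exists m.+1, f; split => //.
  by rewrite /f => i; case: ifP => // _; rewrite -[_ *: _]addr0; exact: PD.
move=> z [<-|zx].
  rewrite fproj fm.
  have -> : s x ((seminorm y)^-1 *: y) *: ((seminorm y)^-1 *: y) = y; last first.
    by rewrite opprD addrA -/y subrr (sesqui0l ss).
  rewrite scalerA -[RHS]scale1r; congr (_ *: _).
  have -> : x = y + oproj m e x by rewrite subrK.
  rewrite (sesquiZr ss) (sesquiDl ss) /oproj (sesqui_suml ss) big1 ?addr0.
    by rewrite fmorphV/= nr -seminorm_sqr; field.
  by move=> i _; rewrite (sesquiZl ss) [s (e i) y]semi_innerC ye// conjC0 mulr0.
have zz := ex _ zx.
rewrite fproj opprD addrA; set u := z - _.
have -> : s z (f m) = 0.
  have -> : z = u + oproj m e z by rewrite subrK.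
  rewrite (sesquiDl ss) semi_null// add0r /oproj (sesqui_suml ss) big1// => i _.
  by rewrite (sesquiE ss) -(fe i)// of_ ?leqnn// ?ltnS ?(ltnW (ltn_ord i))// ltn_eqF// mulr0.
by rewrite scale0r subr0.
Qed.

End SemiInnerProducts.

Lemma semi_cs_sum (R : realType) (V : lmodType R[i]) (s : V -> V -> R[i]) (m : nat) (x y : 'I_m -> V) :
  sesqui s -> (forall x, 0 <= s x x) ->
  `|\sum_i s (x i) (y i)| ^+ 2 <= (\sum_i s (x i) (x i)) * (\sum_i s (y i) (y i)).
Proof.
move=> ss s0; pose S (f g : {ffun 'I_m -> V}) := \sum_i s (f i) (g i).
have Ss : sesqui S.
  split=> a f g h; rewrite /S mulr_sumr -big_split/=; apply: eq_bigr => i _.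
    by rewrite !ffunE ss.1.
  by rewrite !ffunE ss.2.
have S0 f : 0 <= S f f by apply: sumr_ge0.
have := semi_cs Ss S0 [ffun i => x i] [ffun i => y i].
have E (u v : 'I_m -> V) : S [ffun i => u i] [ffun i => v i] = \sum_i s (u i) (v i).
  by apply: eq_bigr => i _; rewrite !ffunE.
by rewrite !E.
Qed.

(** * Operators on Hilbert spaces *)

Lemma ge0_all_eps (R : realType) (w : R[i]) :
  (forall e, 0 < e -> exists2 r, 0 <= r & `|w - r| <= e) -> 0 <= w.
Proof.
move=> h; have E : w = `|w|; last by rewrite E.
apply: eq_all_eps => e e0; have e2 : 0 < e / 2 by rewrite divr_gt0.
have [r r0 wr] := h _ e2.
rewrite -[_ - _](subrKA r) [leRHS]splitr (le_trans (ler_normD _ _))// lerD//.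
by rewrite distrC -{1}(ger0_norm r0) (le_trans (ler_dist_dist _ _)).
Qed.

Lemma nat_ultra : exists F : set_system nat, UltraFilter F /\ \oo `<=` F.
Proof. exact: ultraFilterLemma. Qed.

Section Operators.
Variable R : realType.

Section Inner.
Variable H : hilbertType R.

Lemma inner_sesqui : sesqui (@inner R H).
Proof.
split=> a x y z; first exact: innerPl.
by rewrite innerDr innerZr.
Qed.

Lemma inner_ge0 (x : H) : 0 <= inner x x.
Proof. by rewrite inner_norm exprn_ge0. Qed.

Lemma innerBl (x y z : H) : inner (x - y) z = inner x z - inner y z.
Proof. by rewrite innerDl innerNl. Qed.

Lemma innerBr (x y z : H) : inner x (y - z) = inner x y - inner x z.
Proof. by rewrite innerDr innerNr. Qed.

Lemma norm_inner_le (x : H) (c : R[i]) : 0 <= c ->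
  (forall y, `|inner x y| <= c * `|y|) -> `|x| <= c.
Proof.
move=> c0 h; have [->|x0] := eqVneq x 0; first by rewrite normr0.
rewrite -(@ler_pM2r _ `|x|) ?normr_gt0// -expr2 -inner_norm.
by rewrite -(ger0_norm (inner_ge0 x)).
Qed.

End Inner.

Section Forms.
Variables (H K : hilbertType R).

Lemma form_bop (b : H -> K -> R[i]) (c : R[i]) : sesqui b -> 0 <= c ->
  (forall x y, `|b x y| <= c * `|x| * `|y|) ->
  exists a : bop H K, forall x y, inner (a x) y = b x y.
Proof.
move=> sb c0 bc.
have ex x : exists z, forall y, inner z y = b x y.
  have ly : linear (fun y => (b x y)^* : R[i]^o).
    by move=> a u v; rewrite sb.2 rmorphD/= rmorphM/= conjCK.
  have by_ y : `|(b x y)^* : R[i]^o| <= c * `|x| * `|y|.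
    by rewrite [leLHS]norm_conjC.
  have M0 : 0 <= c * `|x| by rewrite mulr_ge0.
  have [z hz] := riesz (Bop (bop_predP ly M0 by_)).
  exists z => y; rewrite innerC -hz/=; exact: conjCK.
have [a ha] := choice ex.
have la : linear a.
  move=> k x y; apply: inner_eq => z; rewrite innerC [RHS]innerC.
  by rewrite innerDl innerZl !ha sb.1.
have na x : `|a x| <= c * `|x|.
  by apply: norm_inner_le => [|y]; rewrite ?mulr_ge0// ha.
by exists (Bop (bop_predP la c0 na)).
Qed.

Lemma bop_normP (a : bop H K) x : `|a x| <= `|a| * `|x|.
Proof. exact: opnormP. Qed.

Lemma bop_norm_le (a : bop H K) (c : R[i]) : 0 <= c ->
  (forall x y, `|inner (a x) y| <= c * `|x| * `|y|) -> `|a| <= c.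
Proof.
move=> c0 h; apply: opnorm_le => // x.
by apply: norm_inner_le => [|y]; rewrite ?mulr_ge0.
Qed.

Lemma inner_bop_le (a : bop H K) x y :
  `|inner (a x) y| <= `|a| * `|x| * `|y|.
Proof.
by rewrite (le_trans (cauchy_schwarz _ _))// ler_wpM2r// bop_normP.
Qed.

Lemma bop_inner_eq (a b : bop H K) :
  (forall x y, inner (a x) y = inner (b x) y) -> a = b.
Proof.
move=> ab; apply: bop_eqP => x; apply: inner_eq => y.
by rewrite innerC ab -innerC.
Qed.

End Forms.

Section Projection.
Variables (H : hilbertType R) (S : set H).
Hypotheses (S0 : S 0) (SD : forall a x y, S x -> S y -> S (a *: x + y)).

(* The projection of [x] onto the closure of [S] is obtained as the weak limit
   of a minimizing sequence. *)
Lemma projection x : exists p, (forall s, S s -> inner (x - p) s = 0) /\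
  (forall e : R[i], 0 < e -> exists2 s, S s & `|p - s| < e).
Proof.
have [q qE] : {q : H -> R & forall y, `|y| ^+ 2 = (q y)%:C%C}.
  by exists (fun y => complex.Re `|y| ^+ 2) => y; rewrite rmorphXn/= -normRe.
have q0 y : 0 <= q y by rewrite -ler0c -qE exprn_ge0.
pose A := [set q (x - s) | s in S].
have Ainf : has_inf A.
  by split; [exists (q (x - 0)), 0 | exists 0 => _ [s _ <-]].
pose d := inf A.
have dle s : S s -> d <= q (x - s).
  by move=> Ss; apply: ge_inf; [exact: Ainf.2|exists s].
have [z zP] : {z : nat -> H & forall n, S (z n) /\
    q (x - z n) < d + (n.+1%:R^-1) ^+ 2}.
  apply: (@choice _ _ (fun n s => S s /\ q (x - s) < d + (n.+1%:R^-1) ^+ 2)) => n.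
  have n0 : 0 < (n.+1%:R^-1) ^+ 2 :> R by rewrite exprn_gt0// invr_gt0.
  by have [_ [s Ss <-] qs] := inf_adherent n0 Ainf; exists s.
(* Moving [z n] along [s] cannot bring the squared distance below [d], so the squared component of
   [x - z n] along [s] is at most the excess (n + 1)^-2. *)
have zs n s : S s -> `|inner (x - z n) s| <= `|s| * n.+1%:R^-1.
  move=> Ss; have [->|s0] := eqVneq s 0; first by rewrite inner0r normr0 normr0 mul0r.
  rewrite -(@ler_pXn2r _ 2)// ?nnegrE ?mulr_ge0// ?invr_ge0// exprMn mulrC.
  have s2 : 0 < `|s| ^+ 2 by rewrite exprn_gt0// normr_gt0.
  rewrite -ler_pdivrMr//; set l := inner (x - z n) s / `|s| ^+ 2.
  have := dle (l *: s + z n) (SD _ Ss (zP n).1).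
  have E := inner_proj (x - z n) s0.
  rewrite -/l -addrA -opprD [z n + _]addrC in E.
  have -> : `|inner (x - z n) s| ^+ 2 / `|s| ^+ 2 =
      (q (x - z n) - q (x - (l *: s + z n)))%:C%C.
    by rewrite rmorphB/= -!qE E opprB addrCA subrr addr0.
  rewrite (_ : n.+1%:R^-1 = (n.+1%:R^-1 : R)%:C%C); last first.
    by rewrite fmorphV/= rmorph_nat.
  rewrite -rmorphXn/= lecR; have := (zP n).2; move: (q _) (q _) (_ ^+ 2) => *.
  lra.
have [U [UU Uoo]] := nat_ultra; have pU : ProperFilter U := ultra_proper.
have [B B0 zB] : exists2 B : R[i], 0 < B & forall n, `|z n| <= B.
  exists (`|x| + (`|x - z 0%N| + 1 + 1)).
    by rewrite !addrA ltr_wpDl// !addr_ge0.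
  move=> n; rewrite -[z n](subKr x) (le_trans (ler_normB _ _))// lerD2l.
  rewrite -(@ler_pXn2r _ 2)// ?nnegrE ?addr_ge0// qE.
  have h : q (x - z n) < q (x - z 0%N) + 1.
    apply: lt_le_trans (zP n).2 _; apply: lerD; first exact/dle/(zP 0%N).1.
    by rewrite exprn_ile1 ?invr_ge0// invf_le1// ler1n.
  have {h} : (q (x - z n))%:C%C <= `|x - z 0%N| ^+ 2 + 1 :> R[i].
    by rewrite qE -[1]/(1%:C%C) -rmorphD lecR ltW.
  move=> /le_trans; apply; rewrite [leRHS]expr2 -addrA mulrDl mulrDr -expr2.
  rewrite -addrA lerD2l addrC -{1}[1]mulr1.
  rewrite -[leLHS]addr0 lerD// ?mulr_ge0// ?addr_ge0//.
  by rewrite ler_pM// ler_wpDl// lerDl.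
have zb y : ubounded U (fun n => inner y (z n)).
  apply: (@uboundedW _ _ _ UU _ (`|y| * B)) => n.
  by rewrite (le_trans (cauchy_schwarz _ _))// ler_wpM2l.
have [p pP] : exists p, forall y, inner y p = ulim U (fun n => inner y (z n)).
  have ly : linear (fun y => ulim U (fun n => inner y (z n)) : R[i]^o).
    move=> a u v; rewrite -[X in _ = X + _]/(a * _) -ulimZ// -ulimD//; last exact: uboundedZ.
    by congr ulim; apply/funext => n; rewrite innerPl.
  have by_ y : `|ulim U (fun n => inner y (z n)) : R[i]^o| <= B * `|y|.
    apply: ulim_norm_le; first by rewrite mulr_ge0// ltW.
    by apply: filterE => n /=; rewrite [B * _]mulrC (le_trans (cauchy_schwarz _ _))// ler_wpM2l.
  have [p hp] := riesz (Bop (bop_predP ly (ltW B0) by_)).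
  by exists p => y; rewrite -hp.
have small (e : R[i]) : 0 < e -> exists N, forall n, (N <= n)%N -> n.+1%:R^-1 < e.
  move=> /gt0_complexP[r r0 ->]; exists (Num.truncn r^-1) => n Nn.
  rewrite (_ : n.+1%:R^-1 = (n.+1%:R^-1 : R)%:C%C); last first.
    by rewrite fmorphV/= rmorph_nat.
  rewrite ltcR -[ltRHS]invrK ltf_pV2 ?posrE ?invr_gt0//.
  by rewrite (lt_le_trans (truncnS_gt _))// ler_nat ltnS.
have Unear (A' : set nat) N : (forall n, (N <= n)%N -> A' n) -> U A'.
  by move=> h; apply: Uoo; exists N.
have orth s : S s -> inner s (x - p) = 0.
  move=> Ss; rewrite innerBr pP.
  rewrite -(ulim_cst UU (inner s x)) -mulN1r -ulimZ// -ulimD//; last 2 first.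
  - exact: ubounded_cst.
  - exact: uboundedZ.
  apply: ulim_uniq => e e0.
  have s1 : 0 < `|s| + 1 by rewrite ltr_wpDl.
  have [N hN] := small _ (divr_gt0 e0 s1); apply: (Unear _ N) => n Nn /=.
  rewrite subr0 mulN1r -innerBr innerC norm_conjC (le_lt_trans (zs n _ Ss))//.
  have := hN _ Nn; rewrite ltr_pdivlMr// => /(le_lt_trans _); apply.
  by rewrite mulrC ler_wpM2l ?invr_ge0// lerDl.
exists p; split; first by move=> s Ss; rewrite innerC orth// conjC0.
have orthp : inner (x - p) p = 0.
  rewrite pP -[RHS](ulim_cst UU 0); apply: (eq_ulim UU).
  apply: filterE => n /=; rewrite innerC orth ?conjC0//; exact: (zP n).1.
have zp n : `|inner (x - z n) p| <= B * n.+1%:R^-1.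
  rewrite pP; apply: ulim_norm_le => //.
    by rewrite mulr_ge0 ?invr_ge0// ltW.
  apply: filterE => m /=; rewrite (le_trans (zs _ _ (zP m).1))//.
  by rewrite ler_wpM2r ?invr_ge0.
(* The weak limit is a norm limit: x - p is orthogonal to p and to every z n, so |p - z n|^2 = <x -
   z n, p - z n>, and both terms of this are O(1 / n). *)
have pz n : `|p - z n| ^+ 2 <= 2 * B * n.+1%:R^-1.
  have -> : `|p - z n| ^+ 2 = inner (x - z n) (p - z n).
    rewrite -inner_norm; apply/eqP; rewrite eq_sym -subr_eq0 -innerBl.
    have -> : x - z n - (p - z n) = x - p by rewrite opprB addrA subrK.
    by rewrite innerBr orthp innerC orth ?conjC0 ?subrr//; exact: (zP n).1.
  have nn : 0 <= `|inner (x - z n) (p - z n)| by [].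
  have : `|inner (x - z n) (p - z n)| <= 2 * B * n.+1%:R^-1.
    rewrite innerBr (le_trans (ler_normB _ _))// -mulrA mulr2n mulrDl !mul1r lerD//.
    by rewrite (le_trans (zs _ _ (zP n).1))// ler_wpM2r ?invr_ge0.
  apply: le_trans; rewrite ger0_norm//.
  have -> : inner (x - z n) (p - z n) = inner (p - z n) (p - z n).
    apply/eqP; rewrite -subr_eq0 -innerBl.
    have -> : x - z n - (p - z n) = x - p by rewrite opprB addrA subrK.
    by rewrite innerBr orthp innerC orth ?conjC0 ?subrr//; exact: (zP n).1.
  exact: inner_ge0.
move=> e e0; have B2 : 0 < 2 * B by rewrite mulr_gt0.
have [N hN] := small _ (divr_gt0 (exprn_gt0 2 e0) B2).
exists (z N); first exact: (zP N).1.
rewrite -(@ltr_pXn2r _ 2)// ?nnegrE ?(ltW e0)// (le_lt_trans (pz N))//.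
by have := hN _ (leqnn N); rewrite ltr_pdivlMr// mulrC.
Qed.

End Projection.

Section Adjoint.
Variable H : hilbertType R.
Implicit Types (a b p q : bop H H).

Lemma adj_eq a b : (forall x y, inner (a x) y = inner x (b y)) -> adj a = b.
Proof.
by move=> ab; apply: bop_eqP => x; apply: inner_eq => y; rewrite -adjE ab.
Qed.

Lemma adjD a b : adj (a + b) = adj a + adj b.
Proof. by apply: adj_eq => x y; rewrite !bopD innerDl innerDr !adjE. Qed.

Lemma adjZ c a : adj (c *: a) = c^* *: adj a.
Proof. by apply: adj_eq => x y; rewrite bopZ bopZ innerZl innerZr conjCK adjE. Qed.

Lemma adj1 : adj (1 : bop H H) = 1.
Proof. exact: adj_eq. Qed.

Lemma adjN a : adj (- a) = - adj a.
Proof. by rewrite -scaleN1r adjZ rmorphN1 scaleN1r. Qed.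

Lemma norm_adj_le a : `|adj a| <= `|a|.
Proof.
apply: bop_norm_le => // x y; rewrite -adjEr (le_trans (cauchy_schwarz _ _))//.
by rewrite mulrC mulrAC ler_wpM2r// bop_normP.
Qed.

Lemma norm_bopM a b : `|a * b| <= `|a| * `|b|.
Proof.
apply: bop_norm_le => [|x y]; first by rewrite mulr_ge0.
rewrite bopME (le_trans (inner_bop_le _ _ _))// ler_wpM2r// -mulrA ler_wpM2l//.
exact: bop_normP.
Qed.

Lemma bopB a b x : (a - b) x = a x - b x. Proof. by []. Qed.

Lemma bop1E x : (1 : bop H H) x = x. Proof. by []. Qed.

Lemma bop_sumE (I : Type) (r : seq I) (F : I -> bop H H) x :
  (\sum_(i <- r) F i) x = \sum_(i <- r) F i x.
Proof. by elim/big_rec2: _ => [|i y f _ <-]; rewrite ?bopD. Qed.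

Definition bpos a : Prop := forall x, 0 <= inner (a x) x.

Lemma bpos_sesqui a : sesqui (fun x y => inner (a x) y).
Proof.
split=> c x y z; first by rewrite linearP innerPl.
by rewrite innerDr innerZr.
Qed.

Lemma bpos_adj a : bpos a -> adj a = a.
Proof.
move=> pa; apply: adj_eq => x y; rewrite (semi_innerC (bpos_sesqui a) pa y x).
by rewrite [RHS]innerC.
Qed.

Lemma bpos_sym a : bpos a -> forall x y, inner (a x) y = inner x (a y).
Proof. by move=> pa x y; rewrite adjE bpos_adj. Qed.

Lemma bposD a b : bpos a -> bpos b -> bpos (a + b).
Proof. by move=> pa pb x; rewrite bopD innerDl; exact: addr_ge0. Qed.

Lemma bposZ c a : 0 <= c -> bpos a -> bpos (c *: a).
Proof. by move=> c0 pa x; rewrite bopZ innerZl; exact: mulr_ge0. Qed.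

Lemma bpos_adjM a : bpos (adj a * a).
Proof. by move=> x; rewrite bopME -adjEr inner_ge0. Qed.

Lemma bpos_normB a c : adj a = a -> `|a| <= c -> bpos (c *: (1 : bop H H) - a).
Proof.
move=> sa ac x; rewrite bopB bopZ bop1E innerBl innerZl inner_norm subr_ge0.
have r : inner (a x) x \is Num.real by rewrite CrealE -innerC adjEr sa.
apply: le_trans (real_ler_norm r) _.
rewrite (le_trans (inner_bop_le _ _ _))// -mulrA -expr2 ler_wpM2r//.
exact: exprn_ge0.
Qed.

Lemma bpos_conj a p : bpos p -> bpos (adj a * p * a).
Proof. by move=> pp x; rewrite -mulrA bopME -adjEr; exact: pp. Qed.

(* Riesz--Nagy: if 0 <= p <= 1, iterating p |-> p - p^2 writes p as a strongly
   convergent sum of squares of operators that commute with q. *)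
Lemma bposM_contr p q : bpos p -> bpos (1 - p) -> bpos q -> p * q = q * p ->
  bpos (q * p).
Proof.
move=> pp pp1 pq cpq v.
pose f n := iter n (fun a : bop H H => a - a * a) p.
have fS n : f n.+1 = f n - f n * f n by [].
have fP n : [/\ bpos (f n), bpos (1 - f n) & f n * q = q * f n].
  elim: n => [|n [f0 f1 fq]]; first by split.
  split; rewrite fS.
  (* Positivity of a - a^2 without square roots: a - a^2 = a (1 - a) a + (1 - a) a (1 - a). *)
  - have E1 : f n * (1 - f n) * f n = f n * f n - f n * f n * f n.
      by rewrite mulrBr mulr1 mulrBl.
    have E2 : (1 - f n) * f n * (1 - f n) = (f n - f n * f n) - (f n * f n - f n * f n * f n).
      by rewrite mulrBr mulr1 [(1 - f n) * _]mulrBl mul1r mulrBl.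
    have -> : f n - f n * f n = f n * (1 - f n) * f n + (1 - f n) * f n * (1 - f n).
      by rewrite E1 E2 [RHS]addrC subrK.
    apply: bposD; first by rewrite -{1}(bpos_adj f0); exact: bpos_conj.
    by rewrite -{1}(bpos_adj f1); exact: bpos_conj.
  - rewrite opprD opprK addrA; apply: bposD => //.
    by rewrite -{1}(bpos_adj f0); exact: bpos_adjM.
  - by rewrite mulrBr mulrBl fq -mulrA fq !mulrA fq.
have sumE n : p = \sum_(k < n) f k * f k + f n.
  elim: n => [|n IH]; first by rewrite big_ord0 add0r.
  by rewrite fS big_ord_recr/= -addrA [f n * f n + _]addrC subrK.
apply: ge0_all_eps => e e0.
(* The squares |f k v|^2 have partial sums at most <p v, v>, so they cannot all stay above c^2. *)
have [n fn] : exists n, `|q| * `|f n v| * `|v| <= e.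
  pose c := e / (`|q| * `|v| + 1).
  have c1 : 0 < `|q| * `|v| + 1 by rewrite ltr_wpDl ?mulr_ge0.
  have c0 : 0 < c by rewrite divr_gt0.
  have [[n fn]|/forallNP h] := pselect (exists n, `|f n v| <= c).
    exists n; rewrite mulrAC (le_trans (ler_wpM2l _ fn))// ?mulr_ge0//.
    by rewrite mulrA ler_pdivrMr// mulrC ler_wpM2l ?lerDl// ltW.
  have : c ^+ 2 = 0.
    apply: (@ler_nat_mul0 _ _ (inner (p v) v)) => //.
      by rewrite exprn_ge0// ltW.
    move=> n; rewrite (sumE n) bopD innerDl.
    have -> : inner ((\sum_(k < n) f k * f k) v) v = \sum_(k < n) `|f k v| ^+ 2.
      rewrite bop_sumE (sesqui_suml (inner_sesqui _)); apply: eq_bigr => k _.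
      have [f0 _ _] := fP k.
      by rewrite bopME bpos_sym// inner_norm.
    have [f0 _ _] := fP n; rewrite -[leLHS]addr0 lerD//.
    rewrite mulr_natl -[X in _ *+ X]card_ord -sumr_const ler_sum// => k _.
    rewrite ler_pXn2r// ?nnegrE ?(ltW c0)//.
    by have /negP := h k; rewrite -real_ltNge ?ger0_real ?(ltW c0)// => /ltW.
  by move=> /eqP; rewrite sqrf_eq0 gt_eqF.
exists (\sum_(k < n) inner (q (f k v)) (f k v)); first exact: sumr_ge0.
rewrite (sumE n) mulrDr mulr_sumr bopD innerDl.
have -> : inner ((\sum_(k < n) q * (f k * f k)) v) v
    = \sum_(k < n) inner (q (f k v)) (f k v).
  rewrite bop_sumE (sesqui_suml (inner_sesqui _)); apply: eq_bigr => k _.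
  have [f0 _ fq] := fP k.
  by rewrite mulrA -fq -mulrA bopME bpos_sym.
rewrite addrC addKr bopME (le_trans (cauchy_schwarz _ _))//.
by rewrite (le_trans _ fn)// ler_wpM2r// bop_normP.
Qed.

Lemma bposM p q : bpos p -> bpos q -> p * q = q * p -> bpos (q * p).
Proof.
move=> pp pq cpq; have n0 : 0 < `|p| + 1 by rewrite ltr_wpDl.
have -> : q * p = (`|p| + 1) *: (q * ((`|p| + 1)^-1 *: p)).
  by rewrite bopMZr scalerA mulfV ?gt_eqF// scale1r.
apply: bposZ; first exact: ltW.
apply: bposM_contr => //.
- by apply: bposZ => //; rewrite invr_ge0 ltW.
- rewrite -[1]scale1r; apply: bpos_normB.
    by rewrite adjZ bpos_adj// geC0_conj// invr_ge0 ltW.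
  rewrite normrZ normfV ger0_norm ?(ltW n0)// mulrC ler_pdivrMr// mul1r.
  by rewrite lerDl.
- by rewrite bopMZl bopMZr cpq.
Qed.

End Adjoint.
End Operators.

(** * Functionals on von Neumann algebras *)

Section DualSpaces.
Variables (R : realType) (V : normedModType R[i]).
Implicit Types (phi psi : dual V).

Lemma dualD phi x y : phi (x + y) = phi x + phi y.
Proof. exact: linearD. Qed.

Lemma dualB phi x y : phi (x - y) = phi x - phi y.
Proof. exact: linearB. Qed.

Lemma dualZ phi c x : phi (c *: x) = c * phi x.
Proof. exact: linearZ. Qed.

Lemma dual0 phi : phi 0 = 0.
Proof. exact: linear0. Qed.

Lemma dual_sum phi (I : Type) (r : seq I) (F : I -> V) :
  phi (\sum_(i <- r) F i) = \sum_(i <- r) phi (F i).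
Proof. exact: linear_sum. Qed.

Lemma dual_le phi x : `|phi x : R[i]| <= `|phi| * `|x|.
Proof. exact: (opnormP phi x). Qed.

Lemma dual_ex (f : V -> R[i]) (C : R[i]) :
  (forall c x y, f (c *: x + y) = c * f x + f y) -> 0 <= C ->
  (forall x, `|f x| <= C * `|x|) ->
  exists phi : dual V, (forall x, phi x = f x) /\ `|phi| <= C.
Proof.
move=> lf C0 fC; have lf' : linear (f : V -> R[i]^o) by move=> c x y; exact: lf.
exists (Bop (bop_predP lf' C0 fC)); split => //.
exact: opnorm_le.
Qed.

Lemma dual_addE phi psi x : (phi + psi) x = phi x + psi x. Proof. by []. Qed.

Lemma dual_scaleE c phi x : (c *: phi) x = c * phi x. Proof. by []. Qed.

Lemma dual_sumE (I : Type) (r : seq I) (F : I -> dual V) x :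
  (\sum_(i <- r) F i) x = \sum_(i <- r) (F i x : R[i]).
Proof. by elim/big_rec2: _ => [|i y f _ <-]; rewrite ?dual_addE. Qed.

(** The Banach--Alaoglu theorem in ultrafilter form. *)
Lemma ulim_dual (I : Type) (F : set_system I) (f : I -> dual V) (C : R[i]) :
  UltraFilter F -> 0 <= C -> F [set i | `|f i| <= C] ->
  exists phi : dual V, (forall x, phi x = ulim F (fun i => f i x)) /\ `|phi| <= C.
Proof.
move=> FF C0 fC; have pF : ProperFilter F := ultra_proper.
have bf x : F [set i | `|f i x : R[i]| <= C * `|x|].
  apply: (@filterS _ F _ _ _ _ fC) => i /= h; rewrite (le_trans (dual_le _ _))//.
  by rewrite ler_wpM2r.
have ub x : ubounded F (fun i => f i x) by exists (C * `|x|).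
apply: dual_ex => // [c x y|x]; last by apply: ulim_norm_le; rewrite ?mulr_ge0.
rewrite -ulimZ// -ulimD//; last exact: uboundedZ.
by congr ulim; apply/funext => i; rewrite dualD dualZ.
Qed.

End DualSpaces.

Section VonNeumann.
Variables (R : realType) (H : hilbertType R) (M : vnalg H).
Implicit Types (a b c : vn M) (phi psi : dual (vn M)).

Lemma vnME a b x : (a * b) x = a (b x). Proof. by []. Qed.
Lemma vnDE a b x : (a + b) x = a x + b x. Proof. by []. Qed.
Lemma vnBE a b x : (a - b) x = a x - b x. Proof. by []. Qed.
Lemma vnZE k a x : (k *: a) x = k *: a x. Proof. by []. Qed.
Lemma vn1E x : (1 : vn M) x = x. Proof. by []. Qed.
Lemma vn0E x : (0 : vn M) x = 0. Proof. by []. Qed.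

Lemma vn_sumE (I : Type) (r : seq I) (F : I -> vn M) x :
  (\sum_(i <- r) F i) x = \sum_(i <- r) F i x.
Proof. by elim/big_rec2: _ => [|i y f _ <-]. Qed.

Lemma vn_eq a b : (forall x y, inner (a x) y = inner (b x) y) -> a = b.
Proof. by move=> h; apply/val_inj/bop_inner_eq. Qed.

Lemma starE a x y : inner (star a x) y = inner x (a y).
Proof. by rewrite -adjEr. Qed.

Lemma starEr a x y : inner x (star a y) = inner (a x) y.
Proof. by rewrite -adjE. Qed.

Lemma starK a : star (star a) = a.
Proof. by apply/val_inj; exact: adjK. Qed.

Lemma starD a b : star (a + b) = star a + star b.
Proof. by apply/val_inj; exact: adjD. Qed.

Lemma starZ k a : star (k *: a) = k^* *: star a.
Proof. by apply/val_inj; exact: adjZ. Qed.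

Lemma starN a : star (- a) = - star a.
Proof. by apply/val_inj; exact: adjN. Qed.

Lemma starB a b : star (a - b) = star a - star b.
Proof. by rewrite starD starN. Qed.

Lemma starM a b : star (a * b) = star b * star a.
Proof. by apply/val_inj; exact: adjM. Qed.

Lemma star1 : star (1 : vn M) = 1.
Proof. by apply/val_inj; exact: adj1. Qed.

Lemma star0 : star (0 : vn M) = 0.
Proof. by rewrite -{1}[0](scale0r (0 : vn M)) starZ conjC0 scale0r. Qed.

Lemma star_sum (I : Type) (r : seq I) (F : I -> vn M) :
  star (\sum_(i <- r) F i) = \sum_(i <- r) star (F i).
Proof. by elim/big_rec2: _ => [|i y f _ <-]; [exact: star0 | exact: starD]. Qed.

Lemma norm_star a : `|star a| <= `|a|.
Proof. exact: norm_adj_le. Qed.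

Lemma norm_vnM a b : `|a * b| <= `|a| * `|b|.
Proof. exact: norm_bopM. Qed.

Lemma vn_normP a x : `|a x| <= `|a| * `|x|.
Proof. exact: bop_normP. Qed.

Lemma vn_norm_le a (c : R[i]) : 0 <= c ->
  (forall x y, `|inner (a x) y| <= c * `|x| * `|y|) -> `|a| <= c.
Proof. exact: bop_norm_le. Qed.

Lemma vn_scaleMl k a b : (k *: a) * b = k *: (a * b).
Proof. by apply/val_inj; exact: bopMZl. Qed.

Lemma vn_scaleMr k a b : a * (k *: b) = k *: (a * b).
Proof. by apply/val_inj; exact: bopMZr. Qed.

(** Slices are built with it: the operator of a form compatible with every [S] in the commutant
    commutes with the commutant, hence lies in the bicommutant, which is [M]. *)
Lemma form_vn (f : H -> H -> R[i]) (c : R[i]) : sesqui f -> 0 <= c ->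
  (forall x y, `|f x y| <= c * `|x| * `|y|) ->
  (forall S, commutant (vn_set M) S -> forall x y, f (S x) y = f x (adj S y)) ->
  exists a : vn M, (forall x y, inner (a x) y = f x y) /\ `|a| <= c.
Proof.
move=> sf c0 fc fS; have [a ha] := form_bop sf c0 fc.
have Ma : a \in vn_pred M.
  apply/asboolP; rewrite -vn_bicommutant => S SM; apply: bop_inner_eq => x y.
  by rewrite !bopME ha fS// -ha -adjE.
exists (Vn Ma); split => [x y|]; first exact: ha.
by apply: vn_norm_le => // x y; rewrite ha.
Qed.

Lemma vf_subproof x y :
  (fun a : vn M => inner (a x) y : R[i]^o) \in @bop_pred R (vn M) R[i]^o.
Proof.
have l : linear (fun a : vn M => inner (a x) y : R[i]^o).
  by move=> k a b; rewrite vnDE vnZE innerPl.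
apply: (@bop_predP _ _ _ _ (`|x| * `|y|) l); first by rewrite mulr_ge0.
by move=> a; rewrite mulrC mulrA; exact: inner_bop_le.
Qed.

Definition vf x y : dual (vn M) := Bop (vf_subproof x y).

Lemma vfE x y a : vf x y a = inner (a x) y. Proof. by []. Qed.

Lemma norm_vf x y : `|vf x y| <= `|x| * `|y|.
Proof.
apply: opnorm_le => [a|]; last by rewrite mulr_ge0.
by rewrite mulrC mulrA; exact: inner_bop_le.
Qed.

Lemma dmul_subproof c phi d :
  (fun a : vn M => phi (c * a * d)) \in @bop_pred R (vn M) R[i]^o.
Proof.
have l : linear (fun a : vn M => phi (c * a * d)).
  move=> k a b; rewrite mulrDr mulrDl vn_scaleMr vn_scaleMl.
  by rewrite dualD dualZ.
apply: (@bop_predP _ _ _ _ (`|phi| * `|c| * `|d|) l).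
  by rewrite !mulr_ge0.
move=> a; rewrite (le_trans (dual_le _ _))// -!mulrA ler_wpM2l//.
rewrite (le_trans (norm_vnM _ _))// [`|d| * _]mulrC ler_wpM2l//.
exact: norm_vnM.
Qed.

Definition dmul c phi d : dual (vn M) := Bop (dmul_subproof c phi d).

Lemma dmulE c phi d a : dmul c phi d a = phi (c * a * d). Proof. by []. Qed.

Lemma dstar_subproof phi :
  (fun a : vn M => (phi (star a))^* : R[i]^o) \in @bop_pred R (vn M) R[i]^o.
Proof.
have l : linear (fun a : vn M => (phi (star a))^* : R[i]^o).
  move=> k a b; rewrite starD starZ dualD dualZ rmorphD/= rmorphM/= conjCK.
  by [].
apply: (@bop_predP _ _ _ _ `|phi| l) => // a.
rewrite [leLHS]norm_conjC (le_trans (dual_le _ _))// ler_wpM2l//.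
exact: norm_star.
Qed.

Definition dstar phi : dual (vn M) := Bop (dstar_subproof phi).

Lemma dstarE phi a : dstar phi a = (phi (star a))^*. Proof. by []. Qed.

Definition dpos phi : Prop := forall a, bpos a -> 0 <= (phi a : R[i]).

Lemma dpos_vf x : dpos (vf x x).
Proof. by move=> a; exact. Qed.

Lemma bpos_starM a : bpos (star a * a : vn M).
Proof. exact: bpos_adjM. Qed.

Section PositiveFunctional.
Variable phi : dual (vn M).
Hypothesis phi_pos : dpos phi.

Definition dform a b : R[i] := phi (star b * a).

Lemma dform_sesqui : sesqui dform.
Proof.
split=> k a b d; rewrite /dform.
  by rewrite mulrDr vn_scaleMr dualD dualZ.
by rewrite starD starZ mulrDl vn_scaleMl dualD dualZ.
Qed.

Lemma dform_ge0 a : 0 <= dform a a.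
Proof. exact/phi_pos/bpos_starM. Qed.

Lemma dpos_conj a : phi (star a) = (phi a)^*.
Proof.
have := semi_innerC dform_sesqui dform_ge0 a 1.
by rewrite /dform star1 mul1r mulr1.
Qed.

Lemma dpos1_ge0 : 0 <= (phi 1 : R[i]).
Proof. by have := dform_ge0 1; rewrite /dform star1 mul1r. Qed.

Lemma bpos_sqrB a b : bpos ((`|a| ^+ 2) *: (star b * b) - star b * star a * (a * b) : vn M).
Proof.
move=> x; rewrite vnBE vnZE innerBl innerZl subr_ge0 -mulrA 4!vnME !starE.
rewrite !inner_norm -exprMn ler_pXn2r// ?nnegrE ?mulr_ge0//.
exact: vn_normP.
Qed.

Lemma dpos_bound a b : phi (star b * star a * (a * b)) <= `|a| ^+ 2 * phi (star b * b) :> R[i].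
Proof. by rewrite -subr_ge0 -dualZ -dualB; exact/phi_pos/bpos_sqrB. Qed.

(** Cauchy--Schwarz against 1, combined with a^* a <= |a|^2; a positive functional attains its norm
    at 1. *)
Lemma dpos_le a : `|phi a : R[i]| <= `|a| * phi 1.
Proof.
have p1 := dpos1_ge0.
rewrite -(@ler_pXn2r _ 2)// ?nnegrE ?mulr_ge0//.
have := semi_cs dform_sesqui dform_ge0 a 1.
rewrite /dform star1 !mul1r => /le_trans; apply.
have := dpos_bound a 1; rewrite star1 !mul1r !mulr1 => h.
by rewrite exprMn expr2 [phi 1 ^+ 2]expr2 mulrA ler_wpM2r.
Qed.

End PositiveFunctional.

End VonNeumann.

Lemma In_cat (T : Type) (x : T) s1 s2 :
  List.In x (s1 ++ s2) <-> List.In x s1 \/ List.In x s2.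
Proof. by elim: s1 => [|y s IH] /=; tauto. Qed.

(** * Central elements and states under which they take definite values *)

Section Central.
Variables (R : realType) (H : hilbertType R) (M : vnalg H).
Implicit Types (a b c : vn M) (phi psi rho : dual (vn M)).

Definition central c : Prop := forall a, c * a = a * c.

Lemma central_star c : central c -> central (star c).
Proof. by move=> cc a; rewrite -[a]starK -!starM cc. Qed.

Lemma centralM b c : central b -> central c -> central (b * c).
Proof. by move=> cb cc a; rewrite -mulrA cc mulrA cb mulrA. Qed.

Lemma centralD b c : central b -> central c -> central (b + c).
Proof. by move=> cb cc a; rewrite mulrDl mulrDr cb cc. Qed.

Lemma centralZ k c : central c -> central (k *: c).
Proof. by move=> cc a; rewrite vn_scaleMl vn_scaleMr cc. Qed.

Lemma centralN c : central c -> central (- c).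
Proof. by move=> cc; rewrite -scaleN1r; exact: centralZ. Qed.

Lemma central1 : central 1.
Proof. by move=> a; rewrite mul1r mulr1. Qed.

Lemma central0 : central 0.
Proof. by move=> a; rewrite mul0r mulr0. Qed.

Lemma centralX c n : central c -> central (c ^+ n).
Proof.
move=> cc; elim: n => [|n IH]; first exact: central1.
by rewrite exprS; exact: centralM.
Qed.

Lemma central_sum (I : Type) (r : seq I) (F : I -> vn M) :
  (forall i, central (F i)) -> central (\sum_(i <- r) F i).
Proof.
move=> h; elim/big_ind: _ => //; [exact: central0 | exact: centralD].
Qed.

Lemma starX b n : star (b ^+ n) = star b ^+ n.
Proof.
elim: n => [|n IH]; first exact: star1.
by rewrite exprS starM IH -exprSr.
Qed.

(** For positive [p] and [a] the product p a is positive because the two commute ([bposM]). *)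
Lemma dpos_central phi (p : vn M) : dpos phi ->
  bpos p -> central p -> dpos (dmul p phi 1).
Proof.
move=> pp p0 cp a a0; rewrite dmulE mulr1; apply: pp.
by apply: bposM => //; rewrite -[LHS]/(vn_val (a * p)) -cp.
Qed.

(* Power iteration: the states phi (|b|^2k .) / phi (|b|^2k) cluster at a state
   under which |b|^2 takes a definite value. *)
Lemma power_iteration phi b : dpos phi -> phi 1 = 1 -> central b ->
  exists rho (L : R[i]), [/\ dpos rho, rho 1 = 1,
    forall x, rho (star b * b * x) = L * rho x, phi (star b * b) <= L :> R[i] &
    forall c k, central c -> (forall x, phi (c * x) = k * phi x) ->
      forall x, rho (c * x) = k * rho x].
Proof.
move=> pp p1 cb; set B := star b * b.
have cB : central B by apply: centralM => //; exact: central_star.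
have sB : star B = B by rewrite /B starM starK.
(* If phi (B) = 0 then B is a null vector for phi, and phi itself serves with L = 0. *)
have [/eqP B0|Bn0] := eqVneq (phi B : R[i]) 0.
  exists phi, 0; split => // [x|]; last by rewrite (eqP B0).
  rewrite mul0r.
  have BB : dform phi B B = 0.
    apply/le_anti; rewrite dform_ge0// andbT /dform /B starM starK.
    have := dpos_bound pp (star b) b.
    by rewrite starK (eqP B0) mulr0.
  have := semi_null_r (dform_sesqui phi) (dform_ge0 pp) x BB.
  by rewrite /dform sB.
have BX k : B ^+ k = star (b ^+ k) * b ^+ k.
  rewrite starX -exprMn_comm//; exact: central_star.
have BXpos k : bpos (B ^+ k) by rewrite BX; exact: bpos_starM.
pose psi k := dmul (B ^+ k) phi 1.
have psiE k x : psi k x = phi (B ^+ k * x) by rewrite dmulE mulr1.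
have psi_pos k : dpos (psi k) by apply: dpos_central => //; exact: centralX.
have [m mE] : {m : nat -> R & forall k, phi (B ^+ k) = (m k)%:C%C}.
  exists (fun k => complex.Re (phi (B ^+ k))) => k.
  by rewrite RRe_real// ger0_real// pp.
have m0 : m 0%N = 1.
  by have := mE 0%N; rewrite expr0 p1 => /(congr1 (@complex.Re R)).
(* By Cauchy--Schwarz the moments phi (B^k) are log-convex, so their successive ratios [r k]
   increase; bounded by |B|, they converge to [L]. *)
have cs k : m k.+1 ^+ 2 <= m k * m k.+2.
  have := semi_cs (dform_sesqui (psi k)) (dform_ge0 (psi_pos k)) B 1.
  rewrite /dform star1 sB !mul1r !psiE mulr1 -exprSr mulrA -2!exprSr !mE.
     rewrite ger0_norm; last by rewrite -(mE k.+1) pp.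
  by rewrite -rmorphXn -rmorphM lecR mulrC.
have m_gt0 k : 0 < m k /\ 0 < m k.+1.
  elim: k => [|k [k0 k1]].
    split; first by rewrite m0 ltr01.
    rewrite lt_neqAle eq_sym -lecR -mE pp// andbT; apply: contra_neq Bn0 => h.
    by rewrite -[B]expr1 mE h.
  split => //; have := cs k; rewrite ltNge; apply: contraL => h.
  rewrite -ltNge (@le_lt_trans _ _ 0)// ?exprn_gt0//.
  by rewrite mulr_ge0_le0// ltW.
have mg k : 0 < m k by have [] := m_gt0 k.
pose r k := m k.+1 / m k.
have r_incr k : r k <= r k.+1.
  by rewrite /r ler_pdivrMr// mulrAC ler_pdivlMr// -expr2 mulrC cs.
have [D BD] : exists D : R, `|B| = D%:C%C by exists (complex.Re `|B|); rewrite -normRe.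
have rD k : r k <= D.
  rewrite ler_pdivrMr// -lecR rmorphM/= -BD -!mE.
  have := dpos_le (psi_pos k) B; rewrite !psiE -exprSr mulr1 => h.
  by rewrite (le_trans _ h)// ger0_norm// pp.
have hs : has_sup (range r) by split; [exists (r 0%N), 0%N | exists D => _ [k _ <-]].
pose L := sup (range r).
have rL k : r k <= L by apply: ub_le_sup; [exact: hs.2 | exists k].
have mono j k : (j <= k)%N -> r j <= r k.
  by move=> /subnK <-; elim: (k - j)%N => [//|n IH]; rewrite addSn (le_trans IH).
have r0 k : 0 <= r k by rewrite divr_ge0// ltW.
have [U [UU Uoo]] := nat_ultra.
have [f fE] : exists f : nat -> dual (vn M), forall k x,
    f k x = ((m k)^-1)%:C%C * phi (B ^+ k * x).
  by exists (fun k => ((m k)^-1)%:C%C *: psi k) => k x; rewrite dual_scaleE psiE.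
have f_le k : `|f k| <= 1.
  apply: opnorm_le => // x; rewrite mul1r fE normrM -psiE.
  rewrite ger0_norm ?ler0c ?invr_ge0 ?(ltW (mg k))//.
  have mC : 0 < (m k)%:C%C :> R[i] by rewrite ltcR.
  have -> : ((m k)^-1)%:C%C = ((m k)%:C%C)^-1 :> R[i] by rewrite fmorphV.
  rewrite mulrC ler_pdivrMr//.
  by have := dpos_le (psi_pos k) x; rewrite [psi k 1]psiE mulr1 mE.
have pU : ProperFilter U := ultra_proper.
have [rho [rhoE _]] := @ulim_dual _ _ _ U f 1 UU ler01 (filterE _ f_le).
have ub x : ubounded U (fun k => f k x).
  exists `|x|; apply: filterE => k.
  apply: (@le_trans _ _ (`|f k| * `|x|)); first exact: dual_le.
  by rewrite ler_piMl.
have fr k : f k B = (r k)%:C%C.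
  by rewrite fE -exprSr mE -rmorphM mulrC.
have rhoB : rho B = L%:C%C.
  rewrite rhoE; apply: ulim_uniq => _ /gt0_complexP[e e0 ->].
  have [_ [N _ <-] hN] := sup_adherent e0 hs.
  apply: Uoo; exists N => // k /= Nk; rewrite fr -rmorphB normc_def/=.
  rewrite expr0n/= addr0 sqrtr_sqr ltcR ler0_norm ?subr_le0// opprB ltrBlDr addrC -ltrBlDr.
  by rewrite (lt_le_trans hN)// mono.
have rho1 : rho 1 = 1.
  rewrite rhoE -[RHS](ulim_cst UU); apply: (eq_ulim UU); apply: filterE => k /=.
  by rewrite fE mulr1 mE -rmorphM mulVf ?gt_eqF.
have rho_pos : dpos rho.
  move=> a a0; rewrite rhoE; apply: ulim_ge0 => //; apply: filterE => k /=.
  by rewrite fE -psiE mulr_ge0 ?psi_pos// ler0c invr_ge0 ltW.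
(* Together with rho (B) = L this leaves B no variance under rho, which is what makes its value
   definite. *)
have rhoBB : rho (B * B) <= (L%:C%C) ^+ 2 :> R[i].
  rewrite -subr_ge0 rhoE -(ulim_cst UU (_ ^+ 2)) -mulN1r -ulimZ// -(ulimD UU); last 2 first.
  - exact: ubounded_cst.
  - exact: uboundedZ.
  apply: ulim_ge0; first by apply: uboundedD; [exact: ubounded_cst | exact: uboundedZ].
  apply: filterE => k /=; rewrite mulN1r subr_ge0 fE mulrA -2!exprSr mE -rmorphM -rmorphXn lecR.
  have -> : (m k)^-1 * m k.+2 = r k * r k.+1.
    by rewrite /r; field; rewrite !gt_eqF.
  by rewrite expr2 ler_pM.
have Lc : (L%:C%C)^* = L%:C%C :> R[i].
  by rewrite geC0_conj// ler0c (le_trans (r0 0%N)).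
pose E : vn M := B - L%:C%C *: (1 : vn M).
have nul : dform rho E E = 0.
  apply/le_anti; rewrite dform_ge0// andbT /dform /E starB starZ star1 sB.
  rewrite Lc mulrBl dualB !mulrBr !vn_scaleMl !vn_scaleMr !mul1r !mulr1.
  rewrite !dualB !dualZ rhoB rho1 mulr1 subrr subr0.
  by rewrite subr_le0 -expr2.
exists rho, L%:C%C; split => //.
- move=> x; have := semi_null_r (dform_sesqui rho) (dform_ge0 rho_pos) x nul.
  rewrite /dform /E starB starZ star1 sB Lc mulrBl vn_scaleMl mul1r dualB dualZ.
  by move=> /eqP; rewrite subr_eq0 => /eqP.
- by rewrite -[B]expr1 mE lecR; have := rL 0%N; rewrite /r m0 divr1.
move=> c k cc ck x; rewrite !rhoE -ulimZ//; congr ulim; apply/funext => j.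
by rewrite !fE mulrA -cc -mulrA ck mulrCA.
Qed.

Definition definite rho c : Prop :=
  exists k : R[i], forall x, rho (c * x) = k * rho x.

(** One power iteration per element; the last clause of [power_iteration] preserves the values that
    are already definite. *)
Lemma definite_states phi (cs : seq (vn M)) : dpos phi -> phi 1 = 1 ->
  (forall c, List.In c cs -> central c) ->
  exists rho, [/\ dpos rho, rho 1 = 1,
    forall c, List.In c cs -> definite rho (star c * c) &
    forall c k, central c -> (forall x, phi (c * x) = k * phi x) ->
      forall x, rho (c * x) = k * rho x].
Proof.
elim: cs phi => [|c cs IH] phi pp p1 cc; first by exists phi; split.
have [rho [L [rp r1 rL _ rc]]] := power_iteration pp p1 (cc _ (or_introl erefl)).
have [|rho' [rp' r1' rd' rc']] := IH rho rp r1.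
  by move=> d dcs; apply: cc; right.
exists rho'; split => //.
  move=> d [<-|/rd'//]; exists L; apply: rc' => //.
  by apply: centralM; [apply: central_star|]; apply: cc; left.
by move=> d k cd dk; apply: rc' => //; exact: rc.
Qed.

(* b and b^* are combinations of the |1 + w b^*|^2 for w in {1, i, -1, -i}. *)
Definition quartet b := [:: 1 + star b; 1 + (-1) *: star b; 1 + 'i *: star b;
  1 + (- 'i) *: star b].

Lemma quartet_definite rho b :
  (forall c, List.In c (quartet b) -> definite rho (star c * c)) ->
  definite rho b /\ definite rho (star b).
Proof.
have E w x : rho (star (1 + w *: star b) * (1 + w *: star b) * x) =
    rho x + w * rho (star b * x) + w^* * rho (b * x) +
    (w^* * w) * rho (b * star b * x).
  rewrite starD star1 starZ starK mulrDl mul1r mulrDr mulr1.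
  rewrite !vn_scaleMl vn_scaleMr !mulrDl mul1r !vn_scaleMl scalerA.
  by rewrite !dualD !dualZ !addrA.
move=> h.
have [L1 e1] := h _ (or_introl erefl).
have [L2 e2] := h _ (or_intror (or_introl erefl)).
have [L3 e3] := h _ (or_intror (or_intror (or_introl erefl))).
have [L4 e4] := h _ (or_intror (or_intror (or_intror (or_introl erefl)))).
have i2 : 'i * 'i = -1 :> R[i] by rewrite -expr2 sqrCi.
rewrite -[star b]scale1r in e1.
split; [exists (4^-1 * (L1 - L2 + 'i * (L3 - L4))) | exists (4^-1 * (L1 - L2 - 'i * (L3 - L4)))];
  move=> x; move: (e1 x) (e2 x) (e3 x) (e4 x);
  rewrite !E !rmorphN/= !conjCi conjC1 opprK;
  move: (rho x) (rho (b * x)) (rho (star b * x)) (rho (b * star b * x)) => p v u w h1 h2 h3 h4.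
- have -> : 4^-1 * (L1 - L2 + 'i * (L3 - L4)) * p =
      4^-1 * (L1 * p - L2 * p + 'i * (L3 * p - L4 * p)) by ring.
  rewrite -h1 -h2 -h3 -h4.
  transitivity (4^-1 * (2 * u + 2 * v + 2 * ('i * 'i) * u - 2 * ('i * 'i) * v)).
    by rewrite i2; field.
  by congr (_ * _); ring.
- have -> : 4^-1 * (L1 - L2 - 'i * (L3 - L4)) * p =
      4^-1 * (L1 * p - L2 * p - 'i * (L3 * p - L4 * p)) by ring.
  rewrite -h1 -h2 -h3 -h4.
  transitivity (4^-1 * (2 * u + 2 * v - 2 * ('i * 'i) * u + 2 * ('i * 'i) * v)).
    by rewrite i2; field.
  by congr (_ * _); ring.
Qed.

Lemma definite_states_all phi m (b : 'I_m -> vn M) : dpos phi -> phi 1 = 1 ->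
  (forall i, central (b i)) ->
  exists rho, [/\ dpos rho, rho 1 = 1,
    forall i, definite rho (b i) /\ definite rho (star (b i)) &
    forall c k, central c -> (forall x, phi (c * x) = k * phi x) ->
      forall x, rho (c * x) = k * rho x].
Proof.
move=> pp p1 cb.
pose cs := flatten [seq quartet (b i) | i <- enum 'I_m].
have csE i c : List.In c (quartet (b i)) -> List.In c cs.
  have : i \in enum 'I_m by rewrite mem_enum.
  rewrite /cs; elim: (enum 'I_m) => // j s IH; rewrite inE => /predU1P[->|/IH {}IH] ci.
    by apply/In_cat; left.
  by apply/In_cat; right; exact: IH.
have ccs c : List.In c cs -> central c.
  rewrite /cs; elim: (enum 'I_m) => //= j s IH.
  have cj := central_star (cb j).
  have cq w : central (1 + w *: star (b j)).
    by apply: centralD; [exact: central1 | exact: centralZ].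
  move=> [<-|[<-|[<-|[<-|/IH//]]]] //.
  by rewrite -[star (b j)]scale1r.
have [rho [rp r1 rd rc]] := definite_states pp p1 ccs.
exists rho; split => // i; apply: quartet_definite => c ci.
by apply: rd; exact: csE ci.
Qed.

(** For functions b_i this is the pointwise estimate of sum |b_i|^2, obtained from the coefficients
    g_i = conj b_i. The point is replaced by a state under which all b_i and b_i^* are definite. It
    is reached from the vector state phi of [v], iterated first on A = sum b_i^* b_i so that the
    final value k of A satisfies phi (A)^2 <= phi (A^2) <= L = k^2. *)
Lemma sum_sqr_le m (b : 'I_m -> vn M) (e : R[i]) : 0 <= e ->
  (forall i, central (b i)) ->
  (forall g : 'I_m -> R[i], `|\sum_i g i *: b i| ^+ 2 <= e ^+ 2 * \sum_i `|g i| ^+ 2) ->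
  forall v : H, \sum_i `|b i v| ^+ 2 <= e ^+ 2 * `|v| ^+ 2.
Proof.
move=> e0 cb bg v; have [->|v0] := eqVneq v 0.
  by rewrite normr0 expr0n mulr0 big1// => i _; rewrite linear0 normr0 expr0n.
have v2 : 0 < `|v| ^+ 2 by rewrite exprn_gt0// normr_gt0.
pose A := \sum_i star (b i) * b i.
have cA : central A.
  by apply: central_sum => i; apply: centralM => //; exact: central_star.
have sA : star A = A.
  by rewrite /A star_sum; apply: eq_bigr => i _; rewrite starM starK.
pose phi := (`|v| ^+ 2)^-1 *: vf M v v.
have phiE a : phi a = (`|v| ^+ 2)^-1 * inner (a v) v by [].
have pp : dpos phi.
  by move=> a a0; rewrite phiE mulr_ge0 ?invr_ge0 ?(ltW v2)//; exact: a0.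
have p1 : phi 1 = 1 by rewrite phiE vn1E inner_norm mulVf ?gt_eqF.
have [rho1 [L [rp1 r11 rL AL _]]] := power_iteration pp p1 cA.
have [rho [rp r1 rd rc]] := definite_states_all rp1 r11 cb.
have {rc rL} rL x : rho (A * A * x) = L * rho x.
  by apply: rc; [exact: centralM | move=> y; rewrite -{1}sA rL].
pose k := \sum_i `|rho (b i) : R[i]| ^+ 2.
have def a : definite rho a -> forall x, rho (a * x) = rho a * rho x.
  by move=> [l hl] x; rewrite -[a in RHS]mulr1 !hl r1 mulr1.
have rA x : rho (A * x) = k * rho x.
  rewrite /A /k !mulr_suml dual_sum; apply: eq_bigr => i _.
  have [d1 d2] := rd i.
  by rewrite -mulrA def// def// dpos_conj// mulrA normCKC.
have k0 : 0 <= k by apply: sumr_ge0 => i _; exact: exprn_ge0.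
have Lk : L = k ^+ 2.
  have rA1 : rho A = k by rewrite -[A]mulr1 rA r1 mulr1.
  by have := rL 1; rewrite r1 !mulr1 => <-; rewrite rA rA1.
have ke : k <= e ^+ 2.
  have [->|kn0] := eqVneq k 0; first exact: exprn_ge0.
  have kp : 0 < k by rewrite lt_def kn0.
  rewrite -(@ler_pM2l _ k)// [leRHS]mulrC.
  (* With these coefficients the combination has rho-value k, and the hypothesis becomes k^2 <= e^2
     k. *)
  have := bg (fun i => (rho (b i))^*).
  have -> : \sum_i `|(rho (b i) : R[i])^*| ^+ 2 = k.
    by apply: eq_bigr => i _; rewrite norm_conjC.
  apply: le_trans.
  have -> : k = rho (\sum_i (rho (b i))^* *: b i).
    by rewrite dual_sum; apply: eq_bigr => i _; rewrite dualZ normCKC.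
  rewrite -expr2 -{1}(ger0_norm (_ : 0 <= rho (\sum_i (rho (b i))^* *: b i))).
    rewrite ler_pXn2r// ?nnegrE//.
    by have := dpos_le rp (\sum_i (rho (b i))^* *: b i); rewrite r1 mulr1.
  by rewrite dual_sum; apply: sumr_ge0 => i _; rewrite dualZ -normCKC exprn_ge0.
have phiA : phi A = (`|v| ^+ 2)^-1 * \sum_i `|b i v| ^+ 2.
  rewrite phiE /A vn_sumE (sesqui_suml (inner_sesqui _)); congr (_ * _).
  by apply: eq_bigr => i _; rewrite vnME starE inner_norm.
have phiA0 : 0 <= (phi A : R[i]).
  by rewrite phiA mulr_ge0 ?invr_ge0 ?(ltW v2)// sumr_ge0// => i _; exact: exprn_ge0.
suff : phi A <= e ^+ 2 :> R[i].
  by rewrite phiA mulrC ler_pdivrMr.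
rewrite -(@ler_pXn2r _ 2)// ?nnegrE ?exprn_ge0//.
apply: (@le_trans _ _ L); last by rewrite Lk ler_pXn2r// ?nnegrE ?exprn_ge0.
apply: le_trans AL; have := semi_cs (dform_sesqui phi) (dform_ge0 pp) A 1.
by rewrite /dform star1 !mul1r p1 mulr1 ger0_norm.
Qed.

End Central.

(** * Goldstine's theorem and decomposition into positive functionals *)

Lemma ulim_sum (R : realType) (T I : Type) (F : set_system T) (r : seq I)
  (u : I -> T -> R[i]) : UltraFilter F -> (forall j, ubounded F (u j)) ->
  ulim F (fun i => \sum_(j <- r) u j i) = \sum_(j <- r) ulim F (u j).
Proof.
move=> FF ub; have pF : ProperFilter F := ultra_proper.
suff [-> //] : ulim F (fun i => \sum_(j <- r) u j i) = \sum_(j <- r) ulim F (u j) /\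
    ubounded F (fun i => \sum_(j <- r) u j i).
elim: r => [|j r [IH br]].
  have -> : (fun i => \sum_(j <- [::]) u j i) = fun=> 0.
    by apply/funext => i; rewrite big_nil.
  by rewrite big_nil ulim_cst//; split => //; exact: ubounded_cst.
have -> : (fun i => \sum_(k <- j :: r) u k i) = fun i => u j i + \sum_(k <- r) u k i.
  by apply/funext => i; rewrite big_cons.
by rewrite big_cons ulimD// IH; split => //; exact: uboundedD.
Qed.

Lemma conj_pair (R : realType) (x y : R) : ((x +i* y)%C)^* = (x -i* y)%C :> R[i].
Proof. by []. Qed.

Lemma re_sqr_sub (R : realType) (p u : R[i]) (t : R) :
  complex.Re (`|p - t%:C%C * u| ^+ 2) = complex.Re (`|p| ^+ 2)
    - 2 * t * complex.Re (p^* * u) + t ^+ 2 * complex.Re (`|u| ^+ 2).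
Proof.
by case: p u => [p1 p2] [u1 u2]; rewrite conj_pair -!add_Re2_Im2 /=; ring.
Qed.

(** The step length in [helly]: the second-order term t^2 W is then at most t i / 2, and minimality
    up to t i / 2 bounds the first-order gain X by i / 2 ([step_bound]). *)
Lemma small_step (R : realType) (i B : R) : 0 < i -> 0 <= B ->
  exists t, [/\ 0 < t, t <= 1 & t * B <= i / 2].
Proof.
move=> i0 B0; have Bi : 0 < 2 * (B + i) by nra.
exists (i / (2 * (B + i))); split.
- by rewrite divr_gt0.
- by rewrite ler_pdivrMr//; nra.
- by rewrite mulrAC ler_pdivrMr//; nra.
Qed.

Lemma step_bound (R : realType) (i B W X t d : R) : 0 < t -> W <= B ->
  t * B <= i / 2 -> d < i + t * i / 2 -> i <= d - 2 * t * X + t ^+ 2 * W ->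
  X <= i / 2.
Proof.
move=> t0 WB tB di h; rewrite -(@ler_pM2l _ (2 * t)) ?mulr_gt0//.
have : t ^+ 2 * W <= t * (i / 2).
  rewrite expr2 -mulrA ler_pM2l// (le_trans _ tB)// ler_pM2l//.
lra.
Qed.

Lemma half_absurd (R : realType) (i x z : R) :
  0 < i -> i <= z -> z + x <= x + i / 2 -> False.
Proof. lra. Qed.

Section Goldstine.
Variables (R : realType) (H : hilbertType R) (M : vnalg H).
Implicit Types (a b c : vn M) (phi psi rho : dual (vn M)) (s : seq (H * H)).

Definition vfsum s : dual (vn M) := \sum_(p <- s) vf M p.1 p.2.

(** Bounding both square sums makes the norm of [vfsum] at most r. It also allows convex
    combinations: [smix] concatenates two lists after scaling their vectors by the square roots of
    the weights, as the functional is quadratic in the vectors. *)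
Definition sball (r : R[i]) s : Prop :=
  \sum_(p <- s) `|p.1| ^+ 2 <= r /\ \sum_(p <- s) `|p.2| ^+ 2 <= r.

Lemma vfsumE s a : vfsum s a = \sum_(p <- s) inner (a p.1) p.2.
Proof. exact: dual_sumE. Qed.

Lemma norm_vfsum r s : 0 <= r -> sball r s -> `|vfsum s| <= r.
Proof.
move=> r0 [s1 s2]; apply: opnorm_le => // a; rewrite vfsumE.
rewrite (le_trans (ler_norm_sum _ _ _))//.
apply: (@le_trans _ _ (\sum_(p <- s) `|a| * (2^-1 * `|p.1| ^+ 2 + 2^-1 * `|p.2| ^+ 2))).
  apply: ler_sum => p _; rewrite (le_trans (inner_bop_le _ _ _))// -mulrA.
  rewrite ler_wpM2l// -subr_ge0.
  have -> : 2^-1 * `|p.1| ^+ 2 + 2^-1 * `|p.2| ^+ 2 - `|p.1| * `|p.2| =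
      2^-1 * (`|p.1| - `|p.2|) ^+ 2 by field.
  have re : `|p.1| - `|p.2| \is Num.real by rewrite rpredB// normr_real.
  by rewrite mulr_ge0 ?invr_ge0// real_exprn_even_ge0.
rewrite -mulr_sumr mulrC ler_wpM2r// big_split/= -!mulr_sumr.
have -> : r = 2^-1 * r + 2^-1 * r by field.
by rewrite lerD// ler_wpM2l// invr_ge0.
Qed.

Definition sscale (r : R[i]) s := [seq (r *: p.1, r *: p.2) | p <- s].

Lemma vfsum_scale r s a : 0 <= r -> vfsum (sscale r s) a = r ^+ 2 * vfsum s a.
Proof.
move=> r0; rewrite !vfsumE big_map mulr_sumr; apply: eq_bigr => p _ /=.
by rewrite linearZ innerZl innerZr geC0_conj// mulrA.
Qed.

Lemma vfsum_cat s s' a : vfsum (s ++ s') a = vfsum s a + vfsum s' a.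
Proof. by rewrite !vfsumE big_cat. Qed.

Definition smix (t : R[i]) s s' := sscale (sqrtC (1 - t)) s ++ sscale (sqrtC t) s'.

Lemma sball_mix r t s s' : 0 <= t -> t <= 1 -> sball r s -> sball r s' ->
  sball r (smix t s s').
Proof.
move=> t0 t1 [s1 s2] [s1' s2']; have t1' : 0 <= 1 - t by rewrite subr_ge0.
by split; rewrite big_cat !big_map/=;
  under eq_bigr => p _ do rewrite normrZ exprMn ger0_norm ?sqrtC_ge0// sqrtCK;
  under [X in _ + X]eq_bigr => p _ do rewrite normrZ exprMn ger0_norm ?sqrtC_ge0// sqrtCK;
  rewrite -!mulr_sumr (_ : r = (1 - t) * r + t * r) ?lerD ?ler_wpM2l//; ring.
Qed.

Lemma vfsum_mix t s s' a : 0 <= t -> t <= 1 ->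
  vfsum (smix t s s') a = (1 - t) * vfsum s a + t * vfsum s' a.
Proof.
move=> t0 t1; have t1' : 0 <= 1 - t by rewrite subr_ge0.
by rewrite vfsum_cat !vfsum_scale ?sqrtC_ge0// !sqrtCK.
Qed.

Let re : R[i] -> R := @complex.Re R.

(** One-term lists suffice: [x] and [y] are scaled to length sqrt r, and [y] is turned by the phase
    of <b x, y>, which makes the value real. *)
Lemma vn_norm_ball (r T : R) b : 0 < r ->
  (forall s, sball r%:C%C s -> re (vfsum s b) <= T) ->
  `|b| <= (T / r)%:C%C.
Proof.
move=> r0 h; have rC : 0 < r%:C%C :> R[i] by rewrite ltcR.
have T0 : 0 <= T.
  have := h [::]; rewrite vfsumE big_nil; apply.
  by split; rewrite big_nil ltW.
apply: vn_norm_le => [|x y]; first by rewrite ler0c divr_ge0// ltW.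
have [->|x0] := eqVneq x 0; first by rewrite linear0 inner0l normr0 normr0 mulr0 mul0r.
have [->|y0] := eqVneq y 0; first by rewrite inner0r !normr0 !mulr0.
set z := inner (b x) y; have [z0|z0] := eqVneq z 0.
  by rewrite z0 normr0 !mulr_ge0// ler0c divr_ge0// ltW.
have nx : `|x| != 0 by rewrite normr_eq0.
have ny : `|y| != 0 by rewrite normr_eq0.
have nz : `|z| != 0 by rewrite normr_eq0.
pose k : R[i] := sqrtC r%:C%C.
have k0 : 0 <= k by rewrite sqrtC_ge0 ltW.
have := h [:: ((k / `|x|) *: x, (k / `|y| * (z / `|z|)) *: y)].
rewrite vfsumE big_cons big_nil addr0/= linearZ innerZl innerZr -/z.
have -> : k / `|x| * ((k / `|y| * (z / `|z|))^* * z) = r%:C%C * `|z| / (`|x| * `|y|).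
  rewrite !rmorphM/= !fmorphV/= !conj_normC (geC0_conj k0) (@geC0_conj _ `|y|)//.
  transitivity (k ^+ 2 * (z^* * z) / (`|x| * `|y| * `|z|)).
    by field; rewrite nx ny nz.
  by rewrite sqrtCK -normCKC; field; rewrite nx ny nz.
have v0 : 0 <= r%:C%C * `|z| / (`|x| * `|y|).
  by rewrite !mulr_ge0 ?invr_ge0 ?mulr_ge0// ltW.
move=> hT.
have : r%:C%C * `|z| / (`|x| * `|y|) <= T%:C%C.
  rewrite -[leLHS]RRe_real ?ger0_real// lecR; apply: hT.
  split; rewrite big_cons big_nil addr0/= normrZ exprMn.
    rewrite normrM normfV normr_id mulrC -exprMn mulrCA mulfV// mulr1 ger0_norm//.
    by rewrite sqrtCK.
  rewrite !normrM !normfV !normr_id mulfV// mulr1 -exprMn -mulrA mulVf// mulr1.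
  by rewrite ger0_norm// sqrtCK.
have xy0 : 0 < `|x| * `|y| by rewrite mulr_gt0 ?normr_gt0.
rewrite ler_pdivrMr// => h2.
have -> : (T / r)%:C%C = T%:C%C / r%:C%C :> R[i] by rewrite rmorphM/= fmorphV.
by rewrite -mulrA mulrAC ler_pdivlMr// mulrC.
Qed.

(* Separation in C^n, carried out with a near-minimizer of the distance. *)
Lemma helly phi (r : R) (l : seq (vn M)) : 0 < r -> `|phi| <= r%:C%C ->
  forall e : R[i], 0 < e -> exists2 s, sball r%:C%C s &
    \sum_(a <- l) `|vfsum s a - phi a| ^+ 2 < e.
Proof.
move=> r0 phir _ /gt0_complexP[e e0 ->].
have rC : 0 < r%:C%C :> R[i] by rewrite ltcR.
pose D s : R[i] := \sum_(a <- l) `|phi a - vfsum s a| ^+ 2.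
have D0 s : 0 <= D s by apply: sumr_ge0 => a _; exact: exprn_ge0.
pose d s : R := re (D s).
have dE s : D s = (d s)%:C%C by rewrite RRe_real// ger0_real.
have d0 s : 0 <= d s by rewrite -ler0c -dE.
suff [s sb ds] : exists2 s, sball r%:C%C s & d s < e.
  exists s => //; have -> : \sum_(a <- l) `|vfsum s a - phi a| ^+ 2 = D s.
    by apply: eq_bigr => a _; rewrite distrC.
  by rewrite dE ltcR.
pose A := [set d s | s in sball r%:C%C].
have Ainf : has_inf A.
  split; last by exists 0 => _ [s _ <-].
  by exists (d [::]), [::] => //; split; rewrite big_nil ltW.
pose i := inf A.
have ile s : sball r%:C%C s -> i <= d s.
  by move=> sb; apply: ge_inf; [exact: Ainf.2|exists s].
have [ilt|ige] := ltP i e.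
  have ei : 0 < e - i by rewrite subr_gt0.
  have [_ [s sb <-] ds] := inf_adherent ei Ainf.
  by exists s => //; move: ds; rewrite addrC subrK.
exfalso; have i0 : 0 < i by exact: lt_le_trans ige.
pose B : R := re (\sum_(a <- l) (2 * r%:C%C * `|a|) ^+ 2).
have BE : \sum_(a <- l) (2 * r%:C%C * `|a|) ^+ 2 = B%:C%C :> R[i].
  rewrite RRe_real// ger0_real// sumr_ge0// => a _.
  by rewrite exprn_ge0// !mulr_ge0// ltW.
have B0 : 0 <= B.
  by rewrite -ler0c -BE sumr_ge0// => a _; rewrite exprn_ge0// !mulr_ge0// ltW.
have [t [t0 t1 tB]] := small_step i0 B0.
have eta0 : 0 < t * i / 2 by rewrite divr_gt0// mulr_gt0.
have [_ [s sb <-] ds] := inf_adherent eta0 Ainf; rewrite -/i in ds.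
(* Pairing with [b] is the linear part of the squared distance at [s]; it separates phi from the
   ball. *)
pose b := \sum_(a <- l) (phi a - vfsum s a)^* *: a.
have phib : phi b = D s + vfsum s b.
  rewrite /b !dual_sum -big_split/=; apply: eq_bigr => a _.
  by rewrite !dualZ normCKC; ring.
have mixb s' : sball r%:C%C s' -> re (vfsum s' b) <= re (vfsum s b) + i / 2.
  move=> sb'.
  pose W : R := re (\sum_(a <- l) `|vfsum s' a - vfsum s a| ^+ 2).
  have WB : W <= B.
    rewrite -lecR -BE RRe_real; last first.
      by rewrite ger0_real// sumr_ge0// => a _; rewrite exprn_ge0.
    apply: ler_sum => a _; rewrite ler_pXn2r// ?nnegrE ?mulr_ge0 ?(ltW rC)//.
    rewrite (le_trans (ler_normB _ _))//.
    have -> : 2 * r%:C%C * `|a| = r%:C%C * `|a| + r%:C%C * `|a| by ring.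
    by rewrite lerD// (le_trans (dual_le _ _))// ler_wpM2r// norm_vfsum// ltW.
  pose X : R := re (vfsum s' b) - re (vfsum s b).
  have key : d (smix t%:C%C s s') = d s - 2 * t * X + t ^+ 2 * W.
    have XE : X = re (\sum_(a <- l) (phi a - vfsum s a)^* * (vfsum s' a - vfsum s a)).
      rewrite /X -raddfB/= /b !dual_sum -sumrB; congr (re _); apply: eq_bigr => a _.
      by rewrite !dualZ mulrBr.
    rewrite XE /d /D /W.
    have tC0 : 0 <= t%:C%C :> R[i] by rewrite ler0c ltW.
    have tC1 : t%:C%C <= 1 :> R[i] by rewrite -[1]/(1%:C%C) lecR.
    elim: (l) => [|a l' IH]; first by rewrite !big_nil /re/=; ring.
    have reD x y : re (x + y) = re x + re y by case: x y => [x1 x2] [y1 y2].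
    rewrite !big_cons !reD IH vfsum_mix//.
    move: (phi a) (vfsum s a) (vfsum s' a) => p v w.
    have -> : p - ((1 - t%:C%C) * v + t%:C%C * w) = (p - v) - t%:C%C * (w - v) by ring.
    rewrite /re re_sqr_sub.
    move: (complex.Re (`|p - v| ^+ 2)) (complex.Re (_^* * _)) (complex.Re (`|w - v| ^+ 2)).
    move: (complex.Re _) (complex.Re _) (complex.Re _) => *; ring.
  have := ile _ (sball_mix (ltW (_ : 0 < t%:C%C)) (_ : t%:C%C <= 1) sb sb').
  rewrite ltcR -[1 in X in X -> _]/(1%:C%C) lecR => /(_ t0 t1).
  rewrite key => h; rewrite -lerBlDl -/X.
  exact: step_bound t0 WB tB ds h.
have bT := vn_norm_ball r0 mixb.
have : re (phi b) <= re (vfsum s b) + i / 2.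
  have h : `|phi b : R[i]| <= (re (vfsum s b) + i / 2)%:C%C.
    rewrite (le_trans (dual_le _ _))//; apply: (@le_trans _ _ (r%:C%C * `|b|)).
      by rewrite ler_wpM2r.
    rewrite (le_trans (ler_wpM2l (ltW rC) bT))// -rmorphM lecR mulrC divfK//.
    by rewrite gt_eqF.
  rewrite -lecR (le_trans _ h)// (le_trans _ (normc_ge_Re _))// lecR.
  exact: ler_norm.
rewrite phib dE.
have -> : re ((d s)%:C%C + vfsum s b) = d s + re (vfsum s b) by case: (vfsum s b).
exact: half_absurd i0 (ile s sb).
Qed.

(** By [helly] the lists that approximate phi on finitely many elements up to a tolerance form a
    filter base; an ultrafilter above it replaces the approximating net. *)
Lemma goldstine phi (r : R) : 0 < r -> `|phi| <= r%:C%C ->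
  exists F : set_system (seq (H * H)), [/\ UltraFilter F, F (sball r%:C%C) &
    forall a, phi a = ulim F (fun s => vfsum s a)].
Proof.
move=> r0 phir; have rC : 0 < r%:C%C :> R[i] by rewrite ltcR.
pose D := [set p : seq (vn M) * R[i] | 0 < p.2].
pose B (p : seq (vn M) * R[i]) := [set s | sball r%:C%C s /\
  forall a, List.In a p.1 -> `|vfsum s a - phi a| < p.2].
have Binter : forall i j, D i -> D j -> exists2 k, D k & B k `<=` B i `&` B j.
  move=> [l e] [l' e']; rewrite /D /mkset => e0 e0'; simpl in e0, e0'.
  have [n n0 [ne ne']] : exists2 n : R[i], 0 < n & n <= e /\ n <= e'.
    have [u u0 ->] := gt0_complexP e0; have [v v0 ->] := gt0_complexP e0'.
    exists (Num.min u v)%:C%C; first by rewrite ltcR lt_min u0.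
    by rewrite !lecR !ge_min !lexx orbT.
  exists (l ++ l', n) => // s [sb sl]; split; split => //= a al.
    have h : List.In a (l ++ l') by apply/In_cat; left.
    exact: lt_le_trans (sl a h) ne.
  have h : List.In a (l ++ l') by apply/In_cat; right.
  exact: lt_le_trans (sl a h) ne'.
have B0 : forall i, D i -> B i !=set0.
  move=> [l e]; rewrite /D /mkset => e0; simpl in e0.
  have [s sb sl] := helly l r0 phir (exprn_gt0 2 e0).
  exists s; split => // a /= al.
  rewrite -(@ltr_pXn2r _ 2)// ?nnegrE ?(ltW e0)// (le_lt_trans _ sl)//.
  elim: l al {sl} => // b l IH /= [<-|/IH h]; rewrite big_cons.
    by rewrite lerDl sumr_ge0// => c _; exact: exprn_ge0.
  by rewrite (le_trans h)// lerDr exprn_ge0.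
have PF : ProperFilter (filter_from D B).
  apply: filter_from_proper => //; apply: filter_from_filter => //.
  by exists ([::], 1) => /=; exact: ltr01.
have [F [FF BF]] := ultraFilterLemma PF.
have pF : ProperFilter F := ultra_proper.
have Fb p : D p -> F (B p) by move=> Dp; apply: BF; exists p.
exists F; split => //.
  apply: (@filterS _ F _ _ _ _ (Fb ([::], 1) _)); last exact: ltr01.
  by move=> s [].
move=> a; apply/esym/ulim_uniq => e e0.
apply: (@filterS _ F _ _ _ _ (Fb ([:: a], e) e0)) => s [_] /(_ a); apply.
by left.
Qed.

Definition spol (w : R[i]) s := [seq (p.1 + w *: p.2, p.1 + w *: p.2) | p <- s].

Lemma sball_spol w r s : `|w| = 1 -> 0 <= r -> sball r s -> sball (4 * r) (spol w s).
Proof.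
move=> w1 r0 [s1 s2].
suff h : \sum_(p <- s) `|p.1 + w *: p.2| ^+ 2 <= 4 * r.
  by split; rewrite big_map.
apply: (@le_trans _ _ (\sum_(p <- s) (2 * `|p.1| ^+ 2 + 2 * `|p.2| ^+ 2))).
  apply: ler_sum => p _; have -> : `|p.2| = `|w *: p.2| by rewrite normrZ w1 mul1r.
  by rewrite -parallelogram lerDl exprn_ge0.
rewrite big_split/= -!mulr_sumr.
have -> : 4 * r = 2 * r + 2 * r by ring.
by rewrite lerD// ler_wpM2l.
Qed.

(** Polarizing <a x, y> writes each approximant from [goldstine] as a combination of four positive
    functionals whose norms stay bounded, and positivity survives the limit. *)
Lemma dpos_decomposition phi : exists psi : 'I_4 -> dual (vn M),
  (forall k, dpos (psi k)) /\ phi = \sum_(k < 4) (4^-1 * 'i ^+ k) *: psi k.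
Proof.
pose r : R := re `|phi| + 1.
have r0 : 0 < r.
  by rewrite ltr_wpDl// -ler0c -normRe.
have phir : `|phi| <= r%:C%C by rewrite normRe lecR lerDl.
have [F [FF Fr Fphi]] := goldstine r0 phir.
have pF : ProperFilter F := ultra_proper.
have rC : 0 <= r%:C%C :> R[i] by rewrite ler0c ltW.
have rC4 : 0 <= 4 * r%:C%C :> R[i] by rewrite mulr_ge0.
have i1 k : `|'i ^+ k : R[i]| = 1 by rewrite normrX normCi expr1n.
have Fk k : F [set s | `|vfsum (spol ('i ^+ k) s)| <= 4 * r%:C%C].
  apply: (@filterS _ F _ _ _ _ Fr) => s sr /=.
  by apply: norm_vfsum => //; exact: sball_spol.
have ex (k : 'I_4) := @ulim_dual _ _ _ F (fun s => vfsum (spol ('i ^+ k) s)) _ FF rC4 (Fk k).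
have [psi psiP] := choice ex.
exists psi; split.
  move=> k a a0; rewrite (psiP k).1; apply: ulim_ge0.
    exists (4 * r%:C%C * `|a|); apply: (@filterS _ F _ _ _ _ (Fk k)) => s /= h.
    by rewrite (le_trans (dual_le _ _))// ler_wpM2r.
  by apply: filterE => s /=; rewrite vfsumE big_map sumr_ge0.
apply: bop_eqP => a; rewrite dual_sumE Fphi.
have ub (k : nat) : ubounded F (fun s => vfsum (spol ('i ^+ k) s) a).
  exists (4 * r%:C%C * `|a|); apply: (@filterS _ F _ _ _ _ (Fk k)) => s /= h.
  by rewrite (le_trans (dual_le _ _))// ler_wpM2r.
have -> : \sum_(k < 4) ((4^-1 * 'i ^+ k) *: psi k) a =
    ulim F (fun s => \sum_(k < 4) (4^-1 * 'i ^+ k) * vfsum (spol ('i ^+ k) s) a).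
  rewrite ulim_sum//; last by move=> k; exact: uboundedZ.
  by apply: eq_bigr => k _; rewrite dual_scaleE (psiP k).1 ulimZ.
congr ulim; apply/funext => s; rewrite vfsumE.
have -> : \sum_(k < 4) (4^-1 * 'i ^+ k) * vfsum (spol ('i ^+ k) s) a =
   \sum_(k < 4) \sum_(p <- s) (4^-1 * 'i ^+ k) *
     inner (a (p.1 + 'i ^+ k *: p.2)) (p.1 + 'i ^+ k *: p.2).
  by apply: eq_bigr => k _; rewrite vfsumE big_map mulr_sumr.
rewrite exchange_big/=; apply: eq_bigr => p _.
rewrite !big_ord_recl big_ord0 addr0 /bump/=.
rewrite !linearD !linearZ/= !(innerDl, innerDr, innerZl, innerZr).
rewrite !exprS !expr0 !rmorphM/= !conjCi conjC1.
have i2 : 'i * 'i = -1 :> R[i] by rewrite -expr2 sqrCi.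
move: (inner (a p.1) p.1) (inner (a p.1) p.2) (inner (a p.2) p.1) (inner (a p.2) p.2).
move: 'i i2 => j i2 A B C D; apply/esym/eqP; rewrite -subr_eq0.
(* With i replaced by a variable j, the two sides differ by a multiple of j^2 + 1; the other factor
   is the quotient. *)
apply/eqP; transitivity (4^-1 * (j * j + 1) * ((1 + j) * A + (1 + j ^+ 4) * C
  - (j ^+ 4 - 2 * j ^+ 2 + 3) * B + (1 - j ^+ 3) * (1 - j ^+ 2 + j ^+ 4) * D)).
  by field.
by rewrite i2 addNr mulr0 mul0r.
Qed.

End Goldstine.

(** * Tensor products and slices *)

Lemma pow2_bounded (R : realType) (r D : R) : 0 <= r ->
  (forall k, r ^+ (2 ^ k) <= D) -> r <= 1.
Proof.
move=> r0 h; rewrite leNgt; apply/negP => r1.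
have bern n : 1 + n%:R * (r - 1) <= r ^+ n.
  elim: n => [|n IH]; first by rewrite mul0r addr0 expr0.
  rewrite exprS -natr1 mulrDl mul1r addrA.
  have h1 : 0 <= n%:R * (r - 1) ^+ 2 by rewrite mulr_ge0// sqr_ge0.
  apply: (@le_trans _ _ (r * (1 + n%:R * (r - 1)))); last by rewrite ler_wpM2l.
  by rewrite -subr_ge0 (_ : _ - _ = n%:R * (r - 1) ^+ 2)//; ring.
have D0 : 0 <= D by apply: le_trans (h 0%N); rewrite exprn_ge0.
have r10 : 0 < r - 1 by rewrite subr_gt0.
pose n := Num.truncn (D / (r - 1)).
have := h n.+1; rewrite leNgt => /negP; apply.
apply: lt_le_trans (bern (2 ^ n.+1)%N).
have h1 : D < n.+1%:R * (r - 1) by rewrite -ltr_pdivrMr// truncnS_gt.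
apply: (lt_trans h1); rewrite ltr_pwDl// ler_wpM2r ?(ltW r10)// ler_nat.
exact/ltnW/ltn_expl.
Qed.

(* Iterating [nq] gives n(a)^(2^k) <= T^(2^k - 1) C w(a)^(2^k); the 2^k-th root removes C. *)
Lemma cstar_power (R : realType) (V : Type) (q : V -> V) (n w : V -> R[i]) (T C : R[i]) :
  0 <= T -> 0 <= C -> (forall b, 0 <= n b) -> (forall b, 0 <= w b) ->
  (forall b, n b ^+ 2 <= n (q b) * T) -> (forall b, w (q b) <= w b ^+ 2) ->
  (forall b, n b <= C * w b) -> forall a, n a <= w a * T.
Proof.
move=> T0 C0 n0 w0 nq wq nw a.
have pow k b : n b ^+ (2 ^ k) <= T ^+ (2 ^ k).-1 * C * w b ^+ (2 ^ k).
  elim: k b => [|k IH] b; first by rewrite expn0 expr1 expr0 mul1r expr1.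
  have k0 : (0 < 2 ^ k)%N by rewrite expn_gt0.
  rewrite expnS exprM.
  have h1 : (n b ^+ 2) ^+ (2 ^ k) <= (n (q b) * T) ^+ (2 ^ k).
    by rewrite ler_pXn2r ?nnegrE ?exprn_ge0 ?mulr_ge0.
  apply: (le_trans h1); rewrite exprMn.
  apply: (le_trans (ler_wpM2r _ (IH _))); first by rewrite exprn_ge0.
  have -> : ((2 * 2 ^ k).-1 = (2 ^ k).-1 + 2 ^ k)%N.
    by rewrite mul2n -addnn -{1}(prednK k0) addSn.
  have hb : w (q b) ^+ (2 ^ k) <= (w b ^+ 2) ^+ (2 ^ k).
    by rewrite ler_pXn2r ?nnegrE ?exprn_ge0.
  have h2 : 0 <= T ^+ (2 ^ k).-1 * C by rewrite mulr_ge0// exprn_ge0.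
  apply: (le_trans (ler_wpM2r _ (ler_wpM2l h2 hb))); first by rewrite exprn_ge0.
  rewrite exprD exprM; move: (T ^+ _) (T ^+ _) (_ ^+ (2 ^ k)%N) => u v x.
  by rewrite le_eqVlt; apply/orP; left; apply/eqP; ring.
have [z0|z0] := eqVneq T 0.
  rewrite z0 mulr0 -(@ler_pXn2r _ 2)// ?nnegrE// expr0n/=.
  by rewrite (le_trans (nq _))// z0 mulr0.
have [a0|a0] := eqVneq (w a) 0; first by have := nw a; rewrite a0 mulr0 mul0r.
have zp : 0 < T by rewrite lt_def z0.
have ap : 0 < w a by rewrite lt_def a0 w0.
rewrite -[leRHS]mul1r -ler_pdivrMr ?mulr_gt0//.
have [r r0 rE] : exists2 r : R, 0 <= r & n a / (w a * T) = r%:C%C.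
  by apply: ge0_complexP; rewrite divr_ge0// mulr_ge0.
have [D D0 DE] : exists2 D : R, 0 <= D & C / T = D%:C%C.
  by apply: ge0_complexP; rewrite divr_ge0.
rewrite rE -[1]/(1%:C%C) lecR; apply: (@pow2_bounded _ _ D) => // k.
rewrite -lecR rmorphXn/= -rE -DE expr_div_n ler_pdivrMr ?exprn_gt0 ?mulr_gt0//.
rewrite (le_trans (pow k a))// exprMn.
have -> : T ^+ (2 ^ k) = T * T ^+ (2 ^ k).-1.
  by rewrite -exprS prednK// expn_gt0.
move: (_ ^+ (2 ^ k).-1) (_ ^+ (2 ^ k)) => u v.
by rewrite le_eqVlt; apply/orP; left; apply/eqP; field.
Qed.

Section Tensor.
Variables (R : realType) (H1 H2 K : hilbertType R) (t : hilbert_tensor H1 H2 K).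

Lemma tensDl x y z : t (x + y) z = t x z + t y z.
Proof. by rewrite -[x]scale1r tensPl !scale1r. Qed.

Lemma tens0l z : t 0 z = 0.
Proof. by apply: (@addrI _ (t 0 z)); rewrite -tensDl !addr0. Qed.

Lemma tensZl a x z : t (a *: x) z = a *: t x z.
Proof. by rewrite -[a *: x]addr0 tensPl tens0l addr0. Qed.

Lemma norm_tens x y : `|t x y| = `|x| * `|y|.
Proof.
apply/eqP; rewrite -(@eqrXn2 _ 2)// ?mulr_ge0//.
by rewrite exprMn -!inner_norm inner_tens.
Qed.

Lemma bop_tens_eq (A B : bop K K) : (forall x y, A (t x y) = B (t x y)) -> A = B.
Proof.
move=> AB; apply: bop_inner_eq => w u.
suff E : adj A u = adj B u by rewrite adjE E -adjE.
apply/eqP; rewrite -subr_eq0; apply/eqP/(@tens_total _ _ _ _ t) => x y.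
by rewrite innerBr -!adjE AB subrr.
Qed.

Implicit Types (s : seq (H1 * H2)) (a : bop H1 H1).

Let tv s : K := \sum_(p <- s) t p.1 p.2.
Let ta a s : K := \sum_(p <- s) t (a p.1) p.2.

Lemma tens_approx w (e : R[i]) : 0 < e -> exists s, `|w - tv s| < e.
Proof.
move=> e0; have : closure [set z | exists n (x : 'I_n -> H1) (y : 'I_n -> H2),
  z = \sum_(i < n) t (x i) (y i)] w by rewrite tens_dense.
have bw : nbhs w (ball w e) by exact: nbhsx_ballx.
move=> /(_ _ bw)[z [[n [x [y ->]]]]]; rewrite -ball_normE/= => h.
exists [seq (x i, y i) | i <- enum 'I_n].
by rewrite /tv big_map big_enum/=.
Qed.

Let tsc (k : R[i]) s := [seq (k *: p.1, p.2) | p <- s].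

Lemma tv_cat s s' : tv (s ++ s') = tv s + tv s'.
Proof. by rewrite /tv big_cat. Qed.

Lemma ta_cat a s s' : ta a (s ++ s') = ta a s + ta a s'.
Proof. by rewrite /ta big_cat. Qed.

Lemma tv_sc k s : tv (tsc k s) = k *: tv s.
Proof.
by rewrite /tv big_map scaler_sumr; apply: eq_bigr => p _; rewrite tensZl.
Qed.

Lemma ta_sc a k s : ta a (tsc k s) = k *: ta a s.
Proof.
rewrite /ta big_map scaler_sumr; apply: eq_bigr => p _.
by rewrite linearZ tensZl.
Qed.

Lemma ta_sqr a s : `|ta a s| ^+ 2 <= `|ta (adj a * a) s| * `|tv s|.
Proof.
have -> : `|ta a s| ^+ 2 = `|inner (ta (adj a * a) s) (tv s)|.
  rewrite -[LHS]ger0_norm ?exprn_ge0// -inner_norm; congr `|_|.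
  have E (f g : H1 -> H1) : inner (\sum_(p <- s) t (f p.1) p.2) (\sum_(p <- s) t (g p.1) p.2)
     = \sum_(p <- s) \sum_(q <- s) inner (f p.1) (g q.1) * inner p.2 q.2.
    rewrite (sesqui_suml (inner_sesqui _)); apply: eq_bigr => p _.
    rewrite (sesqui_sumr (inner_sesqui _)); apply: eq_bigr => q _.
    exact: inner_tens.
  rewrite /ta /tv E (E _ id); apply: eq_bigr => p _; apply: eq_bigr => q _.
  by rewrite bopME -adjEr.
exact: cauchy_schwarz.
Qed.

(** Boundedness of a (x) 1 on finite sums. [ta_sqr] is the C*-type inequality that [cstar_power]
    asks for; the triangle inequality provides the crude constant [C], which depends on [s] and
    drops out. *)
Lemma norm_ta a s : `|ta a s| <= `|a| * `|tv s|.
Proof.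
pose C := \sum_(p <- s) `|p.1| * `|p.2|.
have C0 : 0 <= C by apply: sumr_ge0 => p _; exact: mulr_ge0.
apply: (@cstar_power _ _ (fun b => adj b * b) (fun b => `|ta b s|) (fun b => `|b|) _ C) => //.
- by move=> b; exact: ta_sqr.
- by move=> b; rewrite (le_trans (norm_bopM _ _))// expr2 ler_wpM2r// norm_adj_le.
- move=> b; rewrite (le_trans (ler_norm_sum _ _ _))// mulr_suml ler_sum// => p _.
  by rewrite norm_tens mulrAC ler_wpM2r// mulrC bop_normP.
Qed.

(** Extension of a (x) 1 by continuity. Its form at w is an ultralimit along chosen approximants of
    w; by [bs] any other finite sum gives the same value up to its distance from w, whence linearity
    and the values on elementary tensors. *)
Lemma topl_ex a : exists c : bop K K, forall x y, c (t x y) = t (a x) y.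
Proof.
have ex w : exists f : nat -> seq (H1 * H2), forall n, `|w - tv (f n)| < n.+1%:R^-1.
  have ex2 (n : nat) : exists s, `|w - tv s| < n.+1%:R^-1.
    by apply: tens_approx; rewrite invr_gt0.
  by have [f fP] := choice ex2; exists f.
have {ex} [f fP] := choice ex.
have [U [UU Uoo]] := nat_ultra; have pU : ProperFilter U := ultra_proper.
have taB s s' : `|ta a s - ta a s'| <= `|a| * `|tv s - tv s'|.
  have := norm_ta a (s ++ tsc (-1) s').
  by rewrite ta_cat tv_cat ta_sc tv_sc !scaleN1r.
pose b w u := ulim U (fun n => inner (ta a (f w n)) u).
have near w s n : `|ta a (f w n) - ta a s| <= `|a| * (n.+1%:R^-1 + `|w - tv s|).
  rewrite (le_trans (taB _ _))// ler_wpM2l//.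
  rewrite -(subrKA w) (le_trans (ler_normD _ _))// lerD2r distrC.
  exact: ltW.
have n1 n : n.+1%:R^-1 <= 1 :> R[i] by rewrite invf_le1// ler1n.
have ub w u : ubounded U (fun n => inner (ta a (f w n)) u).
  exists (`|a| * (1 + `|w|) * `|u|); apply: filterE => n /=.
  rewrite (le_trans (cauchy_schwarz _ _))// ler_wpM2r//.
  have := near w [::] n; rewrite /ta /tv !big_nil !subr0 => /le_trans; apply.
  by rewrite ler_wpM2l// lerD2r.
have bs w s u : `|b w u - inner (ta a s) u| <= `|a| * `|w - tv s| * `|u|.
  apply: le_all_eps => [||e e0]; rewrite ?mulr_ge0//.
  rewrite -(ulim_cst UU (inner (ta a s) u)) -mulN1r -ulimZ; last exact: ubounded_cst.
  rewrite -(ulimD UU)//; last by apply: uboundedZ => //; exact: ubounded_cst.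
  apply: ulim_norm_le; first by rewrite addr_ge0 ?mulr_ge0// ltW.
  have c0 : 0 < `|a| * `|u| + 1 by rewrite ltr_wpDl// mulr_ge0.
  have [r r0 rE] := gt0_complexP (divr_gt0 e0 c0).
  apply: Uoo; exists (Num.truncn r^-1) => // n /= Nn.
  rewrite mulN1r -innerBl (le_trans (cauchy_schwarz _ _))//.
  apply: (le_trans (ler_wpM2r _ (near _ _ _))) => //.
  rewrite mulrDr mulrDl addrC lerD2l mulrAC.
  have nr : n.+1%:R^-1 <= e / (`|a| * `|u| + 1).
    rewrite rE (_ : n.+1%:R^-1 = (n.+1%:R^-1 : R)%:C%C); last first.
      by rewrite fmorphV/= rmorph_nat.
    rewrite lecR -[leRHS]invrK lef_pV2 ?posrE ?invr_gt0//.
    by rewrite (le_trans (ltW (truncnS_gt _)))// ler_nat ltnS.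
  rewrite (le_trans (ler_wpM2l _ nr)) ?mulr_ge0// mulrA ler_pdivrMr//.
  by rewrite mulrC ler_wpM2l ?lerDl// ltW.
have sb : sesqui b.
  split=> k x y z; last first.
    rewrite /b -ulimZ// -ulimD//; last exact: uboundedZ.
    by congr ulim; apply/funext => n; rewrite innerDr innerZr.
  apply: eq_all_eps => e e0.
  (* [C - 1] is the total of the error factors in [h1], [h2] and [h3] below. *)
  pose C := `|a| * `|z| * (2 * (`|k| + 1)) + 1.
  have C0 : 0 < C by rewrite ltr_wpDl// !mulr_ge0// addr_ge0.
  have d0 : 0 < e / C by rewrite divr_gt0.
  have [s hs] := tens_approx x d0; have [s' hs'] := tens_approx y d0.
  have E := bs (k *: x + y) (tsc k s ++ s') z.
  rewrite ta_cat tv_cat ta_sc tv_sc innerDl innerZl in E.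
  have -> : b (k *: x + y) z - (k * b x z + b y z) =
     (b (k *: x + y) z - (k * inner (ta a s) z + inner (ta a s') z))
     - k * (b x z - inner (ta a s) z) - (b y z - inner (ta a s') z) by ring.
  have Ez : `|k *: x + y - (k *: tv s + tv s')| <= `|k| * (e / C) + e / C.
    rewrite opprD addrACA -scalerBr (le_trans (ler_normD _ _))// normrZ.
    by rewrite lerD ?ler_wpM2l// ltW.
  have h1 : `|b (k *: x + y) z - (k * inner (ta a s) z + inner (ta a s') z)| <=
     `|a| * (`|k| * (e / C) + e / C) * `|z|.
    by rewrite (le_trans E)// ler_wpM2r// ler_wpM2l.
  have h2 : `|k * (b x z - inner (ta a s) z)| <= `|k| * (`|a| * (e / C) * `|z|).
    rewrite normrM ler_wpM2l// (le_trans (bs _ _ _))// ler_wpM2r// ler_wpM2l//.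
    exact: ltW.
  have h3 : `|b y z - inner (ta a s') z| <= `|a| * (e / C) * `|z|.
    by rewrite (le_trans (bs _ _ _))// ler_wpM2r// ler_wpM2l// ltW.
  rewrite (le_trans (ler_normB _ _))//.
  apply: (le_trans (lerD (le_trans (ler_normB _ _) (lerD h1 h2)) h3)).
  have -> : `|a| * (`|k| * (e / C) + e / C) * `|z| + `|k| * (`|a| * (e / C) * `|z|) +
     `|a| * (e / C) * `|z| = (C - 1) * (e / C) by rewrite /C; ring.
  by rewrite mulrA ler_pdivrMr// mulrC ler_wpM2l ?(ltW e0)// gerBl.
have bb w u : `|b w u| <= `|a| * `|w| * `|u|.
  by have := bs w [::] u; rewrite /ta /tv !big_nil inner0l !subr0.
have [c hc] := form_bop sb (normr_ge0 a) bb.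
exists c => x y; apply: inner_eq => u; rewrite innerC [RHS]innerC hc; congr (_ ^*).
apply/eqP; rewrite -subr_eq0 -normr_le0.
by have := bs (t x y) [:: (x, y)] u; rewrite /ta /tv !big_cons !big_nil !addr0 subrr normr0 mulr0 mul0r.
Qed.

End Tensor.

Section Swap.
Variables (R : realType) (H1 H2 K : hilbertType R) (t : hilbert_tensor H1 H2 K).

Lemma tswap_Pl a x y z : t z (a *: x + y) = a *: t z x + t z y.
Proof. exact: tensPr. Qed.

Lemma tswap_Pr a x y z : t (a *: y + z) x = a *: t y x + t z x.
Proof. exact: tensPl. Qed.

Lemma tswap_inner x1 x2 y1 y2 :
  inner (t y1 x1) (t y2 x2) = inner x1 x2 * inner y1 y2.
Proof. by rewrite inner_tens mulrC. Qed.

Lemma tswap_dense : closure [set z | exists n (x : 'I_n -> H2) (y : 'I_n -> H1),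
  z = \sum_(i < n) t (y i) (x i)] = setT.
Proof.
rewrite -(tens_dense t); congr closure; apply/seteqP.
by split=> z [n [x [y ->]]]; exists n, y, x.
Qed.

(** The space [K] is kept and only the legs are exchanged. Thus [vswap] does not change the
    operator, and every statement about one leg yields one about the other. *)
Definition tswap : hilbert_tensor H2 H1 K :=
  @HilbertTensor R H2 H1 K (fun x y => t y x) tswap_Pl tswap_Pr tswap_inner tswap_dense.

Lemma tswapE x y : tswap x y = t y x. Proof. by []. Qed.

Lemma topr_ex (b : bop H2 H2) : exists c : bop K K, forall x y, c (t x y) = t x (b y).
Proof. by have [c hc] := topl_ex tswap b; exists c => x y; exact: hc. Qed.

Variables (M1 : vnalg H1) (M2 : vnalg H2).

Lemma otimes_set_swap : otimes_set tswap M2 M1 = otimes_set t M1 M2.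
Proof.
by apply/seteqP; split=> c [a [b abc]]; exists b, a => x y; exact: abc.
Qed.

Lemma vn_set_swap : vn_set (vn_tensor tswap M2 M1) = vn_set (vn_tensor t M1 M2).
Proof. by rewrite /= otimes_set_swap. Qed.

Lemma vswap_subproof (X : vn (vn_tensor t M1 M2)) :
  vn_val X \in vn_pred (vn_tensor tswap M2 M1).
Proof. by apply/asboolP; rewrite vn_set_swap; exact: vnP. Qed.

Definition vswap X : vn (vn_tensor tswap M2 M1) := Vn (vswap_subproof X).

Lemma vswapE X z : vswap X z = X z. Proof. by []. Qed.

Lemma vot_ex (a : vn M1) (b : vn M2) :
  exists c : vn (vn_tensor t M1 M2), forall x y, c (t x y) = t (a x) (b y).
Proof.
have [c hc] := topl_ex t a; have [d hd] := topr_ex b.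
have cd x y : (c * d) (t x y) = t (a x) (b y) by rewrite bopME hd hc.
have cdP : c * d \in vn_pred (vn_tensor t M1 M2).
  by apply/asboolP/sub_bicommutant; exists a, b.
by exists (Vn cdP).
Qed.

Definition vot a b := projT1 (cid (vot_ex a b)).

Lemma votE a b x y : vot a b (t x y) = t (a x) (b y).
Proof. by rewrite /vot; case: cid => c. Qed.

Lemma vn_tens_eq (X Y : vn (vn_tensor t M1 M2)) :
  (forall x y, X (t x y) = Y (t x y)) -> X = Y.
Proof. by move=> XY; apply/val_inj/(@bop_tens_eq _ _ _ _ t). Qed.

Lemma votM a b c d : vot a b * vot c d = vot (a * c) (b * d).
Proof. by apply: vn_tens_eq => x y; rewrite vnME !votE. Qed.

Lemma vot1 : vot 1 1 = 1.
Proof. by apply: vn_tens_eq => x y; rewrite votE. Qed.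

Lemma vot_star a b : star (vot a b) = vot (star a) (star b).
Proof.
apply: vn_tens_eq => x y; rewrite votE.
have h : is_otimes t a b (vot a b) by move=> u v; rewrite votE.
exact: (is_otimes_adj h).
Qed.

(** The operator c = S (x) 1 commutes with the generators a (x) b, hence with their bicommutant. *)
Lemma vn_tensor_comm (X : vn (vn_tensor t M1 M2)) S (c : bop K K) : commutant (vn_set M1) S ->
  (forall x y, c (t x y) = t (S x) y) -> (X : bop K K) * c = c * (X : bop K K).
Proof.
move=> SM cS; have := vnP X; apply => d [a [b abd]].
apply: (@bop_tens_eq _ _ _ _ t) => x y; rewrite !bopME cS !abd cS; congr (t _ _).
by have /(congr1 (fun f : bop H1 H1 => f x)) := SM _ (vnP a).
Qed.

Lemma tensor_move (X : vn (vn_tensor t M1 M2)) S x1 x2 y1 y2 :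
  commutant (vn_set M1) S ->
  inner (X (t (S x1) y1)) (t x2 y2) = inner (X (t x1 y1)) (t (adj S x2) y2).
Proof.
move=> SM; have [c hc] := topl_ex t S.
have ot : is_otimes t S 1 c by move=> x y; exact: hc.
have ot' := is_otimes_adj ot.
have E x y : adj c (t x y) = t (adj S x) y by rewrite ot' adj1.
rewrite -hc -E -adjE -[X (c _)]bopME -[c (X _)]bopME.
by rewrite (vn_tensor_comm X SM hc).
Qed.

End Swap.

(** * Slice maps *)

Section Slices.
Variables (R : realType) (H1 H2 K : hilbertType R) (t : hilbert_tensor H1 H2 K).
Variables (M1 : vnalg H1) (M2 : vnalg H2).
Local Notation N := (vn_tensor t M1 M2).
Implicit Types (X Y : vn N).

Lemma slice_ex X y1 y2 : exists a : vn M1,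
  (forall x1 x2, inner (a x1) x2 = inner (X (t x1 y1)) (t x2 y2)) /\
  `|a| <= `|X| * `|y1| * `|y2|.
Proof.
apply: form_vn.
- split=> k x y z; rewrite ?tensDl ?tensZl ?linearD ?linearZ/=.
    by rewrite innerDl innerZl.
  by rewrite innerDr innerZr.
- by rewrite !mulr_ge0.
- move=> x y; rewrite (le_trans (inner_bop_le _ _ _))// !norm_tens.
  rewrite le_eqVlt; apply/orP; left; apply/eqP; ring.
- by move=> S SM x y; exact: tensor_move.
Qed.

Definition slice X y1 y2 : vn M1 := projT1 (cid (slice_ex X y1 y2)).

Lemma sliceE X y1 y2 x1 x2 :
  inner (slice X y1 y2 x1) x2 = inner (X (t x1 y1)) (t x2 y2).
Proof. by rewrite /slice; case: cid => a []. Qed.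

Lemma norm_slice X y1 y2 : `|slice X y1 y2| <= `|X| * `|y1| * `|y2|.
Proof. by rewrite /slice; case: cid => a []. Qed.

End Slices.

Section FunctionalSlices.
Variables (R : realType) (H1 H2 K : hilbertType R) (t : hilbert_tensor H1 H2 K).
Variables (M1 : vnalg H1) (M2 : vnalg H2).
Local Notation N := (vn_tensor t M1 M2).
Implicit Types (X Y : vn N) (phi : dual (vn M2)).

(* lslice X x1 x2 = (omega_{x1,x2} (x) id)(X), slice X y1 y2 = (id (x) omega_{y1,y2})(X);
   rslice and fslice extend these to arbitrary functionals. *)
Definition lslice X x1 x2 : vn M2 := slice (vswap X) x1 x2.

Lemma lsliceE X x1 x2 y1 y2 :
  inner (lslice X x1 x2 y1) y2 = inner (X (t x1 y1)) (t x2 y2).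
Proof. exact: sliceE. Qed.

Lemma norm_lslice X x1 x2 : `|lslice X x1 x2| <= `|X| * `|x1| * `|x2|.
Proof. exact: norm_slice. Qed.

Lemma lslice_linl X k x1 x1' x2 :
  lslice X (k *: x1 + x1') x2 = k *: lslice X x1 x2 + lslice X x1' x2.
Proof.
apply: vn_eq => y1 y2; rewrite vnDE vnZE innerPl !lsliceE.
by rewrite tensPl linearP innerPl.
Qed.

Lemma lslice_linr X k x1 x2 x2' :
  lslice X x1 (k *: x2 + x2') = k^* *: lslice X x1 x2 + lslice X x1 x2'.
Proof.
apply: vn_eq => y1 y2; rewrite vnDE vnZE innerPl !lsliceE.
by rewrite tensPl innerDr innerZr.
Qed.

(** As phi need not be normal, (id (x) phi)(X) is defined weakly, by its form on [H1]; [tensor_move]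
    places it in [M1]. *)
Lemma rslice_ex phi X : exists a : vn M1,
  (forall x1 x2, inner (a x1) x2 = phi (lslice X x1 x2)) /\ `|a| <= `|phi| * `|X|.
Proof.
apply: form_vn.
- split=> k x y z; first by rewrite lslice_linl dualD dualZ.
  by rewrite lslice_linr dualD dualZ.
- by rewrite mulr_ge0.
- move=> x y; rewrite (le_trans (dual_le _ _))// -!mulrA ler_wpM2l//.
  by rewrite mulrA norm_lslice.
- move=> S SM x y; congr (phi _); apply: vn_eq => y1 y2; rewrite !lsliceE.
  exact: tensor_move.
Qed.

Definition rslice phi X : vn M1 := projT1 (cid (rslice_ex phi X)).

Lemma rsliceE phi X x1 x2 : inner (rslice phi X x1) x2 = phi (lslice X x1 x2).
Proof. by rewrite /rslice; case: cid => a []. Qed.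

Lemma norm_rslice phi X : `|rslice phi X| <= `|phi| * `|X|.
Proof. by rewrite /rslice; case: cid => a []. Qed.

Lemma lsliceD X Y x1 x2 : lslice (X + Y) x1 x2 = lslice X x1 x2 + lslice Y x1 x2.
Proof. by apply: vn_eq => y1 y2; rewrite !(vnDE, innerDl, lsliceE). Qed.

Lemma lsliceZ k X x1 x2 : lslice (k *: X) x1 x2 = k *: lslice X x1 x2.
Proof. by apply: vn_eq => y1 y2; rewrite !(vnZE, innerZl, lsliceE). Qed.

Lemma lslice_star X x1 x2 : lslice (star X) x1 x2 = star (lslice X x2 x1).
Proof.
apply: vn_eq => y1 y2; rewrite lsliceE !starE innerC [RHS]innerC lsliceE.
by [].
Qed.

Lemma lslice_vot a b c d X x1 x2 :
  lslice (vot t a b * X * vot t c d) x1 x2 = b * lslice X (c x1) (star a x2) * d.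
Proof.
apply: vn_eq => y1 y2; rewrite lsliceE !vnME votE -[inner (vot _ _ _ _) _]starEr.
rewrite vot_star votE -(starK b) starE lsliceE starK.
by [].
Qed.

Lemma lslice_elem a b x1 x2 : lslice (vot t a b) x1 x2 = inner (a x1) x2 *: b.
Proof.
by apply: vn_eq => y1 y2; rewrite lsliceE votE inner_tens vnZE innerZl.
Qed.

Lemma rsliceD phi X Y : rslice phi (X + Y) = rslice phi X + rslice phi Y.
Proof.
by apply: vn_eq => x y; rewrite vnDE innerDl !rsliceE lsliceD dualD.
Qed.

Lemma rsliceZ phi k X : rslice phi (k *: X) = k *: rslice phi X.
Proof. by apply: vn_eq => x y; rewrite vnZE innerZl !rsliceE lsliceZ dualZ. Qed.

Lemma rsliceB phi X Y : rslice phi (X - Y) = rslice phi X - rslice phi Y.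
Proof. by rewrite -scaleN1r rsliceD rsliceZ scaleN1r. Qed.

Lemma rslice_addf phi psi X : rslice (phi + psi) X = rslice phi X + rslice psi X.
Proof. by apply: vn_eq => x y; rewrite vnDE innerDl !rsliceE dual_addE. Qed.

Lemma rslice_scalef k phi X : rslice (k *: phi) X = k *: rslice phi X.
Proof. by apply: vn_eq => x y; rewrite vnZE innerZl !rsliceE dual_scaleE. Qed.

Lemma rslice_vot a b c d phi X :
  rslice phi (vot t a b * X * vot t c d) = a * rslice (dmul b phi d) X * c.
Proof.
apply: vn_eq => x y; rewrite rsliceE lslice_vot !vnME.
by rewrite -[inner (a _) _]starEr rsliceE dmulE.
Qed.

Lemma rslice_star phi X : rslice phi (star X) = star (rslice (dstar phi) X).
Proof.
apply: vn_eq => x y; rewrite rsliceE lslice_star starE innerC rsliceE dstarE.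
by rewrite conjCK.
Qed.

Lemma rslice_elem phi a b : rslice phi (vot t a b) = phi b *: a.
Proof.
by apply: vn_eq => x y; rewrite rsliceE lslice_elem dualZ vnZE innerZl mulrC.
Qed.

Lemma lslice_pos Y x : bpos (lslice (star Y * Y) x x).
Proof. by move=> y; rewrite lsliceE vnME starE inner_ge0. Qed.

Lemma rslice_pos phi Y : dpos phi -> bpos (rslice phi (star Y * Y)).
Proof. by move=> pp x; rewrite rsliceE; exact/pp/lslice_pos. Qed.

Lemma rslice_vf y1 y2 X : rslice (vf M2 y1 y2) X = slice X y1 y2.
Proof. by apply: vn_eq => x1 x2; rewrite rsliceE vfE lsliceE sliceE. Qed.

End FunctionalSlices.

Section WeaklyCompactTensors.
Variables (R : realType) (H1 H2 K : hilbertType R) (t : hilbert_tensor H1 H2 K).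
Variables (M1 : vnalg H1) (M2 : vnalg H2).
Local Notation N := (vn_tensor t M1 M2).
Implicit Types (X Y : vn N) (phi : dual (vn M2)) (psi : dual (vn M1)).

Definition fslice psi X : vn M2 := rslice psi (vswap X).

Lemma vswapD X Y : vswap (X + Y) = vswap X + vswap Y.
Proof. exact: val_inj. Qed.

Lemma vswapZ k X : vswap (k *: X) = k *: vswap X.
Proof. exact: val_inj. Qed.

Lemma vswapM X Y : vswap (X * Y) = vswap X * vswap Y.
Proof. exact: val_inj. Qed.

Lemma vswap_star X : vswap (star X) = star (vswap X).
Proof. exact: val_inj. Qed.

Lemma vswap_vot a b : vswap (vot t a b : vn N) = vot (tswap t) b a.
Proof.
by apply: (@vn_tens_eq _ _ _ _ (tswap t)) => x y; rewrite vswapE !tswapE votE (votE (tswap t)).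
Qed.

Lemma norm_vswap X : `|vswap X| = `|X|. Proof. by []. Qed.

Lemma fsliceE psi X y1 y2 : inner (fslice psi X y1) y2 = psi (slice X y1 y2).
Proof.
rewrite rsliceE; congr (psi _); apply: vn_eq => x1 x2.
by rewrite lsliceE sliceE.
Qed.

(* Equality of the two iterated slices: by Grothendieck's criterion, weak compactness of the
   operator phi |-> (id (x) phi)(X) on the predual. *)
Definition WC X : Prop := forall psi phi, phi (fslice psi X) = psi (rslice phi X).

Lemma WCD X Y : WC X -> WC Y -> WC (X + Y).
Proof.
by move=> wX wY psi phi; rewrite /fslice vswapD !rsliceD !dualD -wX -wY.
Qed.

Lemma WCZ k X : WC X -> WC (k *: X).
Proof.
by move=> wX psi phi; rewrite /fslice vswapZ !rsliceZ !dualZ -wX.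
Qed.

Lemma WCN X : WC X -> WC (- X).
Proof. by rewrite -scaleN1r; exact: WCZ. Qed.

Lemma WC_elem a b : WC (vot t a b).
Proof.
by move=> psi phi; rewrite /fslice vswap_vot !rslice_elem !dualZ mulrC.
Qed.

Lemma WC0 : WC 0.
Proof. by rewrite -[0](scale0r (vot t 0 0 : vn N)); exact/WCZ/WC_elem. Qed.

Lemma WC_sum (I : Type) (r : seq I) (F : I -> vn N) :
  (forall i, WC (F i)) -> WC (\sum_(i <- r) F i).
Proof. by move=> h; elim/big_ind: _ => //; [exact: WC0 | exact: WCD]. Qed.

Lemma WC_star X : WC X -> WC (star X).
Proof.
move=> wX psi phi; rewrite /fslice vswap_star !rslice_star.
rewrite -[LHS]conjCK -[RHS]conjCK; congr (_ ^*).
rewrite -dstarE -[in RHS]dstarE; exact: wX.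
Qed.

Lemma WC_vot a b c d X : WC X -> WC (vot t a b * X * vot t c d).
Proof.
move=> wX psi phi; rewrite /fslice !vswapM !vswap_vot !rslice_vot -!dmulE.
exact: wX.
Qed.

(** Both iterated slices are bounded by |psi| |phi| |X|, so their equality passes to norm limits. *)
Lemma WC_approx X : (forall e : R[i], 0 < e -> exists2 Y, WC Y & `|X - Y| <= e) -> WC X.
Proof.
move=> h psi phi; apply: eq_all_eps => e e0.
have c0 : 0 < 2 * `|psi| * `|phi| + 1 by rewrite ltr_wpDl// !mulr_ge0.
have [Y wY XY] := h _ (divr_gt0 e0 c0).
have -> : phi (fslice psi X) - psi (rslice phi X) =
    phi (fslice psi (X - Y)) - psi (rslice phi (X - Y)).
  rewrite /fslice.
  have -> : vswap (X - Y) = vswap X - vswap Y by exact: val_inj.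
  rewrite !rsliceB !dualB -/(fslice psi Y) wY.
  by rewrite opprB addrA subrK.
rewrite (le_trans (ler_normB _ _))//.
have h1 : `|phi (fslice psi (X - Y)) : R[i]| <= `|psi| * `|phi| * `|X - Y|.
  rewrite (le_trans (dual_le _ _))// [`|psi| * _]mulrC -mulrA ler_wpM2l//.
  by rewrite -norm_vswap norm_rslice.
have h2 : `|psi (rslice phi (X - Y)) : R[i]| <= `|psi| * `|phi| * `|X - Y|.
  by rewrite (le_trans (dual_le _ _))// -mulrA ler_wpM2l// norm_rslice.
apply: (le_trans (lerD h1 h2)); rewrite -mulr2n -mulr_natl !mulrA.
rewrite (le_trans (ler_wpM2l _ XY)) ?mulr_ge0// mulrA ler_pdivrMr// mulrC.
by rewrite ler_wpM2l ?lerDl// ltW.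
Qed.

End WeaklyCompactTensors.

(** * Riesz products *)

Lemma ultra_fmap (T S : Type) (f : T -> S) (F : set_system T) :
  UltraFilter F -> UltraFilter (f @ F).
Proof.
move=> FF; apply: Build_UltraFilter => G PG FG; apply/seteqP; split=> [A GA|]; last exact: FG.
have [//|nA] := in_ultra_setVsetC (f @^-1` A) FF.
have GnA : G (~` A) by apply: FG.
by have [x []] := filter_ex (filterI GA GnA).
Qed.

Lemma normD_leC (R : realType) (a b : R[i]) (r s u : R) : `|a| <= r%:C%C ->
  `|b| <= s%:C%C -> r + s <= u -> `|a + b| <= u%:C%C.
Proof.
move=> ar bs rsu; rewrite (le_trans (ler_normD _ _))// (le_trans (lerD ar bs))//.
by rewrite -rmorphD lecR.
Qed.

(** The choice is eta n = d / 2^(n + 3), so eta 0 = d / 8 and the errors from stage n on add up to 2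
    eta n. The invariants of the form c - 2 eta n in the construction below record what has been
    spent so far. *)
Lemma geometric_steps (R : realType) (d : R) : 0 < d ->
  exists eta : nat -> R, [/\ forall n, 0 < eta n,
    forall n, eta n.+1 = eta n / 2, forall n, eta n <= d / 8 &
    forall e, 0 < e -> exists m, forall n, (m <= n)%N -> eta n < e].
Proof.
move=> d0; pose eta n : R := d / (2 ^ (n + 3))%:R.
have eta0 n : 0 < eta n by rewrite divr_gt0// ltr0n expn_gt0.
have etaS n : eta n.+1 = eta n / 2.
  rewrite /eta addSn expnS natrM; field.
  by rewrite pnatr_eq0 -lt0n expn_gt0.
exists eta; split => //.
  elim=> [|n IH]; first by rewrite /eta.
  by rewrite etaS (le_trans _ IH)// ler_pdivrMr// ler_peMr ?ler1n// ltW.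
move=> e e0; exists (Num.truncn (d / e)) => n hn.
rewrite ltr_pdivrMr ?ltr0n ?expn_gt0// mulrC -ltr_pdivrMr//.
apply: (lt_le_trans (truncnS_gt _)); rewrite ler_nat.
by rewrite (leq_trans _ (ltn_expl _ _))// ltnS addn3 (leq_trans hn)// -addn3 leq_addr.
Qed.

Section StepArithmetic.
Variables (R : realType) (d e c : R).

Lemma step_half : c - 2 * e + e <= c - 2 * (e / 2).
Proof. lra. Qed.

Lemma step_ge0 : e <= d / 8 -> 0 <= d / 4 - 2 * e.
Proof. lra. Qed.

Lemma step_first : e <= d / 8 -> e + e + (d / 4 - 2 * e) <= 3 / 8 * d - 2 * (e / 2).
Proof. lra. Qed.

Lemma step_le : 0 < e -> c - 2 * e <= c.
Proof. lra. Qed.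

Lemma step_absurd : 0 < d -> d <= 3 / 8 * d -> False.
Proof. lra. Qed.

End StepArithmetic.

Section RieszProducts.
Variables (R : realType) (H : hilbertType R) (M : vnalg H).
Variables (I : Type) (U : set_system I) (h : I -> vn M) (phi : dual (vn M)).
Hypotheses (UU : UltraFilter U) (h_central : forall i, central (h i)).
Hypotheses (h_star : forall i, star (h i) = h i) (h_le1 : forall i, `|h i| <= 1).
Hypothesis phi_pos : dpos phi.
Hypothesis h_weak : forall V : set_system I, UltraFilter V ->
  exists z, forall psi : dual (vn M), ulim V (fun i => psi (h i)) = psi z.
Hypothesis h_null : forall psi : dual (vn M), ulim U (fun i => psi (h i)) = 0.

Let pU : ProperFilter U := ultra_proper.

Let hpos i : bpos (1 + h i : vn M).
Proof.
have := @bpos_normB _ _ (- vn_val (h i)) 1.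
rewrite scale1r opprK; apply; last by rewrite normrN; exact: h_le1.
by rewrite adjN; congr (- _); exact: (congr1 (@vn_val _ _ _) (h_star i)).
Qed.

Fixpoint rprod (s : seq I) : vn M := if s is i :: s' then (1 + h i) * rprod s' else 1.

Let rprod_central s : central (rprod s).
Proof.
elim: s => [|i s IH]; first exact: central1.
by apply: centralM IH; apply: centralD; [exact: central1 | exact: h_central].
Qed.

Let rprod_pos s : bpos (rprod s).
Proof.
elim: s => [|i s IH]; first by move=> x; rewrite vn1E inner_ge0.
apply: (@bposM _ _ (vn_val (rprod s)) (vn_val (1 + h i))) => //.
exact: (congr1 (@vn_val _ _ _) (rprod_central s (1 + h i))).
Qed.

Let ub (V : set_system I) (psi : dual (vn M)) : UltraFilter V ->
  ubounded V (fun i => psi (h i)).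
Proof.
move=> VV; have pV : ProperFilter V := ultra_proper.
exists `|psi|; apply: filterE => i; apply: (@le_trans _ _ (`|psi| * `|h i|)).
  exact: dual_le.
by rewrite ler_piMr.
Qed.

Let small_eventually (L : seq (dual (vn M))) (e : R[i]) : 0 < e ->
  U [set i | forall psi, List.In psi L -> `|psi (h i) : R[i]| <= e].
Proof.
move=> e0; elim: L => [|psi L IH]; first by apply: filterE => i psi [].
have h1 := ulim_near UU (ub psi UU) e0; rewrite h_null in h1.
apply: (@filterS2 _ _ _ _ _ _ _ h1 IH) => i /= h1' h2 psi' [<-|/h2//].
by rewrite subr0 in h1'.
Qed.

Lemma In_map (T S : Type) (f : T -> S) x (s : seq T) :
  List.In x s -> List.In (f x) [seq f y | y <- s].
Proof. by elim: s => //= y s IH [->|/IH]; [left | right]. Qed.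

(** Suppose that the limit d is positive, and let lam be the limit of phi (h_i^2 .). Factors k_n are
    picked among the h_i, each so far along [U] that it is nearly annihilated by all functionals
    built before. With Q_N the product of the 1 + k_j for j < N, the functionals phi (Q_N .) are
    positive and bounded, and their value at k_n stays near d once N > n, since Q_N then contains
    the factor 1 + k_n. A limit mu of them keeps mu (k_n) near d. But a weak limit z of the k_n
    satisfies phi (Q_N z) = 0 for every N, so mu (z) = 0. *)
Lemma riesz_product_null : ulim U (fun i => phi (h i * h i)) = 0.
Proof.
have fle i : `|dmul (h i * h i) phi 1| <= `|phi|.
  apply: opnorm_le => // a; rewrite dmulE mulr1.
  apply: (@le_trans _ _ (`|phi| * `|h i * h i * a|)); first exact: dual_le.
  rewrite ler_wpM2l// (le_trans (norm_vnM _ _))// ler_piMl//.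
  by rewrite (le_trans (norm_vnM _ _))// mulr_ile1.
have [lam [lamE _]] := @ulim_dual _ _ _ U (fun i => dmul (h i * h i) phi 1) _ UU
  (normr_ge0 phi) (filterE _ fle).
have {}lamE a : lam a = ulim U (fun i => phi (h i * h i * a)).
  by rewrite lamE; congr ulim; apply/funext => i; rewrite dmulE mulr1.
have ub2 a : ubounded U (fun i => phi (h i * h i * a)).
  exists (`|phi| * `|a|); apply: filterE => i.
  apply: (@le_trans _ _ (`|dmul (h i * h i) phi 1| * `|a|)); last by rewrite ler_wpM2r.
  by rewrite -[h i * h i * a]mulr1; exact: (dual_le (dmul (h i * h i) phi 1) a).
have -> : ulim U (fun i => phi (h i * h i)) = lam 1.
  by rewrite lamE; congr ulim; apply/funext => i; rewrite mulr1.
have : 0 <= (lam 1 : R[i]).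
  rewrite lamE; apply: ulim_ge0 => //; apply: filterE => i /=.
  by rewrite mulr1 -{1}h_star; exact/phi_pos/bpos_starM.
move=> /ge0_complexP[d d0 dE]; rewrite dE.
have [-> //|dn0] := eqVneq d 0; exfalso.
have {dn0} d0 : 0 < d by rewrite lt_def dn0.
have [eta [eta0 etaS eta_le eta_small]] := geometric_steps d0.
(* The functionals on which the next factor has to be small: phi (Q_m .) for all products so far,
   phi (Q k_j .) for all earlier factors, and lam (Q .). They serve [cA], [cB] and [cC]. *)
pose L s := [seq dmul (rprod (drop k s)) phi 1 | k <- iota 0 (size s).+1] ++
  [seq dmul (rprod s * h j) phi 1 | j <- s] ++ [:: dmul (rprod s) lam 1].
have step s : exists i, (forall psi, List.In psi (L s) ->
      `|psi (h i) : R[i]| <= (eta (size s))%:C%C) /\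
    `|phi (h i * h i * rprod s) - lam (rprod s)| <= (eta (size s))%:C%C.
  have e0 : 0 < (eta (size s))%:C%C :> R[i] by rewrite ltcR.
  have h1 := small_eventually (L s) e0.
  have := ulim_near UU (ub2 (rprod s)) e0; rewrite -lamE => h2.
  by have [i []] := filter_ex (filterI h1 h2); exists i.
have [f fP] := choice step.
pose S n := iter n (fun s => f s :: s) [::].
pose k n := h (f (S n)).
pose Q n := rprod (S n).
have QS n : Q n.+1 = Q n + k n * Q n by rewrite /Q/= mulrDl mul1r.
have sizeS n : size (S n) = n by elim: n => //= n ->.
have dropS m n : (m <= n)%N -> drop (n - m) (S n) = S m.
  elim: n => [|n IH]; first by rewrite leqn0 => /eqP->.
  rewrite leq_eqVlt => /predU1P[->|]; first by rewrite subnn drop0.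
  by rewrite ltnS => mn; rewrite subSn//= IH.
have Qc n : central (Q n) by exact: rprod_central.
have kc n : central (k n) by exact: h_central.
have cA m n : (m <= n)%N -> `|phi (Q m * k n) : R[i]| <= (eta n)%:C%C.
  move=> mn; have [h1 _] := fP (S n); rewrite sizeS in h1.
  have := h1 (dmul (Q m) phi 1); rewrite dmulE mulr1; apply.
  apply/In_cat; left; rewrite sizeS.
  have -> : Q m = rprod (drop (n - m) (S n)) by rewrite dropS.
  apply: (In_map (fun k => dmul (rprod (drop k (S n))) phi 1)).
  have : (n - m)%N \in iota 0 n.+1 by rewrite mem_iota/= add0n ltnS leq_subr.
  elim: (iota 0 n.+1) => // x s IH; rewrite inE => /predU1P[->|/IH]; by [left | right].
have inS j n : (j < n)%N -> List.In (f (S j)) (S n).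
  elim: n => // n IH; rewrite ltnS leq_eqVlt => /predU1P[->|/IH]; by [left | right].
have cB j n : (j < n)%N -> `|phi (Q n * k j * k n) : R[i]| <= (eta n)%:C%C.
  move=> jn; have [h1 _] := fP (S n); rewrite sizeS in h1.
  have := h1 (dmul (Q n * k j) phi 1); rewrite dmulE mulr1; apply.
  apply/In_cat; right; apply/In_cat; left.
  exact: (In_map (fun j => dmul (rprod (S n) * h j) phi 1) (inS _ _ jn)).
have cC n : `|lam (Q n * k n) : R[i]| <= (eta n)%:C%C.
  have [h1 _] := fP (S n); rewrite sizeS in h1.
  have := h1 (dmul (Q n) lam 1); rewrite dmulE mulr1; apply.
  by apply/In_cat; right; apply/In_cat; right; left.
have cD n : `|phi (Q n * k n * k n) - lam (Q n)| <= (eta n)%:C%C.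
  have [_] := fP (S n); rewrite sizeS -/(k n) -/(Q n).
  by rewrite -(Qc n) mulrA.
have lamQ n : `|lam (Q n) - d%:C%C| <= (d / 4 - 2 * eta n)%:C%C.
  elim: n => [|n IH].
    by rewrite {1}/Q/= dE subrr normr0 lecR step_ge0.
  rewrite QS dualD addrAC kc; apply: (normD_leC IH (cC n)).
  by rewrite etaS; exact: step_half.
have phiQ n : phi (Q n) <= phi 1 + (d / 4 - 2 * eta n)%:C%C :> R[i].
  elim: n => [|n IH].
    by rewrite {1}/Q/= lerDl lecR step_ge0.
  rewrite QS dualD kc.
  have Q0 : 0 <= (phi (Q n * k n) + phi (Q n) : R[i]).
    by rewrite -dualD addrC -kc -QS; exact/phi_pos/rprod_pos.
  have re : (phi (Q n * k n) : R[i]) \is Num.real.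
    have h1 : (phi (Q n) : R[i]) \is Num.real by rewrite ger0_real//; exact/phi_pos/rprod_pos.
    by rewrite -[X in X \is _](addrK (phi (Q n))) rpredB// ger0_real.
  have := le_trans (real_ler_norm re) (cA n n (leqnn n)) => h1.
  apply: (le_trans (lerD IH h1)); rewrite -addrA lerD2l -rmorphD lecR etaS; exact: step_half.
(* At j = 0 the term phi (Q_n k_n^2) is close to lam (Q_n), hence to d; each later factor perturbs
   the value only by [cB]. *)
have keyQ n j : `|phi (Q (n.+1 + j)%N * k n) - d%:C%C| <= (3 / 8 * d - 2 * eta (n.+1 + j)%N)%:C%C.
  elim: j => [|j IH].
    rewrite addn0 QS mulrDl dualD.
    have -> : k n * Q n * k n = Q n * k n * k n by rewrite kc.
    have -> : phi (Q n * k n) + phi (Q n * k n * k n) - d%:C%C =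
      (phi (Q n * k n) + (phi (Q n * k n * k n) - lam (Q n))) + (lam (Q n) - d%:C%C).
      by rewrite addrA addrA subrK.
    apply: (normD_leC (normD_leC (cA n n (leqnn n)) (cD n) (lexx _)) (lamQ n)).
    by rewrite etaS; exact: step_first.
  rewrite addnS QS mulrDl dualD.
  have -> : k (n.+1 + j)%N * Q (n.+1 + j)%N * k n = Q (n.+1 + j)%N * k n * k (n.+1 + j)%N.
    by rewrite -mulrA kc.
  have nj : (n < n.+1 + j)%N by rewrite ltnS leq_addr.
  rewrite addrAC; apply: (normD_leC IH (cB _ _ nj)).
  by rewrite etaS; exact: step_half.
have [V [VV Voo]] := nat_ultra; have pV : ProperFilter V := ultra_proper.
have p1 : 0 <= (phi 1 : R[i]) by exact: dpos1_ge0.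
have C0 : 0 <= phi 1 + (d / 4)%:C%C :> R[i] by rewrite addr_ge0// ler0c divr_ge0// ltW.
have mu_le n : `|dmul (Q n) phi 1| <= phi 1 + (d / 4)%:C%C.
  apply: opnorm_le => // a.
  have dp : dpos (dmul (Q n) phi 1) by apply: dpos_central => //; exact: rprod_pos.
  apply: (@le_trans _ _ (`|a| * dmul (Q n) phi 1 1)); first exact: dpos_le.
  rewrite mulrC ler_wpM2r// dmulE !mulr1 (le_trans (phiQ n))// lerD2l lecR.
  exact: step_le.
have [mu [muE _]] := @ulim_dual _ _ _ V (fun n => dmul (Q n) phi 1) _ VV C0 (filterE _ mu_le).
have {}muE a : mu a = ulim V (fun n => phi (Q n * a)).
  by rewrite muE; congr ulim; apply/funext => n; rewrite dmulE mulr1.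
have [z zP] := h_weak (ultra_fmap (fun n => f (S n)) VV).
have {}zP (psi : dual (vn M)) : ulim V (fun n => psi (k n)) = psi z.
  rewrite -(zP psi); apply: (ulim_uniq VV) => e e0.
  have FV := ultra_fmap (fun n => f (S n)) VV.
  exact: (ulimP FV (ub psi FV) e0).
(* For fixed N the values phi (Q_N k_n) tend to 0 by [cA], and phi (Q_N .) is one of the functionals
   that see the weak limit. *)
have Q0 N : phi (Q N * z) = 0.
  have := zP (dmul (Q N) phi 1); rewrite dmulE mulr1 => <-.
  apply: (ulim_uniq VV) => _ /gt0_complexP[e e0 ->].
  have [n0 hn0] := eta_small _ e0.
  apply: Voo; exists (maxn n0 N) => // n /=; rewrite geq_max => /andP[n1 n2].
  rewrite subr0 mulr1 (le_lt_trans (cA _ _ n2))// ltcR.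
  exact: hn0.
have mu0 : mu z = 0.
  rewrite muE -[RHS](ulim_cst VV); apply: (eq_ulim VV); apply: filterE => n /=.
  exact: Q0.
have ubQ a : ubounded V (fun n => phi (Q n * a)).
  exists ((phi 1 + (d / 4)%:C%C) * `|a|); apply: filterE => n.
  apply: (@le_trans _ _ (`|dmul (Q n) phi 1| * `|a|)); last by rewrite ler_wpM2r.
  by rewrite -[Q n * a]mulr1; exact: (dual_le (dmul (Q n) phi 1) a).
have ubc (c : R[i]) : ubounded V (fun=> c).
  by exists `|c|; apply: filterE => i /=; exact: lexx.
have mub n : `|mu (k n) - d%:C%C| <= (3 / 8 * d)%:C%C.
  rewrite muE -(ulim_cst VV (d%:C%C)) -mulN1r -(ulimZ VV _ (ubc _)).
  rewrite -(ulimD VV (ubQ _) (uboundedZ VV _ (ubc _))).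
  apply: ulim_norm_le; first by rewrite ler0c mulr_ge0 ?divr_ge0// ltW.
  apply: Voo; exists n.+1 => // N /= /subnKC <-; rewrite mulN1r.
  by rewrite (le_trans (keyQ _ _))// lecR; exact: step_le.
have : `|mu z - d%:C%C| <= (3 / 8 * d)%:C%C.
  have ubm : ubounded V (fun n => mu (k n)).
    by have := ub mu (ultra_fmap (fun n => f (S n)) VV).
  rewrite -(zP mu) -(ulim_cst VV (d%:C%C)) -mulN1r -(ulimZ VV _ (ubc _)).
  rewrite -(ulimD VV ubm (uboundedZ VV _ (ubc _))).
  apply: ulim_norm_le; first by rewrite ler0c mulr_ge0 ?divr_ge0// ltW.
  by apply: filterE => n /=; rewrite mulN1r.
rewrite mu0 sub0r normrN ger0_norm; last by rewrite ler0c ltW.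
by rewrite lecR => /(step_absurd d0).
Qed.

End RieszProducts.

(** * Central elements of a tensor product *)

Section Bicommutant.
Variables (R : realType) (K : hilbertType R) (A : set (bop K K)).
Hypotheses (A1 : A 1) (AM : forall a b, A a -> A b -> A (a * b)).
Hypothesis Aadj : forall a, A a -> A (adj a).

(* The projection onto the closure of A v commutes with A, hence with A''. *)
Lemma bicommutant_vector c v w : commutant (commutant A) c ->
  (forall a, A a -> inner (a v) w = 0) -> inner (c v) w = 0.
Proof.
move=> Ac vw.
pose S := [set z | exists s : seq (R[i] * bop K K), (forall p, List.In p s -> A p.2) /\
  z = \sum_(p <- s) p.1 *: p.2 v].
have S0 : S 0 by exists [::]; split=> //; rewrite big_nil.
have SD k x y : S x -> S y -> S (k *: x + y).
  move=> [s [sA ->]] [s' [sA' ->]].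
  exists ([seq (k * p.1, p.2) | p <- s] ++ s'); split.
    move=> p /In_cat[|/sA'//]; elim: s sA => //= q s IH sA [<-|].
      exact: (sA q (or_introl erefl)).
    by apply: IH => r rs; apply: sA; right.
  rewrite big_cat big_map/= scaler_sumr; congr (_ + _).
  by apply: eq_bigr => p _; rewrite scalerA.
have SA a x : A a -> S x -> S (a x).
  move=> Aa [s [sA ->]]; exists [seq (p.1, a * p.2) | p <- s]; split.
    move=> p; elim: s sA => //= q s IH sA [<-|].
      exact: (AM Aa (sA q (or_introl erefl))).
    by apply: IH => r rs; apply: sA; right.
  by rewrite big_map linear_sum/=; apply: eq_bigr => p _; rewrite linearZ.
have Sv : S v.
  exists [:: (1, 1)]; split; first by move=> p [<-|].
  by rewrite big_cons big_nil addr0 scale1r.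
have Sw x : S x -> inner x w = 0.
  move=> [s [sA ->]]; rewrite (sesqui_suml (inner_sesqui _)).
  elim: s sA => [|p s IH] sA; rewrite ?big_nil// big_cons IH ?addr0.
    by rewrite innerZl vw ?mulr0//; apply: sA; left.
  by move=> q qs; apply: sA; right.
have [p pP] := choice (projection S0 SD).
have clS x y : (forall s, S s -> inner s y = 0) -> inner (p x) y = 0.
  move=> Sy; apply: eq0_all_eps => e e0; have [_ pS] := pP x.
  have c0 : 0 < `|y| + 1 by rewrite ltr_wpDl.
  have [s Ss ps] := pS _ (divr_gt0 e0 c0).
  rewrite -[p x](subrK s) innerDl (Sy s Ss) addr0 (le_trans (cauchy_schwarz _ _))//.
  rewrite (le_trans (ler_wpM2r _ (ltW ps)))// -mulrA ler_piMr ?(ltW e0)//.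
  by rewrite mulrC ler_pdivrMr// mul1r lerDl.
have orth x s : S s -> inner s (x - p x) = 0.
  by move=> Ss; rewrite innerC (pP x).1// conjC0.
have pp x y : inner (p x) (y - p y) = 0 by apply: clS => s; exact: orth.
have uniq x z : (forall s, S s -> inner s (x - z) = 0) -> (forall y,
    (forall s, S s -> inner s y = 0) -> inner z y = 0) -> p x = z.
  move=> h1 h2; apply/eqP; rewrite -subr_eq0 -normr_eq0 -sqrf_eq0 -inner_norm; apply/eqP.
  have h3 s : S s -> inner s (p x - z) = 0.
    move=> Ss; have -> : p x - z = (x - z) - (x - p x) by rewrite opprB [RHS]addrC addrA subrK.
    by rewrite innerBr h1// orth// subrr.
  by rewrite innerBl clS// h2// subrr.
have plin k x y : p (k *: x + y) = k *: p x + p y.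
  apply: uniq => [s Ss|z Sz]; last by rewrite innerPl !clS// mulr0 addr0.
  by rewrite opprD addrACA -scalerBr innerDr innerZr !orth// mulr0 addr0.
have psym x y : inner (p x) y = inner x (p y).
  rewrite -[y in LHS](subrK (p y)) innerDr pp add0r.
  by rewrite -[x in RHS](subrK (p x)) innerDl [inner (x - p x) _]innerC pp conjC0 add0r.
have pn x : `|p x| <= `|x|.
  have [->|px0] := eqVneq (p x) 0; first by rewrite normr0.
  rewrite -(@ler_pM2r _ `|p x|) ?normr_gt0// -expr2 -inner_norm.
  have h : inner (p x) (p x) = inner x (p x).
    apply/eqP; rewrite eq_sym -subr_eq0 -innerBl; apply/eqP.
    by rewrite innerC pp conjC0.
  by rewrite -[leLHS]ger0_norm ?inner_ge0// h cauchy_schwarz.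
have [P hP] : exists P : bop K K, forall x y, inner (P x) y = inner (p x) y.
  apply: (@form_bop _ _ _ _ 1) => //.
    split=> k x y z; first by rewrite plin innerPl.
    by rewrite innerDr innerZr.
  by move=> x y; rewrite mul1r (le_trans (cauchy_schwarz _ _))// ler_wpM2r.
have {hP} PE x : P x = p x.
  by apply: inner_eq => y; rewrite innerC hP -innerC.
(* [A] is closed under adjoints, so it leaves both the closure of [S] and its orthogonal complement
   invariant. *)
have PA : commutant A P.
  move=> a Aa; apply: bop_eqP => x; rewrite !bopME !PE; apply: uniq.
    move=> s Ss; rewrite -linearB/= adjEr orth//; apply: SA => //; exact: Aadj.
  move=> y Sy; rewrite adjE clS// => s Ss; rewrite -adjE.
  by apply: Sy; exact: SA.
have pv : p v = v.
  apply: uniq => [s _|y]; first by rewrite subrr inner0r.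
  exact.
have : (c * P) v = (P * c) v by rewrite (Ac P PA).
by rewrite !bopME !PE pv => ->; exact: clS.
Qed.

End Bicommutant.

(** Used with n = |X u| when [w] is within e of X u and |<X u, w>| <= c |w|: then |w| <= n + e, and
    replacing w by X u costs n e. *)
Lemma quad_absorb (R : realType) (n c : R[i]) : 0 <= n -> 0 <= c ->
  (forall e, 0 < e -> n ^+ 2 <= c * (n + e) + n * e) -> n <= c.
Proof.
move=> n0 c0 h; have [->//|nn] := eqVneq n 0.
have n1 : 0 < n by rewrite lt_def nn.
rewrite -(@ler_pM2r _ n)// -expr2; apply: le_all_eps => [||e e0].
- exact: exprn_ge0.
- exact: mulr_ge0.
have cn : 0 < c + n + 1 by rewrite ltr_wpDl// addr_ge0.
apply: (le_trans (h _ (divr_gt0 e0 cn))).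
rewrite mulrDr -addrA lerD2l -mulrDl mulrA ler_pdivrMr// mulrC.
by rewrite ler_wpM2l ?(ltW e0)// lerDl.
Qed.

Section Elementary.
Variables (R : realType) (H1 H2 K : hilbertType R) (t : hilbert_tensor H1 H2 K).
Variables (M1 : vnalg H1) (M2 : vnalg H2).
Local Notation N := (vn_tensor t M1 M2).
Implicit Types (X Y Z : vn N).

Definition tsum (s : seq (vn M1 * vn M2)) : vn N := \sum_(p <- s) vot t p.1 p.2.

Lemma tsum_cat s s' : tsum (s ++ s') = tsum s + tsum s'.
Proof. by rewrite /tsum big_cat. Qed.

Lemma vot_scale k a b : vot t (k *: a) b = k *: vot t a b :> vn N.
Proof. by apply: vn_tens_eq => x y; rewrite vnZE !votE vnZE tensZl. Qed.

Lemma tsum_star s : star (tsum s) = tsum [seq (star p.1, star p.2) | p <- s].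
Proof.
by rewrite /tsum star_sum big_map; apply: eq_bigr => p _; rewrite vot_star.
Qed.

Lemma WC_tsum_mull s X : WC X -> WC (tsum s * X).
Proof.
move=> wX; rewrite /tsum mulr_suml; apply: WC_sum => p.
by rewrite -[_ * X]mulr1 -(vot1 t M1 M2); exact: WC_vot.
Qed.

Lemma WC_tsum s : WC (tsum s).
Proof. by apply: WC_sum => p; exact: WC_elem. Qed.

Lemma WC_tsum_mulr s X : WC X -> WC (X * tsum s).
Proof.
move=> wX; rewrite -[X * _]starK starM tsum_star; apply/WC_star/WC_tsum_mull.
exact: WC_star.
Qed.

Lemma otimes_setE c : otimes_set t M1 M2 c -> exists a b, c = vn_val (vot t a b : vn N).
Proof.
move=> [a [b abc]]; exists a, b; apply: (@bop_tens_eq _ _ _ _ t) => x y.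
by rewrite abc votE.
Qed.

Lemma otimes_setM c d : otimes_set t M1 M2 c -> otimes_set t M1 M2 d ->
  otimes_set t M1 M2 (c * d).
Proof.
move=> [a [b ab]] [a' [b' ab']]; exists (a * a'), (b * b') => x y.
by rewrite bopME ab' ab.
Qed.

Lemma otimes_set1 : otimes_set t M1 M2 1.
Proof. by exists 1, 1 => x y. Qed.

(** Density of the algebraic tensor product at one vector. The component of X v orthogonal to all
    the sums is orthogonal to X v itself by [bicommutant_vector], hence 0. *)
Lemma tsum_dense X v (e : R[i]) : 0 < e -> exists s, `|X v - tsum s v| < e.
Proof.
move=> e0; pose S := [set z | exists s, z = tsum s v].
have S0 : S 0 by exists [::]; rewrite /tsum big_nil.
have SD k x y : S x -> S y -> S (k *: x + y).
  move=> [s ->] [s' ->]; exists ([seq (k *: p.1, p.2) | p <- s] ++ s').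
  rewrite tsum_cat vnDE; congr (_ + _); rewrite -vnZE; congr (vn_val _ _).
  rewrite /tsum big_map scaler_sumr; apply: eq_bigr => p _.
  by rewrite vot_scale.
have [p [ps pS]] := projection S0 SD (X v).
have h0 : inner (X v) (X v - p) = 0.
  apply: (bicommutant_vector otimes_set1 otimes_setM (@otimes_set_adj _ _ _ _ t M1 M2)).
    exact: (vnP X).
  move=> c /otimes_setE[a [b ->]]; rewrite innerC ps ?conjC0//.
  by exists [:: (a, b)]; rewrite /tsum big_seq1.
have h1 : inner p (X v - p) = 0.
  apply: eq0_all_eps => d d0; have c0 : 0 < `|X v - p| + 1 by rewrite ltr_wpDl.
  have [s Ss hs] := pS _ (divr_gt0 d0 c0).
  rewrite -[X in inner X _](subrK s) innerDl [inner s _]innerC ps// conjC0 addr0.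
  rewrite (le_trans (cauchy_schwarz _ _))// (le_trans (ler_wpM2r _ (ltW hs)))//.
  by rewrite -mulrA ler_piMr ?(ltW d0)// mulrC ler_pdivrMr// mul1r lerDl.
have E : X v = p.
  apply/eqP; rewrite -subr_eq0 -normr_eq0 -sqrf_eq0 -inner_norm innerBl h0 h1.
  by rewrite subrr.
by have [_ [s ->] hs] := pS _ e0; exists s; rewrite E.
Qed.

Definition ncentral X : Prop := forall a b, vot t a b * X = X * vot t a b.

Lemma lslice_central X x1 x2 : ncentral X -> central (lslice X x1 x2).
Proof.
move=> cX d; have := lslice_vot 1 1 1 d X x1 x2; rewrite mul1r star1 => <-.
have := lslice_vot 1 d 1 1 X x1 x2; rewrite mulr1 star1 => <-.
by rewrite vot1 mul1r mulr1 cX.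
Qed.

Lemma rslice_central phi X : ncentral X -> central (rslice phi X).
Proof.
move=> cX d; have p1 : dmul 1 phi 1 = phi.
  by apply: bop_eqP => a; rewrite dmulE mul1r mulr1.
have := rslice_vot 1 1 d 1 phi X; rewrite mul1r p1 => <-.
have := rslice_vot d 1 1 1 phi X; rewrite mulr1 p1 => <-.
by rewrite vot1 mul1r mulr1 cX.
Qed.

Lemma ncentralD X Y : ncentral X -> ncentral Y -> ncentral (X + Y).
Proof. by move=> cX cY a b; rewrite mulrDr mulrDl cX cY. Qed.

Lemma ncentralZ k X : ncentral X -> ncentral (k *: X).
Proof. by move=> cX a b; rewrite vn_scaleMl vn_scaleMr cX. Qed.

Lemma ncentralB X Y : ncentral X -> ncentral Y -> ncentral (X - Y).
Proof. by move=> cX cY; rewrite -scaleN1r; apply/ncentralD/ncentralZ. Qed.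

Lemma ncentral_vot a b : central a -> central b -> ncentral (vot t a b).
Proof. by move=> ca cb c d; rewrite !votM ca cb. Qed.

Lemma ncentral_tsum s : (forall p, List.In p s -> central p.1 /\ central p.2) ->
  ncentral (tsum s).
Proof.
elim: s => [|p s IH] sc a b; first by rewrite /tsum big_nil mulr0 mul0r.
rewrite /tsum big_cons mulrDr mulrDl; have [c1 c2] := sc p (or_introl erefl).
rewrite ncentral_vot//; congr (_ + _); apply: IH => q qs; apply: sc.
by right.
Qed.

End Elementary.

(** * Compactness of central slices in L^2(phi) *)

Section FiniteRank.
Variables (R : realType) (H1 H2 K : hilbertType R) (t : hilbert_tensor H1 H2 K).
Variables (M1 : vnalg H1) (M2 : vnalg H2).
Local Notation N := (vn_tensor t M1 M2).
Variables (X : vn N) (phi : dual (vn M2)).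
Hypotheses (wX : WC X) (cX : ncentral X) (phi_pos : dpos phi).

Let sn := seminorm (dform phi).
Let fs := dform_sesqui phi.
Let f0 := dform_ge0 phi_pos.

(** Vectors outside the unit ball are sent to 0, so that [y] below is a bounded family indexed by
    all pairs. *)
Let cut (x : H1) := if `|x| <= 1 then x else 0.

Let cut_le x : `|cut x| <= 1.
Proof. by rewrite /cut; case: ifP => // _; rewrite normr0. Qed.

Let y (p : H1 * H1) := lslice X (cut p.1) (cut p.2).

Let y_le p : `|y p| <= `|X|.
Proof.
rewrite (le_trans (norm_lslice _ _ _))// -mulrA ler_piMr//.
by rewrite mulr_ile1// cut_le.
Qed.

Let y_central p : central (y p).
Proof. exact: lslice_central. Qed.

(** Relative weak compactness of the slices, from [WC]: the vector functionals converge pointwise to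
    some psi, and f (fslice psi X) = psi (rslice f X) identifies [fslice psi X] as the weak
    limit. *)
Let y_lim (V : set_system (H1 * H1)) : UltraFilter V ->
  exists z, central z /\ forall psi : dual (vn M2), ulim V (fun p => psi (y p)) = psi z.
Proof.
move=> VV.
have b p : `|vf M1 (cut p.1) (cut p.2)| <= 1.
  by rewrite (le_trans (norm_vf _ _ _))// mulr_ile1.
have [psi [psiE _]] := @ulim_dual _ _ _ V (fun p => vf M1 (cut p.1) (cut p.2)) _ VV
  ler01 (filterE _ b).
exists (fslice psi X); split; last first.
  move=> f; rewrite wX psiE; congr ulim; apply/funext => p.
  by rewrite vfE rsliceE.
apply: rslice_central => a c; apply: val_inj.
by have := congr1 (@vn_val _ _ _) (cX c a); rewrite -!vswap_vot.
Qed.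

(** If no finite set is an e-net, the sets of indices far from finitely many given ones generate a
    filter. Along an ultrafilter above it the slices have a weak limit x, and [riesz_product_null],
    applied to the two selfadjoint parts of k = y - x, gives phi (k^* k) -> 0. Two slices within e /
    2 of x then contradict the choice of the filter. *)
Let y_compact (e : R[i]) : 0 < e -> exists ps : seq (H1 * H1),
  forall p, exists2 q, List.In q ps & sn (y p - y q) <= e.
Proof.
move=> e0; apply: contrapT => /forallNP h.
pose B (l : seq (H1 * H1)) := [set p | forall q, List.In q l -> ~ sn (y p - y q) <= e].
have PF : ProperFilter (filter_from setT B).
  apply: filter_from_proper.
    apply: filter_fromT_filter; first by exists [::].
    move=> l l'; exists (l ++ l') => p pl.
    by split => q ql; apply: pl; apply/In_cat; [left | right].
  move=> l _; have /existsNP[p hp] := h l; exists p => q ql hq; apply: hp.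
  by exists q.
have [U [UU BU]] := ultraFilterLemma PF.
have [x [cx xP]] := y_lim UU.
(* Divided by [C], the selfadjoint elements k + k^* and i k - i k^* become contractions, as
   [riesz_product_null] requires. *)
pose C := 2 * (`|X| + `|x|) + 1.
have C0 : 0 < C by rewrite ltr_wpDl// mulr_ge0// addr_ge0.
have Cinv : C^-1^* = C^-1 by rewrite geC0_conj// invr_ge0 ltW.
pose k p := y p - x.
have ck p : central (k p) by apply: centralD => //; exact: centralN.
have k_le p : `|k p| <= `|X| + `|x|.
  by rewrite (le_trans (ler_normB _ _))// lerD2r.
have sk_le p : `|star (k p)| <= `|X| + `|x| by rewrite (le_trans (norm_star _)).
have k_weak (c d : R[i]) (V : set_system (H1 * H1)) : UltraFilter V ->
  exists z, (forall psi : dual (vn M2),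
    ulim V (fun p => psi (c *: k p + d *: star (k p))) = psi z) /\ (V = U -> z = 0).
  move=> VV; have [x' [_ x'P]] := y_lim VV.
  have ubk (psi : dual (vn M2)) : ubounded V (fun p => psi (k p)).
    exists (`|psi| * (`|X| + `|x|)); apply: filterE => p.
    by apply: (le_trans (dual_le _ _)); rewrite ler_wpM2l.
  have ubsk (psi : dual (vn M2)) : ubounded V (fun p => psi (star (k p))).
    exists (`|psi| * (`|X| + `|x|)); apply: filterE => p.
    by apply: (le_trans (dual_le _ _)); rewrite ler_wpM2l.
  have uby (psi : dual (vn M2)) : ubounded V (fun p => psi (y p)).
    exists (`|psi| * `|X|); apply: filterE => p.
    by apply: (le_trans (dual_le _ _)); rewrite ler_wpM2l.
  have ubc (a : R[i]) : ubounded V (fun=> a) by exists `|a|; apply: filterE => i /=; exact: lexx.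
  have limk (psi : dual (vn M2)) : ulim V (fun p => psi (k p)) = psi (x' - x).
    rewrite dualB -x'P -(ulim_cst VV (psi x)) -mulN1r -(ulimZ VV _ (ubc _)).
    rewrite -(ulimD VV (uby _) (uboundedZ VV _ (ubc _))).
    by congr ulim; apply/funext => p; rewrite dualB mulN1r.
  exists (c *: (x' - x) + d *: star (x' - x)); split.
    move=> psi; rewrite dualD !dualZ -limk.
    have -> : psi (star (x' - x)) = (dstar psi (x' - x))^* by rewrite dstarE conjCK.
    rewrite -limk -(ulim_conj VV (ubk _)).
    have -> : (fun p => (dstar psi (k p))^*) = fun p => psi (star (k p)).
      by apply/funext => p; rewrite dstarE conjCK.
    rewrite -(ulimZ VV _ (ubk _)) -(ulimZ VV _ (ubsk _)).
    rewrite -(ulimD VV (uboundedZ VV _ (ubk _)) (uboundedZ VV _ (ubsk _))).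
    by congr ulim; apply/funext => p; rewrite dualD !dualZ.
  move=> VU; have -> : x' = x; last by rewrite subrr star0 !scaler0 addr0.
  apply: vn_eq => u v; have := x'P (vf M2 u v); rewrite VU xP.
  by rewrite !vfE => <-.
have null (c d : R[i]) : d = c^* -> `|c| = C^-1 -> 
    ulim U (fun p => phi ((c *: k p + d *: star (k p)) * (c *: k p + d *: star (k p)))) = 0.
  move=> dE cE; apply: (riesz_product_null UU) => //.
  - move=> p; apply: centralD; apply: centralZ => //; exact: central_star.
  - by move=> p; rewrite starD !starZ starK dE conjCK addrC.
  - move=> p; rewrite (le_trans (ler_normD _ _))// !normrZ dE norm_conjC cE -mulrDr.
    rewrite mulrC ler_pdivrMr// mul1r (le_trans (lerD (k_le p) (sk_le p)))//.
    by rewrite -mulr2n -mulr_natl /C lerDl.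
  - by move=> V VV; have [z [zP _]] := k_weak c d V VV; exists z.
  - move=> psi; have [z [zP z0]] := k_weak c d U UU.
    by rewrite zP z0// dual0.
have Cp : 0 <= C^-1 by rewrite invr_ge0 ltW.
have n1 := null C^-1 C^-1 (esym Cinv) (ger0_norm Cp).
have n2 : ulim U (fun p => phi ((('i * C^-1) *: k p + (- 'i * C^-1) *: star (k p)) *
    (('i * C^-1) *: k p + (- 'i * C^-1) *: star (k p)))) = 0.
  apply: null; first by rewrite rmorphM/= conjCi Cinv.
  by rewrite normrM normCi mul1r ger0_norm.
have ubs (c d : R[i]) : ubounded U (fun p => phi ((c *: k p + d *: star (k p)) * (c *: k p + d *: star (k p)))).
  exists (`|phi| * ((`|c| * (`|X| + `|x|) + `|d| * (`|X| + `|x|)) * (`|c| * (`|X| + `|x|) + `|d| * (`|X| + `|x|)))).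
  apply: filterE => p; apply: (le_trans (dual_le _ _)); rewrite ler_wpM2l//.
  have h1 : `|c *: k p + d *: star (k p)| <= `|c| * (`|X| + `|x|) + `|d| * (`|X| + `|x|).
    by rewrite (le_trans (ler_normD _ _))// !normrZ lerD// ler_wpM2l.
  by rewrite (le_trans (norm_vnM _ _))// ler_pM.
have Ci : C^-1 != 0 by rewrite invr_eq0 gt_eqF.
have lim0 : ulim U (fun p => dform phi (k p) (k p)) = 0.
  (* As [k p] is central, 4 k^* k = (k^* + k)^2 - (k^* - k)^2; the sign is absorbed by the factor i
     of the second selfadjoint part. *)
  have E p : dform phi (k p) (k p) = (4^-1 * C ^+ 2) *
     (phi ((C^-1 *: k p + C^-1 *: star (k p)) * (C^-1 *: k p + C^-1 *: star (k p))) +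
      phi ((('i * C^-1) *: k p + (- 'i * C^-1) *: star (k p)) *
           (('i * C^-1) *: k p + (- 'i * C^-1) *: star (k p)))).
    rewrite !mulrDl !mulrDr !vn_scaleMl !vn_scaleMr !scalerA !dualD !dualZ.
    rewrite (central_star (ck p)) /dform (central_star (ck p)).
    have i2 : 'i * 'i = -1 :> R[i] by rewrite -expr2 sqrCi.
    move: 'i i2 (phi _) (phi _) (phi _) => j i2 a b c.
    apply/eqP; rewrite -subr_eq0; apply/eqP.
    transitivity (4^-1 * (j * j + 1) * (2 * c - a - b)).
      by field; rewrite gt_eqF.
    by rewrite i2 addNr mulr0 mul0r.
  have -> : (fun p => dform phi (k p) (k p)) = fun p => _ := funext E.
  rewrite (ulimZ UU); last by apply: uboundedD; exact: ubs.
  by rewrite (ulimD UU (ubs _ _) (ubs _ _)) n1 n2 addr0 mulr0.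
have ubk : ubounded U (fun p => dform phi (k p) (k p)).
  exists (`|phi| * ((`|X| + `|x|) * (`|X| + `|x|))); apply: filterE => p.
  apply: (le_trans (dual_le _ _)); rewrite ler_wpM2l//.
  by rewrite (le_trans (norm_vnM _ _))// ler_pM.
have e2 : 0 < e / 2 by rewrite divr_gt0.
have := ulim_near UU ubk (exprn_gt0 2 e2); rewrite lim0 => U1.
have snk p : `|dform phi (k p) (k p) - 0| <= (e / 2) ^+ 2 -> sn (k p) <= e / 2.
  rewrite subr0 ger0_norm// -(seminorm_sqr (dform phi)) ler_pXn2r ?nnegrE ?seminorm_ge0//.
  exact: ltW.
have [p0 p0P] := filter_ex U1.
have U2 : U (B [:: p0]) by apply: BU; exists [:: p0].
have [p [pP1 pP2]] := filter_ex (filterI U1 U2).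
apply: (pP2 p0); first by left.
have -> : y p - y p0 = k p + - k p0 by rewrite /k opprB addrA subrK.
rewrite (le_trans (seminormD fs f0 _ _))// seminormN// [leRHS]splitr.
by rewrite lerD// snk.
Qed.

(* Only finitely many directions of L^2(phi) matter for the slices of X. *)
Lemma lslice_finite_rank (e : R[i]) : 0 < e -> exists m (d : nat -> vn M2),
  [/\ orthon (dform phi) m d, forall i, central (d i) &
    forall x1 x2, sn (lslice X x1 x2 - oproj (dform phi) m d (lslice X x1 x2))
      <= e * `|x1| * `|x2|].
Proof.
move=> e0; have [ps psP] := y_compact e0.
have ycs x : List.In x [seq y p | p <- ps] -> central x.
  by elim: ps {psP} => //= p ps IH [<-//|/IH].
have cD a b c : central b -> central c -> central (a *: b + c : vn M2).
  by move=> cb cc; apply: centralD => //; exact: centralZ.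
have [m [d [od cd dP]]] := gram_schmidt fs f0 (@central0 _ _ M2) cD ycs.
exists m, d; split => // x1 x2.
have [->|x10] := eqVneq x1 0.
  have -> : lslice X 0 x2 = 0 by apply: vn_eq => u v; rewrite lsliceE tens0l linear0 vn0E !inner0l.
  have -> : oproj (dform phi) m d 0 = 0.
    by rewrite /oproj big1// => i _; rewrite (sesqui0l fs) scale0r.
  by rewrite subrr /sn /seminorm (sesqui0l fs) sqrtC0 normr0 mulr0 mul0r.
have [->|x20] := eqVneq x2 0.
  have -> : lslice X x1 0 = 0 by apply: vn_eq => u v; rewrite lsliceE tens0l vn0E inner0r inner0l.
  have -> : oproj (dform phi) m d 0 = 0.
    by rewrite /oproj big1// => i _; rewrite (sesqui0l fs) scale0r.
  by rewrite subrr /sn /seminorm (sesqui0l fs) sqrtC0 normr0 mulr0.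
pose p := (`|x1|^-1 *: x1, `|x2|^-1 *: x2).
have nx1 : `|x1| != 0 by rewrite normr_eq0.
have nx2 : `|x2| != 0 by rewrite normr_eq0.
have nrm (x : H1) : `|x| != 0 -> `| `|x|^-1 *: x| <= 1.
  by move=> xn; rewrite normrZ normfV normr_id mulVf.
have E : lslice X x1 x2 = (`|x1| * `|x2|) *: y p.
  rewrite /y /cut/= !nrm//; apply: vn_eq => u v.
  rewrite vnZE innerZl !lsliceE !tensZl linearZ innerZl innerZr.
  by rewrite geC0_conj ?invr_ge0//; field; rewrite nx1 nx2.
have oZ k z : oproj (dform phi) m d (k *: z) = k *: oproj (dform phi) m d z.
  rewrite -[k *: z]addr0 (oproj_linear fs).
  have -> : oproj (dform phi) m d 0 = 0.
    by rewrite /oproj big1// => i _; rewrite (sesqui0l fs) scale0r.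
  by rewrite addr0.
rewrite E oZ -scalerBr /sn seminormZ// ger0_norm ?mulr_ge0//.
rewrite -mulrA mulrC ler_wpM2r ?mulr_ge0//.
have [q qps hq] := psP p; apply: le_trans hq.
apply: oproj_best => //; apply: dP.
by elim: ps qps {psP ycs} => //= r ps IH [->|/IH]; [left | right].
Qed.

End FiniteRank.

(** * Approximation of central elements by elementary tensors *)

Section Approximation.
Variables (R : realType) (H1 H2 K : hilbertType R) (t : hilbert_tensor H1 H2 K).
Variables (M1 : vnalg H1) (M2 : vnalg H2).
Local Notation N := (vn_tensor t M1 M2).
Implicit Types (X Y Z : vn N) (phi : dual (vn M2)).

Definition sn phi := seminorm (dform phi).

(* The operator (x1, x2) |-> slice of X has norm at most e into L^2(phi). *)
Definition slice_small phi (e : R[i]) X : Prop :=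
  forall x1 x2, sn phi (lslice X x1 x2) <= e * `|x1| * `|x2|.

Lemma lsliceB X Y x1 x2 : lslice (X - Y) x1 x2 = lslice X x1 x2 - lslice Y x1 x2.
Proof. by rewrite -scaleN1r lsliceD lsliceZ scaleN1r. Qed.

Lemma lslice_sum (I : Type) (r : seq I) (F : I -> vn N) x1 x2 :
  lslice (\sum_(i <- r) F i) x1 x2 = \sum_(i <- r) lslice (F i) x1 x2.
Proof.
elim/big_rec2: _ => [|i y f _ <-]; last exact: lsliceD.
by apply: vn_eq => u v; rewrite lsliceE !vn0E !inner0l.
Qed.

(** The sum is X with its second leg projected in L^2(phi) onto the span of the d_i: the coefficient
    of d_i is the slice of X by phi (d_i^* .). *)
Lemma finite_rank_approx X phi (e : R[i]) : WC X -> ncentral X -> dpos phi -> 0 < e ->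
  exists s, ncentral (tsum t s) /\ slice_small phi e (X - tsum t s).
Proof.
move=> wX cX pp e0; have [m [d [od cd dP]]] := lslice_finite_rank wX cX pp e0.
pose a i := rslice (dmul (star (d i)) phi 1) X.
pose s := [seq (a i, d i) | i <- iota 0 m].
exists s; split.
  apply: ncentral_tsum => p; rewrite /s; elim: (iota 0 m) => //= i r IH [<-|/IH//].
  by split; [apply: rslice_central | apply: cd].
move=> x1 x2; have := dP x1 x2; congr (seminorm _ _ <= _).
rewrite lsliceB; congr (_ - _); rewrite /tsum lslice_sum big_map.
rewrite /oproj -(big_mkord xpredT (fun i => dform phi (lslice X x1 x2) (d i) *: d i)).
rewrite /index_iota subn0; apply: eq_bigr => i _.
by rewrite lslice_elem rsliceE dmulE mulr1.
Qed.

(** A combination of the coefficients pairs the slices of X with D = sum conj (g_i) d_i, whose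
    length in L^2(phi) is the l^2-norm of g. Thus [slice_small] supplies the hypothesis of
    [sum_sqr_le]. *)
Lemma slice_small_rslice X phi (e : R[i]) m (d : nat -> vn M2) : dpos phi -> 0 <= e ->
  ncentral X -> slice_small phi e X -> orthon (dform phi) m d ->
  forall x, \sum_(i < m) `|rslice (dmul (star (d i)) phi 1) X x| ^+ 2 <= e ^+ 2 * `|x| ^+ 2.
Proof.
move=> pp e0 cX sX od.
apply: (@sum_sqr_le _ _ M1 m (fun i : 'I_m => rslice (dmul (star (d i)) phi 1) X)) => //.
  by move=> i; exact: rslice_central.
move=> g; set G := \sum_i `|g i| ^+ 2.
have G0 : 0 <= G by apply: sumr_ge0 => i _; exact: exprn_ge0.
have fs := dform_sesqui phi; have f0 := dform_ge0 pp.
pose D := \sum_(i < m) (g i)^* *: d i.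
have DG : dform phi D D = G.
  rewrite /D (sesqui_suml fs); apply: eq_bigr => i _.
  rewrite (sesquiZl fs) (sesqui_sumr fs) (bigD1 i)//= big1 ?addr0.
    by rewrite (sesquiZr fs) od// eqxx mulr1 conjCK -normCKC.
  move=> j ji; rewrite (sesquiZr fs) od//.
  by rewrite (negPf (_ : (i : nat) != j)) ?mulr0// eq_sym.
have nD : sn phi D = sqrtC G by rewrite /sn /seminorm DG.
have sG : 0 <= sqrtC G by rewrite sqrtC_ge0.
suff h : `|\sum_i g i *: rslice (dmul (star (d i)) phi 1) X| <= e * sqrtC G.
  rewrite -[G in leRHS]sqrtCK -exprMn ler_pXn2r// nnegrE//.
  exact: mulr_ge0.
apply: vn_norm_le => [|x1 x2]; first exact: mulr_ge0.
have -> : inner ((\sum_i g i *: rslice (dmul (star (d i)) phi 1) X) x1) x2 =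
    dform phi (lslice X x1 x2) D.
  rewrite vn_sumE (sesqui_suml (inner_sesqui _)) /D (sesqui_sumr fs).
  apply: eq_bigr => i _.
  by rewrite vnZE innerZl rsliceE dmulE mulr1 (sesquiZr fs) conjCK.
rewrite (le_trans (semi_csn fs f0 _ _))// -/(sn phi D) nD mulrC -/(sn phi _).
rewrite (le_trans (ler_wpM2l sG (sX _ _)))//.
by rewrite le_eqVlt; apply/orP; left; apply/eqP; ring.
Qed.

(** The pairing sees only the span of the second legs of [s] in L^2(phi). In an orthonormal basis of
    it both sides are finite sums of inner products in [H1], and Cauchy--Schwarz leaves the column
    sum bounded by [slice_small_rslice]. *)
Lemma elementary_pairing X phi (e : R[i]) s x : dpos phi -> 0 <= e ->
  ncentral X -> slice_small phi e X ->
  `|phi (lslice (star (tsum t s) * X) x x) : R[i]| ^+ 2 <=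
    (e * `|x|) ^+ 2 * phi (lslice (star (tsum t s) * tsum t s) x x).
Proof.
move=> pp e0 cX sX; have fs := dform_sesqui phi; have f0 := dform_ge0 pp.
have [m [d [od _ dP]]] := gram_schmidt fs f0 (P := fun=> True) (xs := [seq p.2 | p <- s])
  I (fun _ _ _ _ _ => I) (fun _ _ => I).
have sP p : List.In p s -> dform phi (p.2 - oproj (dform phi) m d p.2) (p.2 - oproj (dform phi) m d p.2) = 0.
  by move=> ps; apply: dP; elim: s ps => //= q s IH [->|/IH]; [left | right].
pose y i := rslice (dmul (star (d i)) phi 1) X.
pose D i := \sum_(p <- s) dform phi p.2 (d i) *: p.1 x.
have inP a p : List.In p s -> dform phi a p.2 =
    \sum_(i < m) (dform phi p.2 (d i))^* * dform phi a (d i).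
  move=> /sP p0; rewrite -[p.2 in LHS](subrK (oproj (dform phi) m d p.2)) (sesquiDr fs).
  rewrite (semi_null_r fs f0 _ p0) add0r /oproj (sesqui_sumr fs).
  by apply: eq_bigr => i _; rewrite (sesquiZr fs).
have starE' : star (tsum t s) = \sum_(p <- s) vot t (star p.1) (star p.2).
  by rewrite tsum_star /tsum big_map.
have sumIn (F G : vn M1 * vn M2 -> R[i]) : (forall p, List.In p s -> F p = G p) ->
    \sum_(p <- s) F p = \sum_(p <- s) G p.
  elim: (s) => [|p r IH] h; rewrite ?big_nil// !big_cons h; last by left.
  by rewrite IH// => q qr; apply: h; right.
have E1 : phi (lslice (star (tsum t s) * X) x x) = \sum_(i < m) inner (y i x) (D i).
  rewrite starE' mulr_suml lslice_sum dual_sum.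
  under [RHS]eq_bigr => i _ do rewrite /D (sesqui_sumr (inner_sesqui _)).
  rewrite exchange_big/=; apply: sumIn => p ps.
  have -> : vot t (star p.1) (star p.2) * X = vot t (star p.1) (star p.2) * X * vot t 1 1.
    by rewrite vot1 mulr1.
  rewrite lslice_vot mulr1 starK -/(dform phi _ p.2) (inP _ _ ps).
  by apply: eq_bigr => i _; rewrite innerZr rsliceE dmulE mulr1.
have E2 : phi (lslice (star (tsum t s) * tsum t s) x x) = \sum_(i < m) inner (D i) (D i).
  rewrite starE' /tsum mulr_suml lslice_sum dual_sum.
  under [RHS]eq_bigr => i _ do rewrite {2}/D (sesqui_sumr (inner_sesqui _)).
  rewrite exchange_big/=; apply: sumIn => p ps.
  rewrite mulr_sumr lslice_sum dual_sum.
  under [RHS]eq_bigr => i _ do rewrite /D (sesqui_suml (inner_sesqui _)).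
  rewrite exchange_big/=; apply: eq_bigr => q _.
  rewrite votM lslice_elem dualZ vnME starE -/(dform phi q.2 p.2) (inP _ _ ps) mulr_sumr.
  apply: eq_bigr => i _; rewrite innerZl innerZr; ring.
rewrite E1 E2 (le_trans (semi_cs_sum _ _ (inner_sesqui _) (@inner_ge0 _ _)))//.
rewrite exprMn ler_wpM2r//; first by apply: sumr_ge0 => i _; exact: inner_ge0.
under eq_bigr => i _ do rewrite inner_norm.
exact: slice_small_rslice.
Qed.

(** For a vector state [tsum_dense] provides a sum whose value at [t x y] is close to that of X;
    pairing X with it by [elementary_pairing] and absorbing the error bounds |X (t x y)|. *)
Lemma normal_small X y (e : R[i]) : 0 <= e -> ncentral X -> slice_small (vf M2 y y) e X ->
  forall x, `|X (t x y)| <= e * `|x|.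
Proof.
move=> e0 cX sX x; apply: quad_absorb => [||d d0]; rewrite ?mulr_ge0//.
have [s hs] := tsum_dense X (t x y) d0; set w := tsum t s (t x y) in hs.
have h1 : `|inner (X (t x y)) w| <= e * `|x| * `|w|.
  rewrite -(@ler_pXn2r _ 2)// ?nnegrE ?mulr_ge0// exprMn.
  have := elementary_pairing s x (@dpos_vf _ _ M2 y) e0 cX sX.
  by rewrite !vfE !lsliceE !vnME !starE -/w inner_norm.
have hw : `|w| <= `|X (t x y)| + d.
  rewrite -[w](subKr (X (t x y))) (le_trans (ler_normB _ _))// lerD2l.
  exact: ltW.
have h2 : `|inner (X (t x y)) (X (t x y) - w)| <= `|X (t x y)| * d.
  by rewrite (le_trans (cauchy_schwarz _ _))// ler_wpM2l// ltW.
have -> : `|X (t x y)| ^+ 2 = `|inner (X (t x y)) w + inner (X (t x y)) (X (t x y) - w)|.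
  by rewrite -innerDr addrC subrK ger0_norm ?inner_ge0// inner_norm.
rewrite (le_trans (ler_normD _ _))// lerD// (le_trans h1)// ler_wpM2l//.
exact: mulr_ge0.
Qed.

Lemma normal_approx X y (e : R[i]) : WC X -> ncentral X -> 0 < e ->
  exists s, ncentral (tsum t s) /\ forall x, `|(X - tsum t s) (t x y)| <= e * `|x|.
Proof.
move=> wX cX e0.
have [s [cs ss]] := finite_rank_approx wX cX (@dpos_vf _ _ M2 y) e0.
exists s; split => //; apply: normal_small => //; first exact: ltW.
exact: ncentralB.
Qed.

End Approximation.

Section SwapWC.
Variables (R : realType) (H1 H2 K : hilbertType R) (t : hilbert_tensor H1 H2 K).
Variables (M1 : vnalg H1) (M2 : vnalg H2).
Local Notation N := (vn_tensor t M1 M2).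
Implicit Types (X Y Z : vn N) (phi : dual (vn M2)).

Lemma fslice_vswap psi X : fslice psi (vswap X) = rslice psi X.
Proof.
by apply: vn_eq => x1 x2; rewrite fsliceE rsliceE.
Qed.

Lemma WC_vswap X : WC X -> WC (vswap X).
Proof. by move=> wX psi phi; rewrite fslice_vswap -(wX phi psi). Qed.

Lemma ncentral_vswap X : ncentral X -> ncentral (vswap X).
Proof.
move=> cX a b; apply: val_inj.
by have := congr1 (@vn_val _ _ _) (cX b a); rewrite -!vswap_vot.
Qed.

Lemma vswap_tsum s : vswap (tsum t s : vn N) = tsum (tswap t) [seq (p.2, p.1) | p <- s].
Proof.
rewrite /tsum big_map; elim: s => [|p s IH]; first by rewrite !big_nil; exact: val_inj.
by rewrite !big_cons vswapD IH vswap_vot.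
Qed.

(** [normal_approx] with the legs exchanged: the vector in the first leg is fixed and the bound is
    uniform in the second, so it can be used under every positive functional on [M2], normal or
    not. *)
Lemma normal_approx_left X x (e : R[i]) : WC X -> ncentral X -> 0 < e ->
  exists s, forall y, `|(X - tsum t s) (t x y)| <= e * `|y|.
Proof.
move=> wX cX e0; have [s [_ hs]] := normal_approx x (WC_vswap wX) (ncentral_vswap cX) e0.
exists [seq (p.2, p.1) | p <- s] => y; apply: le_trans (hs y).
have -> : tsum (tswap t) s = vswap (tsum t [seq (p.2, p.1) | p <- s]).
  rewrite vswap_tsum -map_comp; congr tsum.
  by rewrite -[LHS]map_id; apply: eq_map => -[].
by [].
Qed.

(* The semi-inner product that omega_x (x) phi defines on M1 (x) M2. *)
Definition tform phi (x : H1) X Y : R[i] := phi (lslice (star Y * X) x x).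

Lemma tform_sesqui phi x : sesqui (tform phi x).
Proof.
split=> k A B C; rewrite /tform.
  by rewrite mulrDr vn_scaleMr lsliceD lsliceZ dualD dualZ.
by rewrite starD starZ mulrDl vn_scaleMl lsliceD lsliceZ dualD dualZ.
Qed.

Lemma tform_ge0 phi x : dpos phi -> forall X, 0 <= tform phi x X X.
Proof. by move=> pp X; exact/pp/lslice_pos. Qed.

(** As phi need not be normal, X is compared with a sum Z that is close to it at [x] uniformly in
    the second leg: the slice of |X - Z|^2 at [x] is then at most k^2 as an operator, and phi may be
    applied. The rest follows [normal_small], in the seminorm of [tform]. *)
Lemma state_small X phi (e : R[i]) x : dpos phi -> 0 <= e -> WC X -> ncentral X ->
  slice_small phi e X -> phi (lslice (star X * X) x x) <= (e * `|x|) ^+ 2 :> R[i].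
Proof.
move=> pp e0 wX cX sX; have fs := tform_sesqui phi x; have f0 := tform_ge0 x pp.
rewrite -[leLHS](seminorm_sqr (tform phi x)) ler_pXn2r// ?nnegrE ?mulr_ge0 ?seminorm_ge0//.
apply: quad_absorb => [||d d0]; rewrite ?mulr_ge0 ?seminorm_ge0//.
have p1 : 0 <= (phi 1 : R[i]) := dpos1_ge0 pp.
have c0 : 0 < sqrtC (phi 1) + 1 :> R[i] by rewrite ltr_wpDl// sqrtC_ge0.
have [k [k0 kd]] : exists k : R[i], 0 < k /\ k * sqrtC (phi 1) <= d.
  exists (d / (sqrtC (phi 1) + 1)); split; first by rewrite divr_gt0.
  by rewrite mulrAC ler_pdivrMr// ler_wpM2l ?lerDl// ltW.
have [s hs] := normal_approx_left x wX cX k0; set Z := tsum t s in hs.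
set nX := seminorm _ X.
have nXZ : seminorm (tform phi x) (X - Z) <= d.
  apply: le_trans kd.
  rewrite -(@ler_pXn2r _ 2)// ?nnegrE ?mulr_ge0 ?seminorm_ge0 ?sqrtC_ge0 ?(ltW k0)//.
  rewrite seminorm_sqr exprMn sqrtCK /tform -subr_ge0 -dualZ -dualB.
  apply: pp => y; rewrite vnBE vnZE vn1E innerBl innerZl lsliceE vnME starE !inner_norm subr_ge0.
  by rewrite -exprMn ler_pXn2r// ?nnegrE ?mulr_ge0// ltW.
have nZ : seminorm (tform phi x) Z <= nX + d.
  have -> : Z = X + - (X - Z) by rewrite opprB addrC subrK.
  by rewrite (le_trans (seminormD fs f0 _ _))// seminormN// lerD2l.
have h1 : `|tform phi x X Z| <= e * `|x| * seminorm (tform phi x) Z.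
  rewrite -(@ler_pXn2r _ 2)// ?nnegrE ?mulr_ge0 ?seminorm_ge0// [leRHS]exprMn.
  by rewrite seminorm_sqr; exact: elementary_pairing.
have h2 : `|tform phi x X (X - Z)| <= nX * d.
  by rewrite (le_trans (semi_csn fs f0 _ _))// ler_wpM2l// seminorm_ge0.
have -> : nX ^+ 2 = `|tform phi x X Z + tform phi x X (X - Z)|.
  by rewrite -(sesquiDr fs) [Z + _]addrC subrK ger0_norm// seminorm_sqr.
rewrite (le_trans (ler_normD _ _))// lerD// (le_trans h1)// ler_wpM2l//.
exact: mulr_ge0.
Qed.

(** With D = X - Z, every term of E = X^* X - D^* D contains Z or Z^*, so E satisfies [WC] and drops
    out of the comparison. Of the two slices of D^* D the left one is small by [state_small], while
    the right one is only known to be nonnegative: hence an inequality. *)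
Lemma WC_square_le X psi phi : WC X -> ncentral X -> dpos psi -> dpos phi ->
  psi (rslice phi (star X * X)) <= phi (fslice psi (star X * X)) :> R[i].
Proof.
move=> wX cX ps pp; rewrite -subr_ge0; apply: ge0_all_eps => e e0.
have p1 : 0 <= (psi 1 : R[i]) := dpos1_ge0 ps.
have c0 : 0 < psi 1 + 1 :> R[i] by rewrite ltr_wpDl.
(* Chosen so that k^2 psi (1) is at most e. *)
pose k := sqrtC (e / (psi 1 + 1)).
have k0 : 0 < k by rewrite sqrtC_gt0 divr_gt0.
have [s [cs ss]] := finite_rank_approx wX cX pp k0; set Z := tsum t s in cs ss.
pose D := X - Z.
have wD : WC D by apply: WCD => //; apply: WCN; exact: WC_tsum.
have cD : ncentral D by exact: ncentralB.
pose E := star X * X - star D * D.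
have wE : WC E.
  have -> : E = star X * Z + star Z * X - star Z * Z.
    have E4 (p q r u : vn N) : p - (p - q - (r - u)) = q + r - u.
      by rewrite opprB [in X in _ + X]opprB addrC -addrA subrK addrC addrA.
    by rewrite /E /D starB mulrBl !mulrBr E4.
  apply: WCD; first apply: WCD.
  - by apply: WC_tsum_mulr; exact: WC_star.
  - by rewrite tsum_star; exact: WC_tsum_mull.
  - by apply: WCN; rewrite tsum_star; apply/WC_tsum_mull/WC_tsum.
have XE : star X * X = E + star D * D by rewrite subrK.
exists (phi (fslice psi (star D * D))).
  by apply: pp; rewrite /fslice vswapM vswap_star; exact: rslice_pos.
have -> : phi (fslice psi (star X * X)) - psi (rslice phi (star X * X)) -
    phi (fslice psi (star D * D)) = - psi (rslice phi (star D * D)).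
  have e1 : phi (fslice psi (star X * X)) =
      phi (fslice psi E) + phi (fslice psi (star D * D)).
    by rewrite XE /fslice vswapD rsliceD dualD.
  by rewrite e1 XE rsliceD dualD wE; ring.
rewrite normrN ger0_norm; last by apply/ps/rslice_pos.
apply: (@le_trans _ _ (psi ((k ^+ 2) *: (1 : vn M1)))); last first.
  by rewrite dualZ sqrtCK mulrAC ler_pdivrMr// ler_wpM2l ?lerDl// ltW.
  rewrite -subr_ge0 -dualB; apply: ps => x.
  rewrite vnBE vnZE vn1E innerBl innerZl rsliceE inner_norm subr_ge0 -exprMn.
  by apply: state_small => //; exact: ltW.
Qed.

End SwapWC.

(** * Squares and products of central elements *)

Section Squares.
Variables (R : realType) (H1 H2 K : hilbertType R) (t : hilbert_tensor H1 H2 K).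
Variables (M1 : vnalg H1) (M2 : vnalg H2).
Local Notation N := (vn_tensor t M1 M2).
Implicit Types (X Y Z : vn N).

Lemma WC_pos X : (forall psi phi, dpos psi -> dpos phi ->
  phi (fslice psi X) = psi (rslice phi X)) -> WC X.
Proof.
move=> h psi phi.
have [ps [pps ->]] := dpos_decomposition psi.
have [ph [pph ->]] := dpos_decomposition phi.
have fsum (c : 'I_4 -> R[i]) (f : 'I_4 -> dual (vn M1)) :
    fslice (\sum_k c k *: f k) X = \sum_k c k *: fslice (f k) X.
  apply: vn_eq => u v; rewrite fsliceE dual_sumE vn_sumE (sesqui_suml (inner_sesqui _)).
  by apply: eq_bigr => k _; rewrite dual_scaleE vnZE innerZl fsliceE.
have rsum (c : 'I_4 -> R[i]) (f : 'I_4 -> dual (vn M2)) :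
    rslice (\sum_k c k *: f k) X = \sum_k c k *: rslice (f k) X.
  apply: vn_eq => u v; rewrite rsliceE dual_sumE vn_sumE (sesqui_suml (inner_sesqui _)).
  by apply: eq_bigr => k _; rewrite dual_scaleE vnZE innerZl rsliceE.
rewrite fsum rsum !dual_sum.
under eq_bigr => i _ do rewrite dualZ dual_sumE mulr_sumr.
under [RHS]eq_bigr => i _ do rewrite dualZ dual_sumE mulr_sumr.
rewrite [RHS]exchange_big/=; apply: eq_bigr => i _; apply: eq_bigr => j _.
  transitivity ((4^-1 * 'i ^+ i) * ((4^-1 * 'i ^+ j) * (ph j (fslice (ps i) X) : R[i]))).
  by [].
by rewrite h// mulrCA.
Qed.

Lemma WC_square X : WC X -> ncentral X -> WC (star X * X).
Proof.
move=> wX cX; apply: WC_pos => psi phi ps pp; apply/eqP; rewrite eq_le.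
apply/andP; split; last exact: WC_square_le.
have := WC_square_le (WC_vswap wX) (ncentral_vswap cX) pp ps.
by rewrite -vswap_star -vswapM fslice_vswap.
Qed.

Lemma polarC (V : lmodType R[i]) (b c : V) :
  c = 2^-1 *: ((1 *: b + 1^* *: c) + 'i *: ('i *: b + 'i^* *: c)).
Proof.
have i2 : 'i * 'i = -1 :> R[i] by rewrite -expr2 sqrCi.
have E : 'i *: ('i *: b + - 'i *: c) = c - b.
  by rewrite scalerDr !scalerA mulrN i2 opprK scale1r scaleN1r addrC.
rewrite conjCi conjC1 !scale1r E addrC addrA subrK -mulr2n -[c *+ 2]scaler_nat scalerA mulVf ?scale1r//.
by rewrite pnatr_eq0.
Qed.

(** The square of X + w Y gives w X^* Y + conj (w) Y^* X for each scalar w; the choices w = 1 and w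
    = i isolate Y^* X ([polarC]). *)
Lemma WC_central_mul X Y : WC X -> WC Y -> ncentral X -> ncentral Y -> WC (star Y * X).
Proof.
move=> wX wY cX cY.
have wk (w : R[i]) : WC (w *: (star X * Y) + w^* *: (star Y * X)).
  have -> : w *: (star X * Y) + w^* *: (star Y * X) =
    star (X + w *: Y) * (X + w *: Y) + (-1) *: (star X * X) + (- (w^* * w)) *: (star Y * Y).
    rewrite starD starZ mulrDl 2!mulrDr !vn_scaleMl !vn_scaleMr. rewrite scalerA.
    rewrite scaleN1r scaleNr.
    move: (star X * X) (_ *: (star X * Y)) (_ *: (star Y * X)) (_ *: (star Y * Y)) => a b c d.
    by rewrite addrAC addrA addrK -[a + b + c]addrA [a + _]addrC addrK.
  apply: WCD; first apply: WCD.
  - by apply: WC_square; [apply: WCD => //; exact: WCZ | apply: ncentralD => //; exact: ncentralZ].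
  - by apply: WCZ; exact: WC_square.
  - by apply: WCZ; exact: WC_square.
rewrite (polarC (star X * Y) (star Y * X)).
by apply: WCZ; apply: WCD; [exact: wk | apply: WCZ; exact: wk].
Qed.

End Squares.

(** * Reduction to central elements *)

Section CentralDecomposition.
Variables (R : realType) (H : hilbertType R) (M : vnalg H).

(** With the matrix units of a block, sum_r e_(ru) x e_(vr) is the entry x_(uv) on the diagonal of
    that block, hence central, and x is the sum of these times e_(uv). The entries are extracted by
    two-sided multiplications alone, which [WC] survives. *)
Lemma subhomogeneous_decomp : subhomogeneous M ->
  exists (I : finType) (a : I -> seq (vn M * vn M)) (e : I -> vn M), forall x,
    (forall i, central (\sum_(q <- a i) q.1 * x * q.2)) /\
    x = \sum_i (\sum_(q <- a i) q.1 * x * q.2) * e i.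
Proof.
move=> [k [n [K [A [phi [n0 Acomm [g gK Kg] phiP]]]]]].
have phiD i (a b : vn M) : phi i (a + b) = phi i a + phi i b.
  by have [+ _ _ _] := phiP i; exact.
have phiM i (a b : vn M) : phi i (a * b) = phi i a *m phi i b.
  by have [_ _ + _] := phiP i; exact.
have phi0 i : phi i 0 = 0.
  by apply: (@addrI _ (phi i 0)); rewrite -phiD !addr0.
have phis i (J : Type) (s : seq J) (F : J -> vn M) :
    phi i (\sum_(j <- s) F j) = \sum_(j <- s) phi i (F j).
  by elim: s => [|j s IH]; rewrite ?big_nil// !big_cons phiD IH.
have phiE a b : (forall i, phi i a = phi i b) -> a = b.
  move=> ab; rewrite -[a]gK -[b]gK; congr g.
  by apply: functional_extensionality_dep => i; exact: ab.
(* The indices are plain naturals because the blocks have different sizes. *)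
pose E i (p q : nat) j : 'M[vn (A j)]_(n j) :=
  \matrix_(u, v) (if [&& j == i, u == p :> nat & v == q :> nat] then 1 else 0).
pose e i (p q : nat) : vn M := g (E i p q).
have pe i p q j : phi j (e i p q) = E i p q j.
  by have := Kg (E i p q) => /(congr1 (fun f => f j)).
pose J : finType := {i : 'I_k & 'I_(n i) * 'I_(n i)}%type.
pose a (p : J) : seq (vn M * vn M) :=
  [seq (e (tag p) r (tagged p).1, e (tag p) (tagged p).2 r) | r : 'I_(n (tag p))].
exists J, a, (fun p : J => e (tag p) (tagged p).1 (tagged p).2) => x.
have Ei (i : 'I_k) (p q : 'I_(n i)) : E i p q i = delta_mx p q.
  by apply/matrixP => u v; rewrite !mxE eqxx/= !val_eqE; case: ifP.
have E0 i p q j : j != i -> E i p q j = 0.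
  by move=> ji; apply/matrixP => u v; rewrite !mxE (negbTE ji).
pose T p : vn M := \sum_(q <- a p) q.1 * x * q.2.
have PT1 p : phi (tag p) (T p) = (phi (tag p) x (tagged p).1 (tagged p).2)%:M.
  case: p => i [u v] /=; rewrite /T phis big_map big_enum/=.
  apply/matrixP => u' v'; rewrite summxE.
  rewrite (eq_bigr (fun r => if (u' == r) && (v' == r) then phi i x u v else 0)).
    rewrite (bigD1 u')//= eqxx/= big1 ?addr0 => [|r].
      by rewrite mxE eq_sym; case: eqP.
    by rewrite eq_sym => /negbTE ->.
  move=> r _; rewrite !phiM !pe !Ei mxE (bigD1 v)//= big1 ?addr0.
    rewrite !mxE (bigD1 u)//= big1 ?addr0; last first.
      by move=> s su; rewrite !mxE (negbTE su) andbF mul0r.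
    by rewrite !mxE !eqxx andbT/=; case: eqP; rewrite ?mul0r ?mul1r//; case: eqP; rewrite ?mulr0 ?mulr1.
  by move=> s sv; rewrite [delta_mx _ _ _ _]mxE (negbTE sv) mulr0.
have PT0 p j : j != tag p -> phi j (T p) = 0.
  move=> jp; rewrite /T phis big_map big_enum/= big1// => r _.
  by rewrite !phiM !pe E0// !mul0mx.
split.
  move=> p y; apply: phiE => j; rewrite !phiM -/(T p).
  have [->|jp] := eqVneq j (tag p); last by rewrite PT0// mul0mx mulmx0.
  rewrite PT1; apply/matrixP => u v; rewrite !mxE (bigD1 u)//= big1 ?addr0; last first.
    by move=> r ru; rewrite !mxE eq_sym (negbTE ru) mulr0n mul0r.
  rewrite (bigD1 v)//= big1 ?addr0; last first.
    by move=> r ru; rewrite !mxE (negbTE ru) mulr0n mulr0.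
  by rewrite !mxE !eqxx !mulr1n Acomm.
apply: phiE => j; rewrite phis.
pose F i (w : 'I_(n i) * 'I_(n i)) : 'M_(n j) :=
  phi j (T (existT (fun i => ('I_(n i) * 'I_(n i))%type) i w)) *m E i w.1 w.2 j.
transitivity (\sum_(p : J) F (tag p) (tagged p)); last first.
  by apply: eq_bigr => [[i w]] _; rewrite phiM pe.
rewrite -(sig_big_dep xpredT (fun _ => xpredT) F)/= /F.
rewrite (bigD1 j)//= [X in _ + X]big1 ?addr0; last first.
  by move=> i ij; rewrite big1// => w _; rewrite E0 ?mulmx0// eq_sym.
rewrite [LHS]matrix_sum_delta pair_big/=; apply: eq_bigr => [[u v] _] /=.
by rewrite Ei (PT1 (existT _ j (u, v)))/= mul_scalar_mx.
Qed.

End CentralDecomposition.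

Section Products.
Variables (R : realType) (H1 H2 K : hilbertType R) (t : hilbert_tensor H1 H2 K).
Variables (M1 : vnalg H1) (M2 : vnalg H2).
Local Notation N := (vn_tensor t M1 M2).
Implicit Types (X Y : vn N).

Lemma vn_lslice_eq X Y : (forall x1 x2, lslice X x1 x2 = lslice Y x1 x2) -> X = Y.
Proof.
move=> XY; apply: vn_tens_eq => x y; apply/eqP; rewrite -subr_eq0; apply/eqP.
apply: (@tens_total _ _ _ _ t) => u v.
by rewrite innerC innerBl -!lsliceE XY subrr conjC0.
Qed.

Lemma central_lslice_comm X : (forall x1 x2, central (lslice X x1 x2)) ->
  forall b, vot t 1 b * X = X * vot t 1 b.
Proof.
move=> cX b; apply: vn_lslice_eq => x1 x2.
have := lslice_vot 1 b 1 1 X x1 x2; rewrite vot1 !mulr1 star1 => ->.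
have := lslice_vot 1 1 1 b X x1 x2; rewrite vot1 !mul1r star1 => ->.
by rewrite [RHS]cX.
Qed.

Section LeftDecomposition.
Variables (I : finType) (a : I -> seq (vn M2 * vn M2)) (e : I -> vn M2).
Hypothesis aP : forall x, (forall i, central (\sum_(q <- a i) q.1 * x * q.2)) /\
    x = \sum_i (\sum_(q <- a i) q.1 * x * q.2) * e i.

Let T i X := \sum_(q <- a i) vot t 1 q.1 * X * vot t 1 q.2.

Lemma lslice_T i X x1 x2 : lslice (T i X) x1 x2 = \sum_(q <- a i) q.1 * lslice X x1 x2 * q.2.
Proof. by rewrite lslice_sum; apply: eq_bigr => q _; rewrite lslice_vot star1. Qed.

Lemma right_decomp X : exists F : I -> vn N,
  [/\ (forall i b, vot t 1 b * F i = F i * vot t 1 b),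
      X = \sum_i F i * vot t 1 (e i),
      (WC X -> forall i, WC (F i)) &
      forall b, vot t b 1 * X = X * vot t b 1 -> forall i, vot t b 1 * F i = F i * vot t b 1].
Proof.
exists (fun i => T i X); split.
- by move=> i b; apply: central_lslice_comm => x1 x2; rewrite lslice_T; exact: (aP _).1.
- apply: vn_lslice_eq => x1 x2; rewrite lslice_sum [LHS](aP _).2; apply: eq_bigr => i _.
  have := lslice_vot 1 1 1 (e i) (T i X) x1 x2; rewrite vot1 !mul1r star1 => ->.
  by rewrite lslice_T.
- by move=> wX i; apply: WC_sum => q; exact: WC_vot.
- move=> b bX i; rewrite mulr_sumr mulr_suml; apply: eq_bigr => q _.
  have c1 y : vot t b 1 * vot t 1 y = vot t 1 y * vot t b 1 :> vn N by rewrite !votM !mul1r !mulr1.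
  by rewrite !mulrA c1 -[_ * vot t b 1 * X]mulrA bX -!mulrA c1.
Qed.

End LeftDecomposition.

Lemma vswap_ex (Y : vn (vn_tensor (tswap t) M2 M1)) : exists X, Y = vswap X.
Proof.
have YP : vn_val Y \in vn_pred N by apply/asboolP; rewrite -vn_set_swap; exact: vnP.
by exists (Vn YP); apply: val_inj.
Qed.

Lemma WC_vswap_inv X : WC (vswap X) -> WC X.
Proof. by move=> wX psi phi; rewrite -[rslice phi X]fslice_vswap wX. Qed.

Lemma vswap_sum (J : Type) (s : seq J) (F : J -> vn N) :
  vswap (\sum_(j <- s) F j) = \sum_(j <- s) vswap (F j).
Proof.
elim: s => [|j s IH]; last by rewrite !big_cons vswapD IH.
by rewrite !big_nil; exact: val_inj.
Qed.

Lemma vswap_inj X Y : vswap X = vswap Y -> X = Y.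
Proof. by move=> /(congr1 (@vn_val _ _ _)) XY; exact: val_inj. Qed.

End Products.

Section MatrixReduction.
Variables (R : realType) (H1 H2 K : hilbertType R) (t : hilbert_tensor H1 H2 K).
Variables (M1 : vnalg H1) (M2 : vnalg H2).
Local Notation N := (vn_tensor t M1 M2).
Implicit Types (X Y : vn N).
Hypotheses (sM1 : subhomogeneous M1) (sM2 : subhomogeneous M2).

Lemma central_decomp X : WC X -> exists (J : finType) (F : J -> vn N) (u : J -> vn M1) (v : J -> vn M2),
  [/\ (forall j, WC (F j)), (forall j, ncentral (F j)) & X = \sum_j F j * vot t (u j) (v j)].
Proof.
move=> wX; have [I2 [a2 [e2 aP2]]] := subhomogeneous_decomp sM2.
have [I1 [a1 [e1 aP1]]] := subhomogeneous_decomp sM1.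
have [F [Fc XF /(_ wX) wF _]] := right_decomp aP2 X.
have : forall i, exists G : I1 -> vn N, [/\ (forall j, WC (G j)), (forall j, ncentral (G j)) &
    F i = \sum_j G j * vot t (e1 j) 1].
  move=> i; have [G [Gc FG wG G2]] := right_decomp aP1 (vswap (F i)).
  have {}wG := wG (WC_vswap (wF i)).
  have [G' GE] : exists G', forall j, G j = vswap (G' j).
    by have [G' GE] := choice (fun j => vswap_ex (G j)); exists G'.
  have c1 j a : vot t a 1 * G' j = G' j * vot t a 1.
    by apply: vswap_inj; rewrite !vswapM vswap_vot -GE.
  have c2 j b : vot t 1 b * G' j = G' j * vot t 1 b.
    apply: vswap_inj; rewrite !vswapM vswap_vot -GE; apply: G2.
    by rewrite -vswap_vot -!vswapM Fc.
  exists G'; split=> [j|j a b|].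
  - by apply: WC_vswap_inv; rewrite -GE.
  - have -> : vot t a b = vot t a 1 * vot t 1 b :> vn N by rewrite votM mul1r mulr1.
    by rewrite -mulrA c2 mulrA c1 mulrA.
  - apply: vswap_inj; rewrite FG vswap_sum; apply: eq_bigr => j _.
    by rewrite vswapM vswap_vot GE.
move=> /choice[G GP]; exists (I2 * I1)%type, (fun p => G p.1 p.2), (fun p => e1 p.2), (fun p => e2 p.1).
split=> [[i j]|[i j]|]; [by have [] := GP i|by have [] := GP i|].
rewrite XF -(pair_big xpredT xpredT (fun i j => G i j * vot t (e1 j) (e2 i)))/=.
apply: eq_bigr => i _; have [_ _ ->] := GP i; rewrite mulr_suml; apply: eq_bigr => j _.
by rewrite -mulrA votM mul1r mulr1.
Qed.

Lemma WC_starM X Y : WC X -> WC Y -> WC (star Y * X).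
Proof.
move=> /central_decomp[J [F [u [v [wF cF ->]]]]] /central_decomp[J' [F' [u' [v' [wF' cF' ->]]]]].
rewrite mulr_sumr; apply: WC_sum => j; rewrite star_sum mulr_suml; apply: WC_sum => j'.
by rewrite starM vot_star mulrA -[_ * _ * F j]mulrA; apply/WC_vot/WC_central_mul.
Qed.

End MatrixReduction.

(** * Square-summable sequences *)

(** One fixed free ultrafilter makes the inner product of l^2 a total function; [tinner_near] shows
    that the ordinary limits agree with it. *)
Definition nat_ufilter : set_system nat := projT1 (cid nat_ultra).

Lemma nat_ufilter_ultra : UltraFilter nat_ufilter.
Proof. by rewrite /nat_ufilter; case: cid => ? []. Qed.

Lemma nat_ufilter_oo : \oo `<=` nat_ufilter.
Proof. by rewrite /nat_ufilter; case: cid => ? []. Qed.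

#[global] Hint Resolve nat_ufilter_ultra : core.

Section Dominated.
Variables (R : realType) (U : set_system nat).
Hypotheses (UU : UltraFilter U) (Uoo : \oo `<=` U).
Implicit Types (S T : nat -> R[i]).

Lemma ulim_mono_ge T C n : (forall m, `|T m| <= C) -> (forall n m, (n <= m)%N -> T n <= T m) ->
  T n <= ulim U T.
Proof.
move=> TC mT; have pU : ProperFilter U := ultra_proper.
have ub : ubounded U T := uboundedW UU TC.
have -> : ulim U T = ulim U (fun m => T m - T n) + T n.
  rewrite (ulimD UU ub (ubounded_cst UU (- T n))) ulim_cst ?subrK//.
rewrite lerDr; apply: ulim_ge0 => //; first exact: (uboundedD UU ub (ubounded_cst UU (- T n))).
by apply: Uoo; exists n => // m nm /=; rewrite subr_ge0 mT.
Qed.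

(** The increments of [S] are dominated by those of the bounded increasing [T]: once [T] is within e
    of its limit, every later [S n] is within e of its own. *)
Lemma dominated_near S T C e : (forall m, `|T m| <= C) ->
  (forall n m, (n <= m)%N -> `|S m - S n| <= T m - T n) -> 0 < e ->
  exists N, forall n, (N <= n)%N -> `|S n - ulim U S| <= e.
Proof.
move=> TC ST e0; have pU : ProperFilter U := ultra_proper.
have mT n m : (n <= m)%N -> T n <= T m.
  by move=> nm; rewrite -subr_ge0; exact: le_trans (ST n m nm).
have ubT : ubounded U T := uboundedW UU TC.
have ubS : ubounded U S.
  apply: (@uboundedW _ _ _ UU _ (`|S 0%N| + (C + C))) => m.
  rewrite -[S m](subrK (S 0%N)) (le_trans (ler_normD _ _))//.
  rewrite addrC lerD2l (le_trans (ST 0%N m _))//.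
  have := mT 0%N m isT; rewrite -subr_ge0 => h; rewrite -[leLHS]ger0_norm//.
  by rewrite (le_trans (ler_normB _ _))// lerD.
have [N /= hN] := ultra_ex UU (ulim_near UU ubT e0).
exists N => n Nn.
have hT : ulim U T - T n <= e.
  have h1 := ulim_mono_ge N TC mT; have h2 := ulim_mono_ge n TC mT.
  apply: (@le_trans _ _ (ulim U T - T N)); first by rewrite lerD2l lerN2 mT.
  by rewrite -[leLHS]ger0_norm ?subr_ge0// distrC.
apply: le_trans hT.
have E : S n - ulim U S = ulim U (fun m => S n - S m).
  rewrite (ulimD UU (ubounded_cst UU (S n))) ?ulim_cst//.
    congr (_ + _); rewrite -[LHS]mulN1r -ulimZ//; congr ulim.
    by apply/funext => m; rewrite mulN1r.
  by case: ubS => M SM; exists M; apply: filterS SM => i /=; rewrite normrN.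
rewrite E; apply: le_all_eps => // [|d d0]; first by rewrite subr_ge0 (ulim_mono_ge n TC mT).
apply: ulim_norm_le => //; first by rewrite addr_ge0 ?subr_ge0 ?(ulim_mono_ge n TC mT)// ltW.
have h : \oo [set m | (n <= m)%N] by exists n.
apply: filterS2 (Uoo h) (ulim_near UU ubT d0) => m /= nm hm.
rewrite distrC (le_trans (ST n m nm))// addrAC lerD2r.
rewrite -lerBlDl.
apply: le_trans hm; have h1 := ulim_mono_ge m TC mT.
by apply: real_ler_norm; rewrite -opprB rpredN ger0_real ?subr_ge0.
Qed.

End Dominated.

Section SquareSummable.
Variables (R : realType) (H : hilbertType R).
Implicit Types (x y z : nat -> H).

Definition tinner n x y : R[i] := \sum_(k < n) inner (x k) (y k).

Lemma tinner_sesqui n : sesqui (tinner n).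
Proof.
split=> a x y z; rewrite /tinner mulr_sumr -big_split/=; apply: eq_bigr => k _.
  by rewrite innerPl.
by rewrite innerDr innerZr.
Qed.

Lemma tinner_ge0 n x : 0 <= tinner n x x.
Proof. by apply: sumr_ge0 => k _; exact: inner_ge0. Qed.

Lemma tinner_cat x y n m : (n <= m)%N ->
  tinner m x y = tinner n x y + \sum_(n <= k < m) inner (x k) (y k).
Proof.
move=> nm; rewrite /tinner -(big_mkord xpredT (fun k => inner (x k) (y k))).
by rewrite -(big_mkord xpredT (fun k => inner (x k) (y k))) (big_cat_nat (leq0n n) nm).
Qed.

Lemma tinner_mono x n m : (n <= m)%N -> tinner n x x <= tinner m x x.
Proof.
move=> nm; rewrite (tinner_cat x x nm) lerDl sumr_ge0// => k _; exact: inner_ge0.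
Qed.

Lemma norm_inner_sqr (u v : H) : `|inner u v| <= inner u u + inner v v.
Proof.
rewrite (le_trans (cauchy_schwarz _ _))// !inner_norm.
have [r r0 ->] := ge0_complexP (normr_ge0 u); have [s s0 ->] := ge0_complexP (normr_ge0 v).
rewrite -!rmorphXn -rmorphM -rmorphD lecR/=; nra.
Qed.

Lemma tinner_diff x y n m : (n <= m)%N ->
  `|tinner m x y - tinner n x y| <=
    (tinner m x x + tinner m y y) - (tinner n x x + tinner n y y).
Proof.
move=> nm.
have E u v : tinner m u v - tinner n u v = \sum_(n <= k < m) inner (u k) (v k).
  by rewrite (tinner_cat u v nm) addrAC subrr add0r.
rewrite opprD addrACA !E -big_split/= (le_trans (ler_norm_sum _ _ _))// ler_sum//.
by move=> k _; exact: norm_inner_sqr.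
Qed.

Definition ell2_pred : {pred nat -> H} :=
  fun x => `[< exists C, forall n, tinner n x x <= C >].

Lemma ell2_submod : GRing.subsemimod_closed ell2_pred.
Proof.
split; [split |].
- apply/asboolP; exists 0 => n; rewrite (sesqui0l (tinner_sesqui n)) //.
- move=> x y /asboolP[C xC] /asboolP[D yD]; apply/asboolP; exists (2 * C + 2 * D) => n.
  have s1 := tinner_sesqui n.
  have h := tinner_ge0 n (x - y).
  have -> : tinner n (x + y) (x + y) =
      2 * tinner n x x + 2 * tinner n y y - tinner n (x - y) (x - y).
    by rewrite !(sesquiE s1); ring.
  rewrite lerBlDr; apply: (@le_trans _ _ (2 * C + 2 * D)); last by rewrite lerDl.
  by rewrite lerD// ler_wpM2l.
- move=> c x /asboolP[C xC]; apply/asboolP; exists (c * c^* * C) => n.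
  have s1 := tinner_sesqui n; rewrite (sesquiZl s1) (sesquiZr s1) mulrA.
  by rewrite ler_wpM2l// -normCK exprn_ge0.
Qed.

HB.instance Definition _ := GRing.isSubmodClosed.Build R[i] (nat -> H) ell2_pred
  ell2_submod.

Record ell2 := Ell2 { ell2_fun :> nat -> H; _ : ell2_fun \in ell2_pred }.

HB.instance Definition _ := [isSub for ell2_fun].
HB.instance Definition _ := [Choice of ell2 by <:].
HB.instance Definition _ := [SubChoice_isSubLmodule of ell2 by <:].

Implicit Types (f g h : ell2).

Lemma ell2P f : exists C, forall n, tinner n f f <= C.
Proof. by case: f => f /= /asboolP. Qed.

Definition ell2_inner f g : R[i] := ulim nat_ufilter (fun n => tinner n f g).

Lemma tinner_ubounded f g : ubounded nat_ufilter (fun n => tinner n f g).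
Proof.
have [C fC] := ell2P f; have [D gD] := ell2P g.
apply: (uboundedW nat_ufilter_ultra (M := C + D)) => n.
rewrite (le_trans (ler_norm_sum _ _ _))// (le_trans _ (lerD (fC n) (gD n)))//.
rewrite -big_split/= ler_sum// => k _; exact: norm_inner_sqr.
Qed.

Lemma ell2_inner_sesqui : sesqui ell2_inner.
Proof.
split=> a f g h; rewrite /ell2_inner.
  have b1 := tinner_ubounded f h; have b2 := tinner_ubounded g h.
  rewrite -(ulimZ nat_ufilter_ultra a b1) -(ulimD nat_ufilter_ultra (uboundedZ nat_ufilter_ultra a b1) b2).
  by congr ulim; apply/funext => n; rewrite (tinner_sesqui n).1.
have b1 := tinner_ubounded f g; have b2 := tinner_ubounded f h.
rewrite -(ulimZ nat_ufilter_ultra a^* b1) -(ulimD nat_ufilter_ultra (uboundedZ nat_ufilter_ultra a^* b1) b2).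
by congr ulim; apply/funext => n; rewrite (tinner_sesqui n).2.
Qed.

Lemma ell2_inner_ge0 f : 0 <= ell2_inner f f.
Proof.
apply: ulim_ge0 => //; first exact: tinner_ubounded.
by have pU := @ultra_proper _ _ nat_ufilter_ultra; apply: filterE => n; exact: tinner_ge0.
Qed.

Definition ell2_norm := seminorm ell2_inner.

Lemma tinner_le f n : tinner n f f <= ell2_inner f f.
Proof.
have [C fC] := ell2P f.
apply: (@ulim_mono_ge _ nat_ufilter nat_ufilter_ultra nat_ufilter_oo (fun n => tinner n f f) C) => [m|i j ij].
  by rewrite ger0_norm ?tinner_ge0.
exact: tinner_mono.
Qed.

Lemma ell2_coord_le f k : `|f k| <= ell2_norm f.
Proof.
rewrite -(@ler_pXn2r _ 2)// ?nnegrE ?seminorm_ge0//; last exact: ell2_inner_ge0.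
rewrite seminorm_sqr -inner_norm; apply: le_trans (tinner_le f k.+1).
by rewrite /tinner big_ord_recr/= lerDr tinner_ge0.
Qed.

Lemma ell2_norm_le f (C : R[i]) : 0 <= C -> (forall n, tinner n f f <= C ^+ 2) -> ell2_norm f <= C.
Proof.
move=> C0 fC; rewrite -(@ler_pXn2r _ 2)// ?nnegrE ?seminorm_ge0//; last exact: ell2_inner_ge0.
rewrite seminorm_sqr -[leLHS]ger0_norm ?ell2_inner_ge0//.
apply: ulim_norm_le; rewrite ?exprn_ge0//.
have pU := @ultra_proper _ _ nat_ufilter_ultra; apply: filterE => n /=.
by rewrite ger0_norm ?tinner_ge0.
Qed.

Lemma ell2_normD f g : ell2_norm (f + g) <= ell2_norm f + ell2_norm g.
Proof. exact: seminormD ell2_inner_sesqui ell2_inner_ge0 _ _. Qed.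

Lemma ell2_normZ c f : ell2_norm (c *: f) = `|c| * ell2_norm f.
Proof. exact: seminormZ ell2_inner_sesqui ell2_inner_ge0 _ _. Qed.

Lemma ell2_norm0_eq0 f : ell2_norm f = 0 -> f = 0.
Proof.
move=> f0; apply/val_inj/funext => k; apply/eqP; rewrite -normr_le0 -f0.
exact: ell2_coord_le.
Qed.

HB.instance Definition _ := Lmodule_isNormed.Build R[i] ell2
  ell2_normD ell2_normZ ell2_norm0_eq0.

Lemma ell2_normE f : `|f| = ell2_norm f. Proof. by []. Qed.

Lemma tnorm_le n x (e : R[i]) : 0 <= e -> (forall k, (k < n)%N -> `|x k| <= e) ->
  seminorm (tinner n) x <= n%:R * e.
Proof.
move=> e0 xe; have ts := tinner_sesqui n.
rewrite -(@ler_pXn2r _ 2)// ?nnegrE ?seminorm_ge0//; last first.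
- exact: mulr_ge0.
- exact: (@tinner_ge0 n).
rewrite seminorm_sqr; apply: (@le_trans _ _ (\sum_(k < n) e ^+ 2)).
  apply: ler_sum => k _; rewrite inner_norm ler_pXn2r ?nnegrE//.
  exact: xe.
rewrite sumr_const card_ord -[leLHS]mulr_natl exprMn ler_wpM2r ?exprn_ge0//.
by rewrite -natrX ler_nat; case: (n) => // m; rewrite expnS leq_pmulr// expn_gt0.
Qed.

Lemma filter_below (F : set_system ell2) (P : nat -> ell2 -> Prop) n : Filter F ->
  (forall k, F [set g | P k g]) -> F [set g | forall k, (k < n)%N -> P k g].
Proof.
move=> FF FP; elim: n => [|n IH]; first by apply: filterE.
apply: filterS2 IH (FP n) => g /= h1 h2 k; rewrite ltnS leq_eqVlt => /predU1P[->//|].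
exact: h1.
Qed.

Lemma ell2_complete (F : set_system ell2) : ProperFilter F -> cauchy F -> cvg F.
Proof.
move=> FF /cauchyP Fc.
have Fk k : exists l, forall e : R[i], 0 < e -> F [set g : ell2 | `|g k - l| < e].
  have : cauchy ((fun g : ell2 => g k) @ F).
    apply: cauchy_exP => e e0; have [g Fg] := Fc _ e0; exists (g k).
    apply: (@filterS _ F _ _ _ _ Fg) => h; rewrite /= -!ball_normE/= => gh.
    have := ell2_coord_le (g - h) k; rewrite -ell2_normE => hk; apply: le_lt_trans gh. exact: hk.
  move=> /cauchy_cvg/cvg_ex[l /cvgrPdist_lt Fl]; exists l => e e0.
  by apply: filterS (Fl e e0) => g /=; rewrite distrC.
have [l lP] := choice Fk.
(* The Cauchy bound passes to the coordinatewise limit in each truncated seminorm, uniformly in [n];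
   this gives both square summability of [l] and convergence to it. *)
have claim g (r : R[i]) n : F (ball g r) -> 0 <= r -> seminorm (tinner n) (fun k => g k - l k) <= r.
  move=> Fg r0; apply: le_all_eps => //; first exact/seminorm_ge0/tinner_ge0.
  move=> e e0; have d0 : 0 < e / n.+1%:R by rewrite divr_gt0.
  have [h [/= gh hl]] := filter_ex (filterI Fg (filter_below n _ (fun k => lP k _ d0))).
  have -> : (fun k => g k - l k) = (fun k => (g - h) k) + (fun k => h k - l k).
    by apply/funext => k; rewrite !fctE/= subrKA.
  rewrite (le_trans (seminormD (tinner_sesqui n) (@tinner_ge0 n) _ _))// lerD//.
    apply: (@le_trans _ _ `|g - h|); last by move: gh; rewrite -ball_normE => /ltW.
    rewrite -(@ler_pXn2r _ 2)// ?nnegrE//; last exact/seminorm_ge0/tinner_ge0.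
    rewrite seminorm_sqr (le_trans (tinner_le (g - h) n))//.
    by rewrite ell2_normE seminorm_sqr.
  rewrite (le_trans (tnorm_le (ltW d0) _))//; first by move=> k /hl/ltW.
  rewrite mulrA ler_pdivrMr// mulrC ler_wpM2l ?(ltW e0)// ler_nat//.
have le2 : l \in ell2_pred.
  have [g Fg] := Fc 1 ltr01; have -> : l = (g : nat -> H) - (fun k => g k - l k).
    by apply/funext => k; rewrite !fctE/= opprB addrC subrK.
  apply: rpredB; first by case: (g).
  apply/asboolP; exists 1 => n; rewrite -(seminorm_sqr (tinner n)) -(expr1n _ 2).
  by rewrite ler_pXn2r ?nnegrE ?seminorm_ge0 ?claim//; exact: tinner_ge0.
apply/cvg_ex; exists (Ell2 le2); apply/cvgrPdist_lt => e e0.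
have e2 : 0 < e / 2 by rewrite divr_gt0.
have [g Fg] := Fc _ e2; apply: filterS (Fg) => h /=.
rewrite -ball_normE/= => gh; rewrite -[_ - h](subrKA g) [ltRHS]splitr.
rewrite (le_lt_trans (ler_normD _ _))// ler_ltD//.
rewrite distrC ell2_normE; apply: ell2_norm_le; first exact: ltW.
move=> n; rewrite -seminorm_sqr ler_pXn2r ?nnegrE ?(ltW e2) ?seminorm_ge0//; last exact: tinner_ge0.
by apply: claim => //; exact: ltW.
Qed.

HB.instance Definition _ := Uniform_isComplete.Build ell2 ell2_complete.

Lemma ell2_innerC f g : ell2_inner g f = (ell2_inner f g)^*.
Proof. exact: semi_innerC ell2_inner_sesqui ell2_inner_ge0 _ _. Qed.

Lemma ell2_inner_norm f : ell2_inner f f = `|f| ^+ 2.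
Proof. by rewrite ell2_normE seminorm_sqr. Qed.

HB.instance Definition _ := isHilbert.Build R ell2 ell2_inner_sesqui.1 ell2_innerC
  ell2_inner_norm.

End SquareSummable.

(** * Ampliations and the ultraweak topology *)

Section Ampliation.
Variables (R : realType) (H : hilbertType R).
Implicit Types (f g : ell2 H) (a b : bop H H).

Lemma ell2_innerE f g : inner f g = ulim nat_ufilter (fun n => tinner n f g).
Proof. by []. Qed.

Lemma fin_subproof n (x : nat -> H) : (fun k => if (k < n)%N then x k else 0) \in @ell2_pred R H.
Proof.
apply/asboolP; exists (tinner n x x) => m.
apply: (@le_trans _ _ (tinner (maxn m n) (fun k => if (k < n)%N then x k else 0) (fun k => if (k < n)%N then x k else 0))).
  by apply: tinner_mono; exact: leq_maxl.
rewrite (tinner_cat _ _ (leq_maxr m n)) big_nat_cond big1 ?addr0.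
  rewrite le_eqVlt; apply/orP; left; apply/eqP.
  by apply: eq_bigr => k _; rewrite ltn_ord.
by move=> k; rewrite andbT => /andP[nk _]; rewrite ltnNge nk inner0l.
Qed.

Definition fin_ell2 n x : ell2 H := Ell2 (fin_subproof n x).

Lemma inner_fin f n x : inner f (fin_ell2 n x) = tinner n f x.
Proof.
rewrite ell2_innerE -(ulim_cst nat_ufilter_ultra (tinner n f x)); apply: eq_ulim => //.
apply: nat_ufilter_oo; exists n => // m /= nm.
rewrite (tinner_cat _ _ nm) big_nat_cond big1 ?addr0.
  by apply: eq_bigr => k _; rewrite ltn_ord.
by move=> k; rewrite andbT => /andP[nk _]; rewrite ltnNge nk inner0r.
Qed.

Definition single n x : ell2 H := fin_ell2 n.+1 (fun k => if k == n then x else 0).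

Lemma inner_single f n x : inner f (single n x) = inner (f n) x.
Proof.
rewrite inner_fin /tinner big_ord_recr/= eqxx big1 ?add0r// => k _.
by rewrite (ltn_eqF (ltn_ord k)) inner0r.
Qed.

Lemma singleE n x k : single n x k = if k == n then x else 0.
Proof. by rewrite /= ltnS; case: eqP => [->|]; rewrite ?leqnn//; case: ifP. Qed.

Lemma norm_single n x : `|single n x| = `|x|.
Proof.
apply/eqP; rewrite -(@eqrXn2 _ 2)//.
by rewrite -!inner_norm inner_single singleE eqxx.
Qed.

Lemma tinner_bop a (x : nat -> H) n :
  tinner n (fun k => a (x k)) (fun k => a (x k)) <= `|a| ^+ 2 * tinner n x x.
Proof.
rewrite /tinner mulr_sumr; apply: ler_sum => k _; rewrite !inner_norm -exprMn.
by rewrite ler_pXn2r ?nnegrE ?mulr_ge0// bop_normP.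
Qed.

Lemma amp_subproof1 a f : (fun k => a (f k)) \in @ell2_pred R H.
Proof.
have [C fC] := ell2P f; apply/asboolP; exists (`|a| ^+ 2 * C) => n.
by rewrite (le_trans (tinner_bop a f n))// ler_wpM2l ?exprn_ge0.
Qed.

Definition amp_fun a f : ell2 H := Ell2 (amp_subproof1 a f).

Lemma amp_subproof2 a : amp_fun a \in @bop_pred R (ell2 H) (ell2 H).
Proof.
apply: (@bop_predP _ _ _ _ `|a|) => // [k f g|f].
  by apply/val_inj/funext => i; exact: (linearP a).
apply: ell2_norm_le; first exact: mulr_ge0.
move=> n; rewrite exprMn (le_trans (tinner_bop a f n))// ler_wpM2l ?exprn_ge0//.
by rewrite -inner_norm; exact: tinner_le.
Qed.

(** The operator a (x) 1 on a countable multiple of [H], where ultraweak forms become vector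
    functionals ([uw_formE]). *)
Definition amp a : bop (ell2 H) (ell2 H) := Bop (amp_subproof2 a).

Lemma ampE a f k : amp a f k = a (f k). Proof. by []. Qed.

Lemma amp1 : amp 1 = 1.
Proof. by apply: bop_eqP => f; apply/val_inj/funext. Qed.

Lemma ampM a b : amp (a * b) = amp a * amp b.
Proof. by apply: bop_eqP => f; apply/val_inj/funext. Qed.

Lemma amp_adj a : adj (amp a) = amp (adj a).
Proof.
apply: adj_eq => f g; rewrite !ell2_innerE; congr ulim; apply/funext => n.
by apply: eq_bigr => k _; rewrite !ampE adjE.
Qed.

(** The matrix entries of an operator T that commutes with the ampliation of [A] commute with [A],
    hence with [c]. So T and [amp c] commute on vectors with a single nonzero entry, and these are
    total. *)
Lemma amp_bicommutant (A : set (bop H H)) c : commutant (commutant A) c ->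
  commutant (commutant (amp @` A)) (amp c).
Proof.
move=> Ac T TA.
have [S SE] : exists S : nat -> nat -> bop H H, forall m n x, S m n x = T (single n x) m.
  have ex m n : exists S : bop H H, forall x, S x = T (single n x) m.
    have h : (fun x => T (single n x) m) \in @bop_pred R H H.
      apply: (@bop_predP _ _ _ _ `|T|) => // [k x y|x].
        have -> : single n (k *: x + y) = k *: single n x + single n y.
          apply/val_inj/funext => i; rewrite -[LHS]/(single n _ i) singleE.
          rewrite -[RHS]/(k *: single n x i + single n y i) !singleE.
          by case: eqP; rewrite ?scaler0 ?addr0.
        by rewrite linearP.
      apply: le_trans (ell2_coord_le _ _) _.
      by rewrite -(norm_single n x); exact: (bop_normP T).
    by exists (Bop h).
  have ex2 m : exists S : nat -> bop H H, forall n x, S n x = T (single n x) m.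
    by have [S SE] := choice (ex m); exists S.
  by have [S SE] := choice ex2; exists S.
have ampS a n x : amp a (single n x) = single n (a x).
  apply/val_inj/funext => i; rewrite -[LHS]/(a (single n x i)) -[RHS]/(single n _ i) !singleE.
  by case: eqP; rewrite ?linear0.
have SA m n : commutant A (S m n).
  move=> a Aa; apply: bop_eqP => x; rewrite !bopME !SE -ampS.
  have /(congr1 (fun B : bop (ell2 H) (ell2 H) => B (single n x))) := TA _ (ex_intro2 _ _ a Aa erefl).
  by rewrite !bopME => ->; rewrite ampE.
have D n x : (amp c * T) (single n x) = (T * amp c) (single n x).
  apply/val_inj/funext => m; rewrite -[LHS]/(c (T (single n x) m)) bopME ampS.
  rewrite -[RHS]/(T (single n (c x)) m) -!SE.
  by have := congr1 (fun B : bop H H => B x) (Ac _ (SA m n)).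
apply/eqP; rewrite -subr_eq0; apply/eqP; set E := _ - _.
have D' n x : E (single n x) = 0 by rewrite /E bopB D subrr.
apply: bop_inner_eq => f g; rewrite [RHS]inner0l adjE.
suff -> : adj E g = 0 by rewrite inner0r.
apply/val_inj/funext => n; apply: inner_eq0 => x; rewrite innerC -inner_single -innerC.
by rewrite -adjE D' inner0l.
Qed.

End Ampliation.

Section SquareSummableSequences.
Variables (R : realType) (H : hilbertType R).
Implicit Types (f g : ell2 H) (x y : sqsum H).

Lemma series_tinner (x y : nat -> H) :
  series (fun n => inner (x n) (y n) : R[i]^o) = (fun n => tinner n x y).
Proof. by apply/funext => n; rewrite /series/= big_mkord. Qed.

Lemma tinner_near f g (e : R[i]) : 0 < e ->
  exists N, forall n, (N <= n)%N -> `|tinner n f g - inner f g| <= e.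
Proof.
have [C fC] := ell2P f; have [D gD] := ell2P g.
apply: (@dominated_near _ nat_ufilter nat_ufilter_ultra nat_ufilter_oo _ (fun n => tinner n f f + tinner n g g) (C + D)).
  by move=> n; rewrite ger0_norm ?addr_ge0 ?tinner_ge0// lerD.
by move=> n m; exact: tinner_diff.
Qed.

Lemma tinner_cvg f g :
  ((fun n => tinner n f g : R[i]^o) @ \oo --> (inner f g : R[i]^o))%classic.
Proof.
apply/cvgrPdist_le => e e0; have [N hN] := tinner_near f g e0.
by exists N => // n Nn; rewrite distrC hN.
Qed.

Lemma of_sqsum_subproof x : (x : nat -> H) \in @ell2_pred R H.
Proof.
apply/asboolP; case: x => x /=.
have -> : (fun n => `|x n| ^+ 2 : R[i]^o) = (fun n => inner (x n) (x n)).
  by apply/funext => n; rewrite inner_norm.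
rewrite series_tinner => /cvg_ex[l /cvgrPdist_lt/(_ 1 ltr01)[N _ hN]].
exists (`|l| + 1) => n; apply: (le_trans (tinner_mono x (leq_maxr N n))).
have /= := hN _ (leq_maxl N n); rewrite distrC => h.
rewrite -[leLHS]ger0_norm ?tinner_ge0// -[tinner _ _ _](subrK l) addrC.
by rewrite (le_trans (ler_normD _ _))// lerD2l ltW.
Qed.

Definition of_sqsum x : ell2 H := Ell2 (of_sqsum_subproof x).

Lemma to_sqsum_subproof f : cvgn (series (fun n => `|f n| ^+ 2 : R[i]^o)).
Proof.
have -> : (fun n => `|f n| ^+ 2 : R[i]^o) = (fun n => inner (f n) (f n)).
  by apply/funext => n; rewrite inner_norm.
by rewrite series_tinner; apply/cvg_ex; exists (inner f f); exact: tinner_cvg.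
Qed.

Definition to_sqsum f : sqsum H := @SqSum R H f (@to_sqsum_subproof f).

Lemma uw_formE xi (a : bop H H) :
  uw_form xi a = inner (amp a (of_sqsum xi.1)) (of_sqsum xi.2).
Proof.
rewrite /uw_form (series_tinner (fun n => a (xi.1 n))).
apply: cvg_lim => //. have h := @tinner_cvg (amp a (of_sqsum xi.1)) (of_sqsum xi.2). refine h.
Qed.

Lemma uw_form_to f g (a : bop H H) : uw_form (to_sqsum f, to_sqsum g) a = inner (amp a f) g.
Proof.
by rewrite uw_formE; congr (inner (amp a _) _); exact: val_inj.
Qed.

End SquareSummableSequences.

Section KernelInclusion.
Variables (R : realType) (V : lmodType R[i]).
Implicit Types (f g : V -> R[i]).

Definition lfun f := forall c x y, f (c *: x + y) = c * f x + f y.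

(** Induction on the list. If G_i is nonzero at some x0 in the common kernel of the others,
    subtracting the multiple of G_i that agrees with f at x0 leaves a functional handled by the
    others; otherwise G_i is redundant. *)
Lemma kernel_inclusion (I : Type) (G : I -> V -> R[i]) (s : seq I) f : (forall i, lfun (G i)) -> lfun f ->
  (forall x, (forall i, List.In i s -> G i x = 0) -> f x = 0) ->
  exists c : seq (R[i] * I), forall x, f x = \sum_(p <- c) p.1 * G p.2 x.
Proof.
move=> lG; elim: s f => [|i s IH] f lf fs.
  by exists [::] => x; rewrite big_nil; exact: fs.
have [h|/existsNP[x0 /not_implyP[x0s /eqP x0i]]] :=
    pselect (forall x, (forall j, List.In j s -> G j x = 0) -> G i x = 0).
  apply: IH => // x xs; apply: fs => j [<-|]; [exact: h | exact: xs].
pose f' x := - (f x0 / G i x0) * G i x + f x.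
have lf' : lfun f' by move=> c x y; rewrite /f' lf lG; ring.
have [x xs|c cP] := IH _ lf'.
  pose y := - (G i x / G i x0) *: x0 + x.
  have fy : f y = 0.
    apply: fs => j [<-|js]; first by rewrite lG mulNr divfK// addNr.
    by rewrite lG (x0s _ js) (xs _ js) mulr0 addr0.
  move: fy; rewrite /y lf /f' => <-; field.
  exact: x0i.
exists ((f x0 / G i x0, i) :: c) => x; rewrite big_cons -cP /f' /=; ring.
Qed.

End KernelInclusion.

(** * The predual *)

Section InitialTopologies.

Lemma initial_cvg (S : choiceType) (T : topologicalType) (e : S -> T) (F : set_system S) (s : S) :
  Filter F -> F --> (s : initial_topology e) <-> e @ F --> e s.
Proof.
move=> FF; split=> [Fs|es].
  by apply: cvg_trans (@initial_continuous _ _ e s); exact: cvg_app.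
move=> A [_ [[B oB <-] Bs BA]]; apply: filterS BA _; apply: es.
exact: open_nbhs_nbhs.
Qed.

Lemma ptws_cvg (I : Type) (T : topologicalType) (F : set_system {ptws I -> T}) (f : {ptws I -> T}) :
  Filter F -> F --> f <-> forall i, (fun g : {ptws I -> T} => g i) @ F --> f i.
Proof.
move=> FF; rewrite cvg_sup; split=> h i.
  exact: (initial_cvg _ _ _).1 (h i).
exact: (initial_cvg _ _ _).2 (h i).
Qed.

Lemma initial_ptws_cvg (S : choiceType) (I : Type) (T : topologicalType) (e : S -> {ptws I -> T})
    (F : set_system S) (s : S) : Filter F ->
  F --> (s : initial_topology e) <-> forall i, (fun x => e x i) @ F --> e s i.
Proof. by move=> FF; rewrite initial_cvg ptws_cvg. Qed.

End InitialTopologies.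

Section LinearFunctionals.
Variables (R : realType) (V : lmodType R[i]) (f : V -> R[i]).
Hypothesis lf : lfun f.

Lemma lfunD x y : f (x + y) = f x + f y.
Proof. by rewrite -[x]scale1r lf mul1r scale1r. Qed.

Lemma lfun0 : f 0 = 0.
Proof. by apply: (@addrI _ (f 0)); rewrite -lfunD !addr0. Qed.

Lemma lfunZ c x : f (c *: x) = c * f x.
Proof. by rewrite -[c *: x]addr0 lf lfun0 addr0. Qed.

End LinearFunctionals.

Section UltraweakFunctionals.
Variables (R : realType) (H : hilbertType R) (M : vnalg H).
Implicit Types (f g : ell2 H) (a b : vn M).

Lemma ampD (a b : bop H H) : amp (a + b) = amp a + amp b.
Proof. by apply: bop_eqP => f; apply/val_inj/funext. Qed.

Lemma ampZ k (a : bop H H) : amp (k *: a) = k *: amp a.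
Proof. by apply: bop_eqP => f; apply/val_inj/funext. Qed.

Lemma uw_form_lfun xi : lfun (fun a : vn M => uw_form xi a : R[i]).
Proof. by move=> k a b; rewrite !uw_formE ampD ampZ bopD bopZ innerPl. Qed.

Lemma uw_form_continuous xi : continuous ((fun a => uw_form xi a) : ultraweak M -> R[i]^o).
Proof.
move=> a; have := @initial_ptws_cvg _ _ _ (@uw_embed _ _ M) (nbhs (a : ultraweak M)) a _.
by case=> h _; exact: (h (@cvg_id _ _) xi).
Qed.

(** Continuity at 0 bounds [h] where finitely many forms are below 1; by scaling, [h] vanishes on
    their common kernel. *)
Lemma ultraweak_rep (h : vn M -> R[i]) : lfun h -> continuous (h : ultraweak M -> R[i]^o) ->
  exists c : seq (R[i] * (sqsum H * sqsum H)), forall a, h a = \sum_(p <- c) p.1 * uw_form p.2 a.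
Proof.
move=> lh ch.
pose G : set_system (vn M) := [set A | exists s : seq (sqsum H * sqsum H), forall a,
  (forall xi, List.In xi s -> `|uw_form xi a : R[i]| < 1) -> A a].
have GF : Filter G.
  constructor; first by exists [::].
    move=> A B [s sA] [s' sB]; exists (s ++ s') => a ha; split.
      by apply: sA => xi xis; apply/ha/In_cat; left.
    by apply: sB => xi xis; apply/ha/In_cat; right.
  by move=> A B AB [s sA]; exists s => a ha; exact/AB/sA.
have G0 : G --> (0 : ultraweak M).
  apply/initial_ptws_cvg => xi; apply/cvgrPdist_lt => e e0.
  (* The tolerance e is absorbed into the first sequence, as the sets of [G] have radius 1. *)
  exists [:: (to_sqsum (e^-1 *: of_sqsum xi.1), to_sqsum (of_sqsum xi.2))] => a /(_ _ (or_introl erefl)).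
  rewrite uw_form_to linearZ/= innerZl normrM normfV (gtr0_norm e0) ltr_pdivrMl// mulr1 -uw_formE.
  by rewrite /uw_embed (lfun0 (uw_form_lfun xi)) sub0r normrN.
have /cvgrPdist_lt/(_ 1 ltr01)/G0[s hs] := ch 0.
have [|||c cP] := @kernel_inclusion R (vn M) _ (fun xi a => uw_form xi a) s h.
- by move=> xi; exact: uw_form_lfun.
- by [].
- move=> a sa; apply/normr0_eq0/(@ler_nat_mul0 _ _ 1) => // n.
  have := hs (n%:R *: a) _; rewrite /= (lfun0 lh) sub0r normrN (lfunZ lh).
  rewrite normrM normr_nat => /(_ _)/ltW; apply => xi /sa.
  by rewrite (lfunZ (uw_form_lfun xi)) => ->; rewrite mulr0 normr0.
by exists c.
Qed.

End UltraweakFunctionals.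

Section Predual.
Variables (R : realType) (H : hilbertType R) (M : vnalg H).
Implicit Types (f g : ell2 H) (a b : vn M) (h : predual M).

Lemma norm_amp (a : bop H H) : `|amp a| <= `|a|.
Proof.
apply: opnorm_le => // f; apply: ell2_norm_le; first exact: mulr_ge0.
move=> n; rewrite exprMn (le_trans (tinner_bop a f n))// ler_wpM2l ?exprn_ge0//.
by rewrite -inner_norm; exact: tinner_le.
Qed.

Lemma uwf_subproof f g : (fun a : vn M => inner (amp a f) g : R[i]^o) \in @bop_pred R (vn M) R[i]^o.
Proof.
apply: (@bop_predP _ _ _ _ (`|f| * `|g|)) => [k a b||a].
- by rewrite ampD ampZ bopD bopZ innerPl.
- exact: mulr_ge0.
rewrite (le_trans (inner_bop_le _ _ _))// -mulrA mulrC ler_wpM2l ?norm_amp//.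
exact: mulr_ge0.
Qed.

Definition uwf f g : dual (vn M) := Bop (uwf_subproof f g).

Lemma uwfE f g a : uwf f g a = inner (amp a f) g. Proof. by []. Qed.

Lemma norm_uwf f g : `|uwf f g| <= `|f| * `|g|.
Proof.
apply: opnorm_le => [a|]; last exact: mulr_ge0.
rewrite uwfE (le_trans (inner_bop_le _ _ _))// -mulrA mulrC ler_wpM2l ?norm_amp//.
exact: mulr_ge0.
Qed.

Lemma uwp_subproof f g : uwf f g \in @predual_pred R H M.
Proof.
apply/asboolP; have E : (uwf f g : vn M -> R[i]) = (fun a => uw_form (to_sqsum f, to_sqsum g) a).
  by apply/funext => a; rewrite uw_form_to.
rewrite E; exact: uw_form_continuous.
Qed.

Definition uwp f g : predual M := Predual (uwp_subproof f g).

Lemma uwpE f g a : uwp f g a = inner (amp a f) g. Proof. by []. Qed.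

Lemma normal_rep (h : vn M -> R[i]) : lfun h -> continuous (h : ultraweak M -> R[i]^o) ->
  exists c : seq (ell2 H * ell2 H), forall a, h a = \sum_(p <- c) inner (amp a p.1) p.2.
Proof.
move=> lh ch; have [c cP] := ultraweak_rep lh ch.
exists [seq (p.1 *: of_sqsum p.2.1, of_sqsum p.2.2) | p <- c] => a.
rewrite cP big_map; apply: eq_bigr => p _ /=.
by rewrite uw_formE -innerZl -linearZ.
Qed.

Lemma predual_cont h : continuous (h : ultraweak M -> R[i]^o).
Proof. by case: h => h /= /asboolP. Qed.

Lemma predual_rep h : exists c : seq (ell2 H * ell2 H), h = \sum_(p <- c) uwp p.1 p.2.
Proof.
have [|c cP] := @normal_rep h _ (@predual_cont h).
  by move=> k a b; rewrite dualD dualZ.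
exists c; apply/val_inj/bop_eqP => a; rewrite cP.
by elim: c {cP} => [|p c IH]; rewrite ?big_nil// !big_cons IH.
Qed.

Lemma fin_near g (e : R[i]) : 0 < e -> exists N, forall n, (N <= n)%N -> `|g - fin_ell2 n g| <= e.
Proof.
move=> e0; have [N hN] := tinner_near g g (exprn_gt0 2 e0); exists N => n /hN hn.
rewrite -(@ler_pXn2r _ 2)// ?nnegrE ?(ltW e0)//; apply: le_trans hn.
have -> : `|g - fin_ell2 n g| ^+ 2 = inner g g - tinner n g g.
  have E : inner (fin_ell2 n g) (fin_ell2 n g) = tinner n g g.
    by rewrite inner_fin; apply: eq_bigr => k _; rewrite /= ltn_ord.
  have E' : inner (fin_ell2 n g) g = tinner n g g.
    by rewrite innerC inner_fin geC0_conj// tinner_ge0.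
  by rewrite -inner_norm innerBl !innerBr E E' inner_fin subrr subr0.
by rewrite -[leLHS]ger0_norm ?subr_ge0 1?distrC// inner_norm -inner_norm tinner_le.
Qed.

(** Truncating the second sequence turns an ultraweak form into a finite sum of vector functionals,
    at a cost of |f| |g - g_n| in norm. *)
Lemma predual_near h (e : R[i]) : 0 < e -> exists s, `|predual_val h - vfsum M s| <= e.
Proof.
have [c ->] := predual_rep h; elim: c e => [|[f g] c IH] e e0.
  by exists [::]; rewrite big_nil /vfsum big_nil subrr normr0 ltW.
have e2 : 0 < e / 2 by rewrite divr_gt0.
have [s hs] := IH _ e2.
have f0 : 0 < `|f| + 1 by rewrite ltr_wpDl.
have [n /(_ n (leqnn n)) hn] := fin_near g (divr_gt0 e2 f0).
exists ([seq (f k, g k) | k <- iota 0 n] ++ s).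
have -> : vfsum M ([seq (f k, g k) | k <- iota 0 n] ++ s) =
    uwf f (fin_ell2 n g) + vfsum M s.
  rewrite /vfsum big_cat/=; congr (_ + _); apply: bop_eqP => a.
  rewrite uwfE inner_fin /tinner -(big_mkord xpredT (fun k => inner (amp a f k) (g k))).
  by rewrite dual_sumE big_map /index_iota subn0.
rewrite big_cons.
have -> : predual_val (uwp f g + \sum_(j <- c) uwp j.1 j.2) - (uwf f (fin_ell2 n g) + vfsum M s) =
    uwf f (g - fin_ell2 n g) + (predual_val (\sum_(j <- c) uwp j.1 j.2) - vfsum M s).
  rewrite opprD addrACA; congr (_ + _); apply: bop_eqP => a.
  by rewrite [RHS]uwfE innerBr.
rewrite (le_trans (ler_normD _ _))// [leRHS]splitr lerD//.
rewrite (le_trans (norm_uwf _ _))//.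
rewrite (le_trans (ler_wpM2l _ hn))// mulrCA ler_piMr ?(ltW e2)// ler_pdivrMr// mul1r.
by rewrite lerDl.
Qed.

Definition vfp (x y : H) : predual M := uwp (single 0 x) (single 0 y).

Lemma vfpE x y a : vfp x y a = inner (a x) y.
Proof. by rewrite uwpE inner_single ampE singleE. Qed.

Lemma vfp_vf x y : predual_val (vfp x y) = vf M x y.
Proof. by apply: bop_eqP => a; rewrite [LHS]vfpE. Qed.

Definition vfpsum (s : seq (H * H)) : predual M := \sum_(p <- s) vfp p.1 p.2.

Lemma vfpsumE s : predual_val (vfpsum s) = vfsum M s.
Proof.
rewrite /vfpsum /vfsum; elim: s => [|p s IH]; rewrite ?big_nil// !big_cons -IH.
by rewrite -vfp_vf.
Qed.

Lemma predual_normE h : `|h| = `|predual_val h|. Proof. by []. Qed.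

Lemma dual_predual_eq (l l' : dual (predual M)) :
  (forall x y, l (vfp x y) = l' (vfp x y)) -> l = l'.
Proof.
move=> E; apply: bop_eqP => h; apply: eq_all_eps => e e0.
have c0 : 0 < `|l - l'| + 1 by rewrite ltr_wpDl.
have [s hs] := predual_near h (divr_gt0 e0 c0).
have -> : l h - l' h = (l - l') (h - vfpsum s).
  have D k : (l - l') k = l k - l' k by [].
  rewrite !dualB !D [l (vfpsum _)]dual_sum [l' (vfpsum _)]dual_sum.
  by rewrite (eq_bigr _ (fun p _ => E p.1 p.2)) subrr subr0.
rewrite (le_trans (dual_le _ _))// predual_normE.
have -> : predual_val (h - vfpsum s) = predual_val h - vfsum M s by rewrite -vfpsumE.
rewrite (le_trans (ler_wpM2l _ hs))// mulrCA ler_piMr ?(ltW e0)// ler_pdivrMr// mul1r.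
by rewrite lerDl.
Qed.

(** The operator is read off from the vector functionals; [dual_predual_eq], the norm density of
    their span, shows that they determine [l]. *)
Lemma predual_dual (l : dual (predual M)) : exists a, l = predual_eval a /\ `|a| <= `|l|.
Proof.
have vfpl k x y z : vfp (k *: x + y) z = k *: vfp x z + vfp y z.
  by apply/val_inj/bop_eqP => a; rewrite [LHS]vfpE linearP innerPl -!vfpE.
have vfpr k x y z : vfp x (k *: y + z) = k^* *: vfp x y + vfp x z.
  by apply/val_inj/bop_eqP => a; rewrite [LHS]vfpE innerDr innerZr -!vfpE.
have [] := @form_vn _ _ M (fun x y => l (vfp x y)) `|l|.
- by split=> k x y z; rewrite ?vfpl ?vfpr dualD dualZ.
- by [].
- move=> x y; rewrite (le_trans (dual_le _ _))// -mulrA ler_wpM2l//.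
  by rewrite predual_normE vfp_vf norm_vf.
- move=> S SM x y; congr (l _); apply/val_inj/bop_eqP => a.
  rewrite [LHS]vfpE [RHS]vfpE -adjE.
  by have := congr1 (fun T : bop H H => inner (T x) y) (SM _ (vnP a)); rewrite !bopME => ->.
move=> a [aE an]; exists a; split=> //; apply: dual_predual_eq => x y.
by rewrite -aE -vfpE.
Qed.

End Predual.

Section NormalDensity.
Variable R : realType.

Lemma amp_set1 (K : hilbertType R) (A : set (bop K K)) : A 1 -> (@amp _ _ @` A) 1.
Proof. by move=> A1; exists 1 => //; exact: amp1. Qed.

Lemma amp_setM (K : hilbertType R) (A : set (bop K K)) :
  (forall a b, A a -> A b -> A (a * b)) ->
  forall a b, (@amp _ _ @` A) a -> (@amp _ _ @` A) b -> (@amp _ _ @` A) (a * b).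
Proof.
by move=> AM _ _ [a Aa <-] [b Ab <-]; exists (a * b); [exact: AM | exact: ampM].
Qed.

Lemma amp_set_adj (K : hilbertType R) (A : set (bop K K)) : (forall a, A a -> A (adj a)) ->
  forall a, (@amp _ _ @` A) a -> (@amp _ _ @` A) (adj a).
Proof.
by move=> AA _ [a Aa <-]; exists (adj a); [exact: AA | rewrite amp_adj].
Qed.

Variables (K : hilbertType R) (A : set (bop K K)).
Hypotheses (A1 : A 1) (AM : forall a b, A a -> A b -> A (a * b)).
Hypothesis Aadj : forall a, A a -> A (adj a).

(** Two ampliations: the first makes each ultraweak form a vector functional, the second packs the
    finite list into one pair of vectors, to which [bicommutant_vector] applies. *)
Lemma bicommutant_normal (s : seq (ell2 K * ell2 K)) c : commutant (commutant A) c ->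
  (forall a, A a -> \sum_(p <- s) inner (amp a p.1) p.2 = 0) ->
  \sum_(p <- s) inner (amp c p.1) p.2 = 0.
Proof.
move=> Ac As.
pose v := fin_ell2 (size s) (fun k => (nth (0, 0) s k).1).
pose w := fin_ell2 (size s) (fun k => (nth (0, 0) s k).2).
have E (a : bop K K) : \sum_(p <- s) inner (amp a p.1) p.2 = inner (amp (amp a) v) w.
  rewrite inner_fin (big_nth (0, 0)) big_mkord; apply: eq_bigr => k _.
  by rewrite ampE /= ltn_ord.
rewrite E; apply: (@bicommutant_vector _ _ (@amp _ _ @` (@amp _ _ @` A))).
- exact/amp_set1/amp_set1.
- exact/amp_setM/amp_setM.
- exact/amp_set_adj/amp_set_adj.
- exact/amp_bicommutant/amp_bicommutant.
- by move=> _ [_ [a Aa <-] <-]; rewrite -E As.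
Qed.

End NormalDensity.

Section TensorPreduals.
Variables (R : realType) (H1 H2 K : hilbertType R) (t : hilbert_tensor H1 H2 K).
Variables (M1 : vnalg H1) (M2 : vnalg H2).
Local Notation N := (vn_tensor t M1 M2).
Implicit Types (X Y : vn N).

Lemma predual_tensor_ext (h h' : predual N) :
  (forall a b, h (vot t a b) = h' (vot t a b)) -> h = h'.
Proof.
move=> hh; apply/eqP; rewrite -subr_eq0; apply/eqP; set d := h - h'.
have d0 a b : d (vot t a b) = 0 by have := hh a b => E; rewrite -[LHS]/(h _ - h' _) E subrr.
have [s sP] := predual_rep d; have dE X : d X = \sum_(p <- s) inner (amp X p.1) p.2.
  rewrite sP; elim: (s) => [|p c IH]; rewrite ?big_nil// !big_cons -IH//.
suff E X : \sum_(p <- s) inner (amp X p.1) p.2 = 0.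
  by apply/val_inj/bop_eqP => X; rewrite [LHS]dE E.
apply: (bicommutant_normal (@otimes_set1 _ _ _ _ t M1 M2) (@otimes_setM _ _ _ _ t M1 M2)
  (@otimes_set_adj _ _ _ _ t M1 M2)).
  exact: (vnP X).
by move=> c /otimes_setE[a [b ->]]; rewrite -dE d0.
Qed.

(** The equality in [WC] is automatic when the functional on the second leg is normal: it is
    immediate for vector functionals, whose sums are norm dense. *)
Lemma fubini_predual (f : predual M2) (psi : dual (vn M1)) X :
  psi (rslice (predual_val f) X) = f (fslice psi X).
Proof.
apply: eq_all_eps => e e0.
have c0 : 0 < 2 * (`|psi| * `|X|) + 1 by rewrite ltr_wpDl// !mulr_ge0.
have [s hs] := predual_near f (divr_gt0 e0 c0).
have E : psi (rslice (vfsum M2 s) X) = vfsum M2 s (fslice psi X).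
  rewrite vfsumE /vfsum.
  elim: s {hs} => [|p s IH].
    by rewrite !big_nil -(scale0r (0 : dual (vn M2))) rslice_scalef scale0r dual0.
  by rewrite !big_cons rslice_addf dualD IH fsliceE rslice_vf.
set d := predual_val f - vfsum M2 s.
have -> : psi (rslice (predual_val f) X) - f (fslice psi X) =
    psi (rslice d X) - d (fslice psi X).
  have -> : predual_val f = d + vfsum M2 s by rewrite subrK.
  by rewrite rslice_addf dualD E dual_addE opprD addrACA subrr addr0.
rewrite (le_trans (ler_normB _ _))//.
have h1 : `|psi (rslice d X) : R[i]| <= `|psi| * `|X| * `|d|.
  rewrite (le_trans (dual_le _ _))// -mulrA ler_wpM2l// mulrC.
  exact: norm_rslice.
have h2 : `|d (fslice psi X) : R[i]| <= `|psi| * `|X| * `|d|.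
  rewrite (le_trans (dual_le _ _))// mulrC ler_wpM2r// -norm_vswap.
  exact: norm_rslice.
rewrite (le_trans (lerD h1 h2))// -mulr2n -mulr_natl mulrA.
rewrite (le_trans (ler_wpM2l _ hs)) ?mulr_ge0// mulrCA ler_piMr ?(ltW e0)// ler_pdivrMr// mul1r.
by rewrite lerDl.
Qed.

End TensorPreduals.

(** * Tensor products of normal functionals *)

Section SquareEnumeration.

(* The squares [0, n) x [0, n), each listed before the next one. *)
Fixpoint squares n : seq (nat * nat) :=
  if n is n'.+1 then squares n' ++ [seq (n', j) | j <- iota 0 n] ++ [seq (i, n') | i <- iota 0 n']
  else [::].

Lemma squaresS n : squares n.+1 =
  squares n ++ [seq (n, j) | j <- iota 0 n.+1] ++ [seq (i, n) | i <- iota 0 n].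
Proof. by []. Qed.

Lemma squares_prefix n m : (n <= m)%N -> exists s, squares m = squares n ++ s.
Proof.
elim: m => [|m IH]; first by rewrite leqn0 => /eqP->; exists [::].
rewrite leq_eqVlt => /predU1P[->|]; first by exists [::]; rewrite cats0.
by rewrite ltnS => /IH[s E]; rewrite squaresS E -catA; eexists.
Qed.

Lemma size_squares n : (n <= size (squares n))%N.
Proof.
elim: n => // n IH; rewrite squaresS size_cat/= size_cat.
by rewrite addnS ltnS (leq_trans IH)// leq_addr.
Qed.

(** The truncations of a double family at [q n] are full squares, over which sums of products
    factor. *)
Lemma square_enumeration : exists (z : nat -> nat * nat) (q : nat -> nat),
  (forall n, (n <= q n)%N) /\ forall (V : nmodType) (G : nat -> nat -> V) n,
    \sum_(k < q n) G (z k).1 (z k).2 = \sum_(i < n) \sum_(j < n) G i j.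
Proof.
exists (fun k => nth (0, 0)%N (squares k.+1) k), (fun n => size (squares n)).
split=> [n|V G n]; first exact: size_squares.
transitivity (\sum_(p <- squares n) G p.1 p.2).
  rewrite (big_nth (0, 0)%N) big_mkord; apply: eq_bigr => k _.
  suff -> : nth (0, 0)%N (squares k.+1) k = nth (0, 0)%N (squares n) k by [].
  have [s E] := squares_prefix (leq_maxl k.+1 n).
  have [s' E'] := squares_prefix (leq_maxr k.+1 n).
  transitivity (nth (0, 0)%N (squares (maxn k.+1 n)) k).
    by rewrite E nth_cat size_squares.
  by rewrite E' nth_cat ltn_ord.
elim: n => [|n IH]; first by rewrite big_nil big_ord0.
rewrite squaresS big_ord_recr big_cat big_cat IH/=.
rewrite [in RHS](eq_bigr (fun i : 'I_n => \sum_(j < n) G i j + G i n)) => [|i _]; last by rewrite big_ord_recr.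
rewrite big_split/= -addrA; congr (_ + _); rewrite addrC; congr (_ + _).
  by rewrite big_map -{1}[n]subn0 -/(index_iota 0 n) big_mkord.
rewrite -(big_mkord xpredT (fun j => G n j)) /index_iota subn0.
by rewrite -[(n, 0)%N :: _]/[seq (n, j) | j <- iota 0 n.+1] big_map.
Qed.

End SquareEnumeration.

Lemma ler_mul_div (R : realType) (a e : R[i]) : 0 <= a -> 0 <= e -> a * (e / (a + 1)) <= e.
Proof.
move=> a0 e0; have c0 : 0 < a + 1 by rewrite ltr_wpDl.
by rewrite mulrCA ler_piMr// ler_pdivrMr// mul1r lerDl.
Qed.

Lemma splitr3 (R : realType) (e : R[i]) : e = e / 3 + e / 3 + e / 3.
Proof. by field. Qed.

Lemma sub_telescope (R : realType) (a b c d : R[i]) : a - b = - (d - a) - (b - c) - (c - d).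
Proof. by ring. Qed.

Section TensorExistence.
Variables (R : realType) (H1 H2 K : hilbertType R) (t : hilbert_tensor H1 H2 K).
Variables (M1 : vnalg H1) (M2 : vnalg H2).
Local Notation N := (vn_tensor t M1 M2).
Implicit Types (X Y : vn N).

Lemma ell2_tens (x : ell2 H1) (y : ell2 H2) (z : nat -> nat * nat) (q : nat -> nat) :
  (forall n, (n <= q n)%N) -> (forall (G : nat -> nat -> R[i]) n,
    \sum_(k < q n) G (z k).1 (z k).2 = \sum_(i < n) \sum_(j < n) G i j) ->
  (fun k => t (x (z k).1) (y (z k).2)) \in @ell2_pred R K.
Proof.
move=> nq zq; have [C xC] := ell2P x; have [D yD] := ell2P y.
apply/asboolP; exists (C * D) => n; apply: (le_trans (tinner_mono _ (nq n))).
rewrite /tinner (zq (fun i j => inner (t (x i) (y j)) (t (x i) (y j)))).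
apply: (@le_trans _ _ (tinner n x x * tinner n y y)); last by rewrite ler_pM ?tinner_ge0.
rewrite /tinner mulr_suml ler_sum// => i _; rewrite mulr_sumr ler_sum// => j _.
by rewrite inner_tens.
Qed.

(** The vectors x_i (x) y_j, enumerated by squares, represent the product functional: at [q n] the
    truncated form is exactly [f n] applied to the slice by [g n], and three errors of size e / 3
    remain. *)
Lemma uwp_tensor (x x' : ell2 H1) (y y' : ell2 H2) : exists h : predual N,
  forall X, h X = uwf M1 x x' (rslice (uwf M2 y y') X).
Proof.
have [z [q [nq zq]]] := square_enumeration.
pose u : ell2 K := Ell2 (ell2_tens x y nq (zq R[i])).
pose u' : ell2 K := Ell2 (ell2_tens x' y' nq (zq R[i])).
exists (uwp N u u') => X; rewrite uwpE.
pose f n := uwf M1 x (fin_ell2 n x'); pose g n := uwf M2 y (fin_ell2 n y').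
have E n : tinner (q n) (amp X u) u' = f n (rslice (g n) X).
  rewrite /tinner (zq _ (fun i j => inner (X (t (x i) (y j))) (t (x' i) (y' j)))).
  rewrite uwfE inner_fin; apply: eq_bigr => i _; rewrite ampE rsliceE uwfE inner_fin.
  by apply: eq_bigr => j _; rewrite ampE lsliceE.
have fd n : uwf M1 x x' - f n = uwf M1 x (x' - fin_ell2 n x').
  by apply: bop_eqP => a; rewrite [RHS]uwfE innerBr.
have gd n : uwf M2 y y' - g n = uwf M2 y (y' - fin_ell2 n y').
  by apply: bop_eqP => a; rewrite [RHS]uwfE innerBr.
set F := uwf M1 x x' in fd *; set G := uwf M2 y y' in gd *.
apply: eq_all_eps => e e0.
have e3 : 0 < e / 3 by rewrite divr_gt0.
have a0 : 0 <= `|x| * (`|G| * `|X|) by rewrite !mulr_ge0.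
have b0 : 0 <= (`|F| + `|x|) * (`|y| * `|X|) by rewrite !mulr_ge0// addr_ge0.
have c0 : 0 < `|x| * (`|G| * `|X|) + 1 by rewrite ltr_wpDl.
have d0 : 0 < (`|F| + `|x|) * (`|y| * `|X|) + 1 by rewrite ltr_wpDl.
have [n1 h1] := tinner_near (amp X u) u' e3.
have [n2 h2] := fin_near x' (divr_gt0 e3 c0).
have [n3 h3] := fin_near y' (divr_gt0 e3 d0).
have [n4 h4] := fin_near x' ltr01.
pose n := maxn (maxn n1 n2) (maxn n3 n4).
have {h1} := h1 (q n) _; rewrite E => h1.
have {}h1 := h1 (leq_trans (leq_trans (leq_maxl n1 n2) (leq_maxl _ _)) (nq n)).
have {}h2 := h2 n (leq_trans (leq_maxr n1 n2) (leq_maxl _ _)).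
have {}h3 := h3 n (leq_trans (leq_maxl n3 n4) (leq_maxr _ _)).
have {}h4 := h4 n (leq_trans (leq_maxr n3 n4) (leq_maxr _ _)).
have fn : `|f n| <= `|F| + `|x|.
  have -> : f n = F + - (F - f n) by rewrite subKr.
  rewrite (le_trans (ler_normD _ _))// lerD2l normrN fd (le_trans (norm_uwf _ _ _))//.
  by rewrite ler_piMr.
have k1 : `|(F - f n) (rslice G X) : R[i]| <= e / 3.
  rewrite (le_trans (dual_le _ _))// (le_trans _ (ler_mul_div a0 (ltW e3)))// mulrAC.
  rewrite ler_pM ?norm_rslice// fd (le_trans (norm_uwf _ _ _))// ler_wpM2l//.
have k2 : `|f n (rslice (G - g n) X) : R[i]| <= e / 3.
  rewrite (le_trans (dual_le _ _))// (le_trans _ (ler_mul_div b0 (ltW e3)))//.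
  rewrite -[leRHS]mulrA ler_pM// (le_trans (norm_rslice _ _))// gd mulrAC ler_wpM2r//.
  by rewrite (le_trans (norm_uwf _ _ _))// ler_wpM2l.
have -> : inner (amp X u) u' - F (rslice G X) =
    - (f n (rslice (g n) X) - inner (amp X u) u') - (F - f n) (rslice G X) - f n (rslice (G - g n) X).
  have -> : rslice (G - g n) X = rslice G X - rslice (g n) X.
    by rewrite rslice_addf -scaleN1r rslice_scalef scaleN1r.
  have -> : (F - f n) (rslice G X) = F (rslice G X) - f n (rslice G X) by [].
  rewrite dualB; exact: sub_telescope.
rewrite (splitr3 e).
rewrite (le_trans (ler_normB _ _))// lerD// (le_trans (ler_normB _ _))// lerD//.
by rewrite normrN.
Qed.

Lemma tensor_ex (f : predual M1) (g : predual M2) : exists h : predual N,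
  forall X, h X = f (rslice (predual_val g) X).
Proof.
have [r ->] := predual_rep f; have [s ->] := predual_rep g.
elim: r => [|[x x'] r [h1 hh1]].
  by exists 0 => X; rewrite big_nil.
have [h2 hh2] : exists h : predual N, forall X,
    h X = uwf M1 x x' (rslice (predual_val (\sum_(p <- s) uwp M2 p.1 p.2)) X).
  elim: s {hh1} => [|[y y'] s [h2 hh2]].
    exists 0 => X; rewrite big_nil.
    have -> : predual_val (0 : predual M2) = 0 *: (0 : dual (vn M2)) by rewrite scale0r.
    by rewrite rslice_scalef scale0r dual0.
  have [h3 hh3] := uwp_tensor x x' y y'; exists (h3 + h2) => X.
  rewrite big_cons -[LHS]/(h3 X + h2 X) hh3 hh2 -dualD; congr (uwf M1 x x' _).
  by rewrite -rslice_addf.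
exists (h2 + h1) => X; rewrite big_cons -[LHS]/(h2 X + h1 X) hh2 hh1.
by [].
Qed.

(** A functional with the defining property exists by [tensor_ex] and is unique by
    [predual_tensor_ext], so [predual_tensor] is not its default. *)
Lemma predual_tensorE (f : predual M1) (g : predual M2) X :
  predual_tensor t f g X = f (rslice (predual_val g) X).
Proof.
have [h hh] := tensor_ex f g; suff -> : predual_tensor t f g = h by exact: hh.
rewrite /predual_tensor; case: xgetP => [h' _ h'P|/(_ h)[]].
  apply: predual_tensor_ext => a b; rewrite hh rslice_elem dualZ mulrC.
  by apply: h'P => x y; rewrite votE.
move=> a b c abc; rewrite hh.
have -> : c = vot t a b by apply: vn_tens_eq => x y; rewrite votE abc.
by rewrite rslice_elem dualZ mulrC.
Qed.

End TensorExistence.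

(** * Weakly almost periodic functionals *)

Section NormalHomomorphisms.
Variables (R : realType) (H K : hilbertType R) (M : vnalg H) (N : vnalg K).
Variable Gamma : vn M -> vn N.
Hypotheses (homG : star_hom Gamma) (normalG : normal_map Gamma).

Lemma homD a b : Gamma (a + b) = Gamma a + Gamma b.
Proof. by case: homG => lG _ _; rewrite -[a]scale1r lG !scale1r. Qed.

Lemma homZ k a : Gamma (k *: a) = k *: Gamma a.
Proof.
have G0 : Gamma 0 = 0 by apply: (@addrI _ (Gamma 0)); rewrite -homD !addr0.
by case: homG => lG _ _; rewrite -[k *: a]addr0 lG G0 addr0.
Qed.

Lemma normal_hom_rep (h : predual N) :
  exists s : seq (ell2 H * ell2 H), forall a, h (Gamma a) = \sum_(p <- s) inner (amp a p.1) p.2.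
Proof.
apply: (@normal_rep _ _ M (fun a => h (Gamma a))).
  by move=> k a b; rewrite homD homZ dualD dualZ.
move=> a; apply: (@cvg_comp _ _ _ (Gamma : ultraweak M -> ultraweak N) (h : ultraweak N -> R[i]^o)).
  exact: normalG.
exact: predual_cont.
Qed.

(** The preadjoint of [Gamma], which is the functional sought by [conv]. *)
Lemma hom_predual (h : predual N) : exists k : predual M, forall a, k a = h (Gamma a).
Proof.
have [s sP] := normal_hom_rep h; exists (\sum_(p <- s) uwp M p.1 p.2) => a.
rewrite sP; elim: (s) => [|p c IH]; rewrite ?big_nil// !big_cons -IH//.
Qed.

(** Normality represents the vector functional at [x] composed with [Gamma] and so gives a crude
    bound for |Gamma b x| with constant sqrt C; [cstar_power] along b |-> b^* b removes the
    constant. *)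
Lemma norm_hom a : `|Gamma a| <= `|a|.
Proof.
apply: opnorm_le => // x.
have [s sP] := normal_hom_rep (vfp N x x).
pose C := \sum_(p <- s) `|p.1| * `|p.2|.
have C0 : 0 <= C by apply: sumr_ge0 => p _; exact: mulr_ge0.
have sqr b : `|Gamma b x| ^+ 2 = inner (Gamma (star b * b) x) x.
  by case: homG => _ GM Gs; rewrite GM Gs vnME starE inner_norm.
have nn b : `|star b * b| <= `|b| ^+ 2.
  by rewrite (le_trans (norm_vnM _ _))// expr2 ler_wpM2r// norm_star.
apply: (@cstar_power _ _ (fun b => star b * b) (fun b => `|Gamma b x|) (fun b => `|b|) _ (sqrtC C)) => //.
- by rewrite sqrtC_ge0.
- by move=> b; rewrite -[leLHS]ger0_norm ?exprn_ge0// sqr cauchy_schwarz.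
- by move=> b; exact: nn.
- move=> b; rewrite -(@ler_pXn2r _ 2)// ?nnegrE ?mulr_ge0 ?sqrtC_ge0//.
  rewrite exprMn sqrtCK sqr -vfpE sP -[leLHS]ger0_norm; last by rewrite -sP vfpE -sqr exprn_ge0.
  rewrite (le_trans (ler_norm_sum _ _ _))// mulr_suml ler_sum// => p _.
  rewrite (le_trans (inner_bop_le _ _ _))// -mulrA mulrC ler_wpM2l ?mulr_ge0//.
  by apply: le_trans (norm_amp _) _; exact: nn.
Qed.

End NormalHomomorphisms.

Section WeakCompactness.
Variables (R : realType) (H : hilbertType R) (M : vnalg H).
Local Notation W := (dual (predual M)).

Lemma weak_cvg (V : normedModType R[i]) (F : set_system V) (v : V) : Filter F ->
  F --> (v : weak V) <-> forall l : dual V, (fun u => l u : R[i]^o) @ F --> (l v : R[i]^o).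
Proof. exact: initial_ptws_cvg. Qed.

Lemma predual_evalE (a : vn M) (f : predual M) : predual_eval a f = f a. Proof. by []. Qed.

Lemma norm_predual_eval (a : vn M) : `|predual_eval a| <= `|a|.
Proof. by apply: opnorm_le => // f; rewrite mulrC; exact: (opnormP (predual_val f) a). Qed.

Lemma predual_eval_linear k (a b : vn M) :
  predual_eval (k *: a + b) = k *: predual_eval a + predual_eval b.
Proof. by apply: bop_eqP => f; exact: linearP. Qed.

Lemma predual_evalZ k (a : vn M) : predual_eval (k *: a) = k *: predual_eval a.
Proof. by apply: bop_eqP => f; exact: linearZ. Qed.

Lemma predual_eval_inj (a b : vn M) : predual_eval a = predual_eval b -> a = b.
Proof.
move=> ab; apply: vn_eq => x y; rewrite -!vfpE.
by have := congr1 (fun l : W => l (vfp M x y)) ab.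
Qed.

(** Together with [bidual_of_dual] it lets the weak topology on the dual of the predual be tested by
    functionals on [M]. *)
Lemma dual_of_bidual (L : dual W) : exists psi : dual (vn M), forall a, psi a = L (predual_eval a).
Proof.
have [|||psi [psiE _]] := @dual_ex _ (vn M) (fun a => L (predual_eval a)) `|L|.
- by move=> c a b; rewrite predual_eval_linear dualD dualZ.
- by [].
- by move=> a; rewrite (le_trans (dual_le _ _))// ler_wpM2l// norm_predual_eval.
by exists psi.
Qed.

Lemma bidual_of_dual (psi : dual (vn M)) : exists L : dual W, forall a, L (predual_eval a) = psi a.
Proof.
have [p pP] := choice (@predual_dual _ _ M).
have pK a : p (predual_eval a) = a by apply: predual_eval_inj; rewrite -(pP _).1.
have [|||L [LE _]] := @dual_ex _ W (fun l => psi (p l)) `|psi|.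
- move=> c l l'; have -> : p (c *: l + l') = c *: p l + p l'.
    by apply: predual_eval_inj; rewrite predual_eval_linear -!(pP _).1.
  by rewrite dualD dualZ.
- by [].
- by move=> l; rewrite (le_trans (dual_le _ _))// ler_wpM2l// (pP _).2.
by exists L => a; rewrite LE pK.
Qed.

Lemma bidual_point (f : predual M) : exists L : dual W, forall l, L l = l f.
Proof.
have [|||L [LE _]] := @dual_ex _ W (fun l => l f) `|f|; last by exists L.
- by [].
- by [].
- by move=> k; rewrite mulrC; exact: dual_le.
Qed.

Lemma weak_hausdorff : hausdorff_space (weak W).
Proof.
move=> l l' ll'; apply: bop_eqP => f; apply: eq_all_eps => e e0.
have [psi psiE] := bidual_point f.
have e2 : 0 < e / 2 by rewrite divr_gt0.
have nb (k : W) : nbhs (k : weak W) [set u : W | `|psi k - psi u| < e / 2].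
  have /(_ (@cvg_id _ _) psi) := (@weak_cvg W (nbhs (k : weak W)) k (@nbhs_filter (weak W) k)).1.
  by move=> /cvgrPdist_lt/(_ _ e2).
have [u [/= h1 h2]] := ll' _ _ (nb l) (nb l').
move: h1 h2; rewrite !psiE => h1 h2.
rewrite -[_ - _](subrKA (u f)) [leRHS]splitr (le_trans (ler_normD _ _))// lerD// ltW//.
by rewrite distrC.
Qed.

End WeakCompactness.

Section AlmostPeriodicity.
Variables (R : realType) (H K : hilbertType R) (t : hilbert_tensor H H K).
Variables (M : vnalg H) (Gamma : vn M -> vn (vn_tensor t M M)).
Hypotheses (homG : star_hom Gamma) (normalG : normal_map Gamma).
Local Notation W := (dual (predual M)).

Lemma convE (f g : predual M) a : conv Gamma f g a = f (rslice (predual_val g) (Gamma a)).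
Proof.
have [k kP] := hom_predual homG normalG (predual_tensor t f g).
rewrite -predual_tensorE /conv; case: xgetP => [k' _ -> //|/(_ k)[]]; exact: kP.
Qed.

(** For fixed psi, [WC] rewrites psi (rslice phi X) as phi (fslice psi X), so the slice map is
    continuous from the weak* topology to the weak one. The ball of the whole dual of [M] is taken
    because it is weak* compact. *)
Lemma WC_compact (X : vn (vn_tensor t M M)) : WC X ->
  compact ([set predual_eval (rslice phi X) | phi in [set phi : dual (vn M) | `|phi| <= 1]] : set (weak W)).
Proof.
move=> wX; rewrite compact_ultra => F FF FK.
have pF : ProperFilter F := ultra_proper.
have [c cP] : exists c : W -> dual (vn M), forall w,
    (exists2 phi : dual (vn M), `|phi| <= 1 & predual_eval (rslice phi X) = w) ->
    `|c w| <= 1 /\ predual_eval (rslice (c w) X) = w.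
  have ex w : exists phi : dual (vn M), (exists2 phi : dual (vn M), `|phi| <= 1 & predual_eval (rslice phi X) = w) ->
      `|phi| <= 1 /\ predual_eval (rslice phi X) = w.
    have [[phi h1 h2]|h] := pselect (exists2 phi : dual (vn M), `|phi| <= 1 & predual_eval (rslice phi X) = w).
      by exists phi.
    by exists 0.
  by have [c cP] := choice ex; exists c.
have [|phi [phiE phi1]] := @ulim_dual _ _ _ F c 1 FF ler01.
  by apply: (@filterS _ F _ _ _ _ FK) => w /cP[].
exists (predual_eval (rslice phi X)); split; first by exists phi.
apply/weak_cvg => L; have [psi psiE] := dual_of_bidual L.
apply/cvgrPdist_lt => e e0.
have ub : ubounded F (fun w => c w (fslice psi X)).
  exists (`|fslice psi X|); apply: (@filterS _ F _ _ _ _ FK) => w /cP[cw _] /=.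
  by rewrite (le_trans (dual_le _ _))// ler_piMl.
apply: filterS2 FK (ulimP FF ub e0) => w /cP[_ cw] /=.
by rewrite -phiE (wX psi phi) (wX psi (c w)) !psiE cw distrC.
Qed.

Lemma WC_WAP a : WC (Gamma a) -> WAP (conv Gamma) (predual_eval a).
Proof.
move=> wX; set X := Gamma a in wX.
have Tp : (fun f : predual M => predual_eval (rslice (predual_val f) X)) \in @bop_pred R (predual M) W.
  apply: (@bop_predP _ _ _ _ `|X|) => [k f g||f].
  - by rewrite -predual_eval_linear rslice_addf rslice_scalef.
  - by [].
  - by rewrite (le_trans (norm_predual_eval _))// mulrC norm_rslice.
exists (Bop Tp) => [f g|]; first by rewrite [RHS]convE.
have cK := WC_compact wX.
apply: (subclosed_compact (@closed_closure _ _) cK).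
(* The image of the dual ball is closed and contains that of the predual ball, hence also its
   closure. *)
have clK := compact_closed (@weak_hausdorff _ _ M) cK.
rewrite [X in _ `<=` X]((closure_id _).1 clK); apply: closure_subset => _ [f f1 <-].
by exists (predual_val f).
Qed.

(** Goldstine approximates phi by sums of vector functionals of bounded norm, and weak compactness
    gives their images under [T] a weak limit w. Testing w on vector functionals identifies it, up
    to the scaling [k], with the slice of X by phi. Testing it on psi, with [fubini_predual] for the
    approximants, gives the other iterated slice. *)
Lemma WAP_WC a : WAP (conv Gamma) (predual_eval a) -> WC (Gamma a).
Proof.
move=> [T TE Tc] psi phi; set X := Gamma a.
have TX f : T f = predual_eval (rslice (predual_val f) X).
  by apply: bop_eqP => g; rewrite TE [LHS]convE.
have [r r0 rE] : exists2 r : R, 0 < r & `|phi| + 1 = r%:C%C.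
  by apply: gt0_complexP; rewrite ltr_wpDl.
have rC : 0 < r%:C%C :> R[i] by rewrite ltcR.
have phir : `|phi| <= r%:C%C by rewrite -rE lerDl.
have [F [FF Fs FE]] := goldstine r0 phir.
pose k : R[i] := r%:C%C^-1.
have k0 : 0 < k by rewrite invr_gt0.
pose G : set_system (weak W) := (fun s => T (k *: vfpsum M s)) @ F.
have GU : UltraFilter G by exact: ultra_fmap.
have : G (closure ([set T v | v in [set v | `|v| <= 1]] : set (weak W))).
  have pF : ProperFilter F := ultra_proper.
  apply: (@filterS _ F _ _ _ _ Fs) => s ss /=; apply: subset_closure.
  exists (k *: vfpsum M s) => //=; rewrite normrZ gtr0_norm// mulrC ler_pdivrMr// mul1r.
  by rewrite predual_normE vfpsumE norm_vfsum// ltW.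
move: Tc; rewrite /weakly_compact compact_ultra => /(_ G GU)/[apply][[w [_ Gw]]].
have ub y : ubounded F (fun s => vfsum M s y).
  exists (r%:C%C * `|y|); apply: (@filterS _ F _ _ _ _ Fs) => s ss /=.
  by rewrite (le_trans (dual_le _ _))// ler_wpM2r// norm_vfsum// ltW.
have lim (L : dual W) y : (forall s, L (predual_eval (rslice (vfsum M s) X)) = vfsum M s y) ->
    L w = k * phi y.
  move=> Ly; rewrite FE -(ulimZ FF k (ub y)); apply/esym/(ulim_uniq FF) => e e0.
  have /cvgrPdist_lt/(_ e e0) := (@weak_cvg _ _ G w (@ultra_proper _ _ GU)).1 Gw L.
  apply: (@filterS _ F) => s /=; rewrite TX distrC.
  have -> : predual_val (k *: vfpsum M s) = k *: vfsum M s by rewrite -vfpsumE.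
  rewrite rslice_scalef predual_evalZ.
  by rewrite dualZ Ly.
have wE : w = predual_eval (k *: rslice phi X).
  apply: dual_predual_eq => x y; have [L LE] := bidual_point (vfp M x y).
  rewrite -LE (lim L (lslice X x y)) => [|s].
    by rewrite predual_evalE vfpE vnZE innerZl rsliceE.
  by rewrite LE predual_evalE vfpE rsliceE.
have [L LE] := bidual_of_dual psi.
have := lim L (fslice psi X); rewrite wE LE dualZ => h.
by apply/esym/(mulfI (lt0r_neq0 k0))/h => s; rewrite LE -vfpsumE fubini_predual.
Qed.

End AlmostPeriodicity.

Theorem corollary3p4 (R : realType) (H K L : hilbertType R)
  (t : hilbert_tensor H H K)
  (tl : hilbert_tensor K H L) (tr : hilbert_tensor H K L)
  (t_assoc : tens_assoc t tl tr)
  (M : vnalg H) (Gamma : vn M -> vn (vn_tensor t M M)) :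
  hopf_vn tl tr Gamma ->
  subhomogeneous M ->
  cstar_subalgebra [set a : vn M | WAP (conv Gamma) (predual_eval a)].
Proof.
move=> [homG _ _ normalG _] sM.
have WAPE : [set a : vn M | WAP (conv Gamma) (predual_eval a)] = [set a | WC (Gamma a)].
  by apply/seteqP; split=> a /=; [exact: WAP_WC | exact: WC_WAP].
have [_ GM Gstar] := homG; have GD := homD homG; have GZ := homZ homG.
rewrite WAPE; split=> [|c a b|a b|a|a] /=.
- by rewrite -[0](scale0r (0 : vn M)) GZ scale0r; exact: WC0.
- by move=> wa wb; rewrite GD GZ; apply: WCD => //; exact: WCZ.
- move=> wa wb; rewrite GM -[Gamma a]starK; apply: WC_starM => //; exact: WC_star.
- by rewrite Gstar; exact: WC_star.
(* Closedness: [Gamma] is contractive, so norm approximants of [a] become norm approximants of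
   [Gamma a]. *)
move=> cl; apply: WC_approx => e e0.
have [b [/= wb]] := cl _ (nbhsx_ballx a _ e0).
rewrite -ball_normE/= => ab; exists (Gamma b) => //.
rewrite -[- Gamma b]scaleN1r -GZ -GD scaleN1r.
by rewrite (le_trans (norm_hom homG normalG _))// ltW.
Qed.
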